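(* For any given positive integers $a, b, k$ and nonnegative integer $k'$, there are only finitely many pairs of odd positive integers $M, N$ satisfying $\sigma(N)=aM$, $\sigma(M)=bN$, $\omega_1(N)\leq k'$ and $\omega(M)\leq k$. Moreover, there is an effectively computable constant $C_2(a,b,k,k')$, depending only on $a,b,k,k'$, such that all such $M, N$ satisfy $M, N\leq C_2(a,b,k,k')$.
   Context: $\sigma(n)$ denotes the sum of the positive divisors of a positive integer $n$; $\omega(n)$ denotes the number of distinct prime factors of $n$; $\omega_1(n)$ denotes the number of primes dividing $n$ exactly once, i.e. the number of primes $p$ with $p\mid n$ and $p^2\nmid n$. ''Effectively computable constant'' means that the constant can be given by a computable function of its arguments. *)

(* Defs.v *)
From mathcomp Require Import all_boot.
From mathcomp Require Import boolp classical_sets functions cardinality.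

Set Implicit Arguments.
Unset Strict Implicit.
Unset Printing Implicit Defensive.

Definition sigma (n : nat) : nat := \sum_(d <- divisors n) d.

Definition omega (n : nat) : nat := size (primes n).

Definition omega1 (n : nat) : nat :=
  count (fun p => ~~ (p ^ 2 %| n)) (primes n).

(* Positivity of M and N is implied by oddness. *)
Definition admissible_pair (a b k k' M N : nat) : Prop :=
  [/\ odd M /\ odd N, sigma N = a * M, sigma M = b * N,
      omega1 N <= k' & omega M <= k].

(* Kleene's (partial) mu-recursive functions, by arity. *)
Inductive recfun : nat -> Type :=
| RZero : recfun 0
| RSucc : recfun 1
| RProj n (i : 'I_n) : recfun n
| RComp m n (f : recfun m) (g : 'I_m -> recfun n) : recfun n
| RPrim n (f : recfun n) (g : recfun n.+2) : recfun n.+1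
| RMin n (f : recfun n.+1) : recfun n.

(* [eval f x z] : the partial function coded by [f] is defined at [x], with
   value [z].  Primitive recursion is on the first argument:
   h (0, x) = f x and h (i + 1, x) = g (i, h (i, x), x).  [RMin f] is the
   least [z] with f (z, x) = 0, all earlier values being defined. *)
Fixpoint eval n (f : recfun n) : n.-tuple nat -> nat -> Prop :=
  match f in recfun n return n.-tuple nat -> nat -> Prop with
  | RZero => fun _ z => z = 0
  | RSucc => fun x z => z = (thead x).+1
  | RProj _ i => fun x z => z = tnth x i
  | RComp m _ f g => fun x z =>
      exists y : m.-tuple nat,
        (forall i, eval (g i) x (tnth y i)) /\ eval f y z
  | RPrim _ f g => fun x z =>
      let x' := [tuple of behead x] in
      (fix prim i z : Prop :=
         if i is j.+1 then
           exists y, prim j y /\ eval g [tuple of [:: j, y & x']] z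
         else eval f x' z) (thead x) z
  | RMin _ f => fun x z =>
      eval f [tuple of z :: x] 0 /\
      (forall i, i < z -> exists y, eval f [tuple of i :: x] y.+1)
  end.

Lemma eval_functional n (f : recfun n) x z z' :
  eval f x z -> eval f x z' -> z = z'.
Proof.
elim: f x z z' => {n}
  [||n j|m n f IHf g IHg|n f IHf g IHg|n f IHf] /=; try by move=> x z z' -> ->.
- move=> x z z' [y [gy fy]] [y' [gy' fy']].
  suff eyy' : y = y' by apply: IHf fy _; rewrite eyy'.
  by apply: eq_from_tnth => i; apply: IHg (gy i) (gy' i).
- move=> x; elim: (thead x) => [|j IHj] z z' /=; first exact: IHf.
  move=> [y [hy gz]] [y' [hy' gz']]; rewrite -(IHj _ _ hy hy') in gz'.
  exact: IHg gz gz'.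
- move=> x z z' [fz ltz] [fz' ltz'].
  case: (ltngtP z z') => // [/ltz'|/ltz] [y fy].
    by have := IHf _ _ _ fz fy.
  by have := IHf _ _ _ fz' fy.
Qed.

Definition computable n (F : n.-tuple nat -> nat) : Prop :=
  exists f : recfun n, forall x, eval f x (F x).

(* Main.v *)
(** Call the prime powers exactly dividing M or N components.  If q^f is a
    component of N with f odd then sigma (q^f) is even; as M is odd, there are at
    most a such q.  If f is even then F = f + 1 is odd and
    rep q F = (q^F - 1) / (q - 1) is composed of a bounded number K of odd primes,
    those of a M.  Two facts bound the number of such q.
    - Baker's theorem on linear forms in logarithms of integers: among the q <= 2^h
      there are at most 2 K^2 with F larger than a fixed power of h, since K + 1
      of the numbers rep q F with a common largest prime satisfy a multiplicative
      relation, that is, a linear form in the ln q and ln (q - 1) which is tiny but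
      nonzero.
    - A Thue-Pade argument: if the primes of rep q F are all at most X, then F is
      bounded in terms of X, and two such q in the same class (same F, same residues
      modulo the primes up to X, nearly the same exponents) cannot be far apart.
    If no p and no p^e of a component lies in an interval ]x, G x], with G growing
    fast, Dickson's argument shows that all components are at most x.  In an interval
    that is long compared with its left end X and avoids the components of M and the
    components of N with f odd, either some window ]x, G x] is free of components, or
    every window contains a component of N with f even, which makes too many widely
    spaced primes q for the two facts above. *)

(* The obstacle is that the number of primes of [M] is bounded but not their size, while the number
   of primes of [N] is not bounded in advance. Baker's theorem is applied to relations from which
   the primes of [a M] have been eliminated, so their size enters only through heights; grouping the
   [q] by the largest prime of [rep q F] serves to control these. It says nothing about short
   exponents [F]. There Thue's method takes over: [q] is a root of [y^F = 1] modulo [rep q F], and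
   polynomials [A], [B] such that [A(x) - y B(x)] vanishes to high order at [x = y] for these roots
   [y] are evaluated at one solution and at a much larger one. As always with this method, it bounds
   the number of widely spaced solutions and not their size. That is enough, since Dickson's
   argument needs just one window without components and this window is found by counting; so the
   result stays effective. The number of windows to be provided depends on the left end [X] of an
   interval, whence the enormous lengths: a tower whose height is itself a tower in [X]. *)
Require Import Defs.
From mathcomp Require Import all_boot all_order all_algebra all_field cyclic.
From mathcomp Require Import boolp classical_sets functions cardinality.
From mathcomp Require Import topology normedtype sequences reals Rstruct exp.
From mathcomp Require Import zify ring lra.

Set Implicit Arguments.
Unset Strict Implicit.
Unset Printing Implicit Defensive.
Import Order.TTheory GRing.Theory Num.Theory.
Import numFieldNormedType.Exports.

(** * Siegel's lemma *)

Section Siegel.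
Local Open Scope ring_scope.

Lemma siegel (I J : finType) (a : I -> J -> int) (A X : nat) :
  (forall i j, `|a i j| <= A)%N ->
  ((#|J| * A * X).+1 ^ #|I| < X.+1 ^ #|J|)%N ->
  exists x : J -> int, [/\ exists j, x j != 0, forall j, (`|x j| <= X)%N &
    forall i, \sum_j a i j * x j = 0].
Proof.
move=> leA ltX.
(* [- neg i] is the least value of the [i]-th form on the box [[0, X]^J]: after this shift every
   form takes values between 0 and [#|J| * A * X], whatever the signs of its coefficients. *)
pose neg i : nat := (\sum_j (if (a i j < 0)%R then `|a i j|%N * X else 0))%N.
pose S i (y : {ffun J -> 'I_X.+1}) : int := \sum_j a i j * (y j : nat)%:Z.
have Sbnd i y : 0 <= S i y + (neg i)%:Z <= (#|J| * A * X)%:Z.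
  rewrite /S /neg -(natz (\sum_j _)%N) natr_sum -mulnA PoszM -(natz #|J|).
  rewrite -sum1_card (natr_sum _ _ xpredT _) mulr_suml -big_split /= PoszM.
  have bnd j : 0 <= a i j * (y j : nat)%:Z +
      (if (a i j < 0)%R then `|a i j|%N * X else 0)%:R <= 1 * (A%:Z * X%:Z).
    have := leA i j; have := ltn_ord (y j); set z := nat_of_ord _.
    case: ifP => h hz hA; apply/andP; split; nia.
  apply/andP; split; first by apply: sumr_ge0 => j _; case/andP: (bnd j).
  by apply: ler_sum => j _; case/andP: (bnd j).
pose phi (y : {ffun J -> 'I_X.+1}) : {ffun I -> 'I_(#|J| * A * X).+1} :=
  [ffun i => inord `|(S i y + (neg i)%:Z)%R|%N].
have /injectivePn[y [y' neyy' eyy']] : ~~ injectiveb phi.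
  apply/negP => /injectiveP /leq_card; rewrite !card_ffun !card_ord leqNgt.
  by rewrite ltX.
exists (fun j => (y j : nat)%:Z - (y' j : nat)%:Z); split.
- have [/existsP[j hj]|] := boolP [exists j, y j != y' j].
    by exists j; rewrite subr_eq0; apply: contraNneq hj => -[?]; apply/eqP/val_inj.
  by rewrite negb_exists => /forallP h; case/eqP: neyy'; apply/ffunP => j;
    have := h j; rewrite negbK => /eqP.
- by move=> j; have := ltn_ord (y j); have := ltn_ord (y' j); lia.
- move=> i; have /ffunP/(_ i) := eyy'; rewrite !ffunE => /(congr1 val) /=.
  have [/andP[h1 h2] /andP[h3 h4]] := (Sbnd i y, Sbnd i y').
  have abs1 y0 : (`|(S i y0 + (neg i)%:Z)%R|%N < (#|J| * A * X).+1)%N.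
    by have /andP[h5 h6] := Sbnd i y0; lia.
  rewrite (inordK (abs1 y)) (inordK (abs1 y')) => h.
  under eq_bigr do rewrite mulrBr.
  rewrite big_split /= sumrN -/(S i y) -/(S i y').
  lia.
Qed.

End Siegel.

(** * A Schwarz lemma for polynomials *)

Section Schwarz.
Local Open Scope ring_scope.
Variable R : realFieldType.
Implicit Types (phi psi : {poly R}) (rho x a : R).

(** Stands in for the maximum of [phi] on the disc of radius [rho]: it dominates the values there
    and behaves well under division by [X - a], so that no complex analysis is needed. *)
Definition wnorm rho phi := \sum_(i < size phi) `|phi`_i| * rho ^+ i.

Lemma wnormE rho phi n : (size phi <= n)%N ->
  wnorm rho phi = \sum_(i < n) `|phi`_i| * rho ^+ i.
Proof.
move=> le_n; rewrite /wnorm (big_ord_widen _ (fun i => `|phi`_i| * rho ^+ i) le_n).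
rewrite big_mkcond; apply: eq_bigr => i _; case: ltnP => // h.
by rewrite nth_default ?normr0 ?mul0r.
Qed.

Lemma wnormD rho phi psi : 0 <= rho ->
  wnorm rho (phi + psi) <= wnorm rho phi + wnorm rho psi.
Proof.
move=> rho0; have le1 := leq_maxl (size phi) (size psi).
have le2 := leq_maxr (size phi) (size psi).
rewrite (wnormE _ (size_polyD _ _)) (wnormE _ le1) (wnormE _ le2) -big_split /=.
apply: ler_sum => i _; rewrite -mulrDl ler_wpM2r ?exprn_ge0 // coefD.
exact: ler_normD.
Qed.

Lemma wnorm_sum rho (I : finType) (F : I -> {poly R}) : 0 <= rho ->
  wnorm rho (\sum_i F i) <= \sum_i wnorm rho (F i).
Proof.
move=> rho0; elim/big_rec2: _ => [|i y1 y2 _ IH].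
  by rewrite /wnorm size_poly0 big_ord0.
by apply: (le_trans (wnormD _ _ rho0)); rewrite lerD2l.
Qed.

Lemma wnormZ rho c phi : wnorm rho (c *: phi) = `|c| * wnorm rho phi.
Proof.
rewrite (wnormE rho (size_scale_leq c phi)) mulr_sumr.
by apply: eq_bigr => i _; rewrite coefZ normrM mulrA.
Qed.

Lemma horner_wnorm rho phi x : `|x| <= rho -> `|phi.[x]| <= wnorm rho phi.
Proof.
move=> le_x; rewrite horner_coef; apply: (le_trans (ler_norm_sum _ _ _)).
apply: ler_sum => i _; rewrite normrM normrX ler_wpM2l ?normr_ge0 //.
by rewrite lerXn2r ?nnegrE ?normr_ge0 // (le_trans _ le_x) ?normr_ge0.
Qed.

(** Comparing coefficients, [psi_i = phi_(i+1) + a psi_(i+1)], hence [rho |psi| <= |phi| + a |psi|]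
    in this norm, and [a <= rho / 2] absorbs the last term. *)
Lemma wnorm_quotient rho phi psi a : 0 <= a <= rho / 2 -> 0 < rho ->
  phi - phi.[a]%:P = psi * ('X - a%:P) ->
  wnorm rho psi <= 2 / rho * wnorm rho phi.
Proof.
move=> /andP[a0 ale] rho0 def_phi.
have coef_eq i : psi`_i = phi`_i.+1 + a * psi`_i.+1.
  have := congr1 (fun p : {poly R} => p`_i.+1) def_phi.
  rewrite mulrBr !coefE /= subr0 => ->.
  by rewrite mulrC subrK.
have [n [le1 le2]] : exists n, (size phi <= n.+1)%N /\ (size psi <= n)%N.
  by exists (maxn (size phi) (size psi)); rewrite leqW ?leq_maxl ?leq_maxr.
have le_sum : rho * wnorm rho psi <= wnorm rho phi + a * wnorm rho psi.
  rewrite (wnormE rho le1) (wnormE rho le2) big_ord_recl /= -addrA ler_wpDl //.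
    by rewrite mulr_ge0 ?normr_ge0 ?exprn_ge0 ?ltW.
  have -> : \sum_(i < n) `|psi`_i| * rho ^+ i = \sum_(i < n.+1) `|psi`_i| * rho ^+ i.
    by rewrite -(wnormE rho le2) (wnormE rho (leqW le2)).
  rewrite [X in _ <= _ + a * X]big_ord_recl mulrDr addrCA ler_wpDl //.
    by apply: mulr_ge0 => //; apply: mulr_ge0; rewrite ?normr_ge0 ?exprn_ge0 ?ltW.
  rewrite big_ord_recr /= [psi`_n]nth_default // normr0 mul0r addr0.
  rewrite !mulr_sumr -big_split /=; apply: ler_sum => i _.
  rewrite coef_eq mulrCA -exprS mulrA -mulrDl ler_wpM2r ?exprn_ge0 ?(ltW rho0) //.
  by apply: (le_trans (ler_normD _ _)); rewrite normrM (ger0_norm a0).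
have w0 : 0 <= wnorm rho psi.
  by apply: sumr_ge0 => i _; rewrite mulr_ge0 ?normr_ge0 ?exprn_ge0 ?ltW.
by rewrite mulrAC ler_pdivlMr //; nra.
Qed.

(* Divide out the roots in [s] one at a time: each division by [X - a] costs a
   factor [2 / rho] in the norm, here with [rho = 4 R']. *)
Lemma schwarz (s : seq nat) : forall (T R' x : nat) (eps : R) phi,
  (0 < T)%N -> (0 < R')%N -> (x < R')%N -> 0 <= eps ->
  (forall c, c \in s -> (c < R')%N) -> (forall c, (count_mem c s <= T)%N) ->
  (forall c j, (j < count_mem c s)%N -> `|phi^`N(j).[c%:R]| <= eps) ->
  `|phi.[x%:R]| <= eps * (1 + 2 * T%:R * R'%:R) ^+ size s
     + 2 ^- size s * wnorm (4 * R'%:R) phi.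
Proof.
elim: s => [|a s IHs] T R' x eps phi T0 R'0 ltx eps0 lts countT data /=.
  rewrite expr0 mulr1 invr1 mul1r ler_wpDl //; apply: horner_wnorm.
  have : (x%:R : R) <= R'%:R by rewrite ler_nat ltnW.
  have : 0 <= (x%:R : R) by rewrite ler0n.
  by rewrite normr_nat; lra.
have /factor_theorem[psi def_phi] : root (phi - phi.[a%:R]%:P) a%:R.
  by rewrite /root !hornerE subrr.
have phi_a : `|phi.[a%:R]| <= eps.
  by have := data a 0%N; rewrite nderivn0 /= eqxx add1n; apply.
have ltaR : (a < R')%N by apply: lts; rewrite mem_head.
have le_aR : (a%:R : R) <= R'%:R by rewrite ler_nat ltnW.
have R'0' : 0 < (R'%:R : R) by rewrite ltr0n.
have T1 : 1 <= (T%:R : R) by rewrite ler1n.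
have psi_j c j : phi^`N(j.+1).[c] = psi^`N(j).[c] + (c - a%:R) * psi^`N(j.+1).[c].
  move/eqP: def_phi; rewrite subr_eq => /eqP ->.
  rewrite nderivnD nderivnC addr0 mulrBr nderivnB.
  rewrite -[psi * 'X]addr0 -polyC0 nderivnMXaddC.
  rewrite -[psi * _%:P]mulrC mul_polyC nderivnZ !hornerE.
  by ring.
(* At [c = a] the Hasse derivative of order [j] of [psi] is that of order [j + 1] of [phi].
   Elsewhere [|c - a| >= 1], both being integers, and [psi_j] gives the bound [(j + 2) eps] by
   induction on [j]; finally [j + 2 <= 2 T]. *)
have data' c j : (j < count_mem c s)%N -> `|psi^`N(j).[c%:R]| <= (2 * T%:R) * eps.
  have [->|neca] := eqVneq c a.
    move=> ltj; have := data a j.+1; rewrite /= eqxx ltnS => /(_ ltj).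
    by rewrite psi_j subrr mul0r addr0 => /le_trans; apply; nra.
  move=> ltj; have ltjT : (j < T)%N.
    by apply: leq_trans ltj (leq_trans _ (countT c)); rewrite /= leq_addl.
  suff : `|psi^`N(j).[c%:R]| <= (j.+2)%:R * eps.
    move/le_trans; apply; apply: ler_wpM2r => //.
    by rewrite -natrM ler_nat; lia.
  have ca1 : 1 <= `|c%:R - a%:R : R|.
    have /orP[ltca|ltca] : (c < a)%N || (a < c)%N by rewrite -neq_ltn.
      by rewrite distrC -natrB ?(ltnW ltca) // normr_nat ler1n subn_gt0.
    by rewrite -natrB ?(ltnW ltca) // normr_nat ler1n subn_gt0.
  elim: j ltj {ltjT} => [|j IHj] ltj.
    have := data c 0%N; rewrite !nderivn0 /= (leq_trans ltj) ?leq_addl //.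
    move/(_ isT).
    have -> : phi.[c%:R] = phi.[a%:R] + psi.[c%:R] * (c%:R - a%:R).
      by move/eqP: def_phi; rewrite subr_eq => /eqP {1}->; rewrite !hornerE addrC.
    move=> h; have : `|psi.[c%:R] * (c%:R - a%:R)| <= 2 * eps.
      have -> : psi.[c%:R] * (c%:R - a%:R) =
        (phi.[a%:R] + psi.[c%:R] * (c%:R - a%:R)) - phi.[a%:R] by ring.
      apply: (le_trans (ler_normB _ _)); lra.
    by rewrite normrM; have := normr_ge0 psi.[c%:R]; nra.
  have := IHj (ltnW ltj); have := data c j.+1.
  rewrite /= (leq_trans ltj) ?leq_addl // => /(_ isT).
  move=> h1 h2; have : `|(c%:R - a%:R) * psi^`N(j.+1).[c%:R]| <= j.+3%:R * eps.
    have -> : (c%:R - a%:R) * psi^`N(j.+1).[c%:R] =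
      phi^`N(j.+1).[c%:R] - psi^`N(j).[c%:R] by rewrite psi_j; ring.
    apply: (le_trans (ler_normB _ _)).
    by rewrite -[j.+3%:R]natr1 mulrDl mul1r addrC lerD.
  by rewrite normrM; have := normr_ge0 psi^`N(j.+1).[c%:R]; nra.
have eps'0 : 0 <= 2 * T%:R * eps by rewrite !mulr_ge0 ?ler0n.
have := IHs T R' x _ psi T0 R'0 ltx eps'0 _ _ data'.
have lts' c : c \in s -> (c < R')%N by move=> cs; apply: lts; rewrite in_cons cs orbT.
have countT' c : (count_mem c s <= T)%N by apply: leq_trans (countT c); rewrite /= leq_addl.
move=> /(_ lts' countT') IH.
have -> : phi.[x%:R] = phi.[a%:R] + psi.[x%:R] * (x%:R - a%:R).
  by move/eqP: def_phi; rewrite subr_eq => /eqP {1}->; rewrite !hornerE addrC.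
apply: (le_trans (ler_normD _ _)); rewrite normrM.
have xa : `|x%:R - a%:R| <= (R'%:R : R).
  have [x0 xR] : (0 <= (x%:R : R)) /\ (x%:R : R) <= R'%:R by rewrite ler0n ler_nat ltnW.
  have a0 : 0 <= (a%:R : R) by rewrite ler0n.
  by rewrite ler_norml; lra.
have := @wnorm_quotient (4 * R'%:R) phi psi a%:R.
have -> : 0 <= (a%:R : R) <= 4 * R'%:R / 2 by rewrite ler0n /=; lra.
have -> : 0 < (4 * R'%:R : R) by lra.
move=> /(_ isT isT def_phi) wpsi.
set W := 1 + 2 * T%:R * R'%:R in IH *.
have W1 : 1 <= W ^+ size s by rewrite exprn_ege1 // /W; nra.
rewrite exprS exprS invfM.
set Ws := W ^+ size s in IH W1 *; set D := 2 ^- size s in IH *.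
have D0 : 0 <= D by rewrite invr_ge0 exprn_ge0.
have step : `|psi.[x%:R]| * `|x%:R - a%:R| <=
   (2 * T%:R * eps * Ws + D * (2 / (4 * R'%:R) * wnorm (4 * R'%:R) phi)) * R'%:R.
  apply: ler_pM; rewrite ?normr_ge0 //; apply: (le_trans IH).
  by rewrite lerD2l ler_wpM2l.
have eqD : D * (2 / (4 * R'%:R) * wnorm (4 * R'%:R) phi) * R'%:R
  = 2^-1 * D * wnorm (4 * R'%:R) phi by field; rewrite gt_eqF.
apply: (le_trans (lerD phi_a step)); rewrite mulrDl eqD addrA lerD2r /W.
have : eps <= eps * Ws by rewrite ler_peMr.
by move=> h; apply: (le_trans (lerD h (lexx _))); rewrite le_eqVlt; apply/orP; left; apply/eqP; ring.
Qed.

End Schwarz.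

(** * Linear forms in logarithms of integers *)

Section TruncatedExp.
Local Open Scope ring_scope.
Variable R : realType.

Definition pexp D (y : R) := \sum_(i < D) y ^+ i / i`!%:R.
(** Truncation of [exp (th X)]: [schwarz] is about polynomials, so exponentials enter through
    truncations whose degree is taken large enough. *)
Definition texp D (th : R) : {poly R} := \poly_(i < D) (th ^+ i / i`!%:R).

Lemma texp_nderivn D th j c : (j <= D)%N ->
  (texp D th)^`N(j).[c] = th ^+ j / j`!%:R * pexp (D - j) (th * c).
Proof.
move=> lejD.
have le_size : (size (texp D th)^`N(j) <= D - j)%N.
  apply/leq_sizeP => i lei; rewrite coef_nderivn coef_poly ifF ?mul0rn //.
  by apply/negbTE; rewrite -leqNgt; lia.
rewrite (horner_coef_wide _ le_size) /pexp mulr_sumr; apply: eq_bigr => i _.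
rewrite coef_nderivn coef_poly ifT; last by have := ltn_ord i; lia.
have := @bin_fact (j + i) j (leq_addr i j); rewrite addnC addnK => hfact.
have : ((j + i)`! %:R : R) = 'C(i + j, j)%:R * (j`!%:R * i`!%:R).
  by rewrite -!natrM hfact addnC.
have [f1 f2] : j`!%:R != 0 :> R /\ i`!%:R != 0 :> R.
  by rewrite !pnatr_eq0 -!lt0n !fact_gt0.
rewrite addnC => ->; rewrite exprMn exprD -mulr_natr.
have f3 : 'C(i + j, j)%:R != 0 :> R by rewrite pnatr_eq0 -lt0n bin_gt0 leq_addl.
by field; rewrite f1 f2 f3.
Qed.

Lemma pexp_cvg (y eta : R) : 0 < eta ->
  exists D0, forall D, (D0 <= D)%N -> `|pexp D y - expR y| <= eta.
Proof.
move=> eta0.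
have /cvgrPdist_le/(_ _ eta0)[D0 _ h] :
    (series (exp_coeff y) @ \oo --> expR y)%classic by exact: is_cvg_series_exp_coeff.
exists D0 => D leD; have := h D leD.
by rewrite distrC /series /= /pexp big_mkord /exp_coeff.
Qed.

Lemma pexp_cvg_fin (I : finType) (y : I -> R) (eta : R) : 0 < eta ->
  exists D0, forall D i, (D0 <= D)%N -> `|pexp D (y i) - expR (y i)| <= eta.
Proof.
move=> eta0; have [f hf] := choice (fun i => pexp_cvg (y i) eta0).
exists (\max_i f i)%N => D i leD; apply: hf.
by apply: leq_trans leD; apply: leq_bigmax.
Qed.

Lemma pexp_le D (y : R) : 0 <= y -> pexp D y <= expR y.
Proof.
move=> y0; rewrite leNgt; apply/negP => lt.
have d0 : 0 < (pexp D y - expR y) / 2 by lra.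
have [D0 h] := pexp_cvg y d0; have := h _ (leq_maxr D D0).
have : pexp D y <= pexp (maxn D D0) y.
  rewrite /pexp (big_ord_widen _ (fun i => y ^+ i / i`!%:R) (leq_maxl D D0)).
  rewrite big_mkcond; apply: ler_sum => i _; case: ifP => // _.
  by rewrite mulr_ge0 ?exprn_ge0 ?invr_ge0.
by rewrite ler_norml => h1 /andP[h2 h3]; lra.
Qed.

Lemma wnorm_texp D th rho : 0 <= rho -> wnorm rho (texp D th) <= expR (`|th| * rho).
Proof.
move=> rho0; rewrite (wnormE _ (size_poly _ _)); apply: le_trans (pexp_le D _); last first.
  by rewrite mulr_ge0.
rewrite le_eqVlt; apply/orP; left; apply/eqP; apply: eq_bigr => i _.
rewrite coef_poly ltn_ord normrM normrX exprMn normfV normr_nat.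
by rewrite mulrAC.
Qed.

Lemma expR_le_inv (d : R) : 0 <= d <= 2^-1 -> expR d <= 1 + 2 * d.
Proof.
move=> /andP[d0 d1]; have h2 := expR_ge1Dx (- d).
have h3 : expR d * expR (- d) = 1 by rewrite -expRD subrr expR0.
have h4 := expR_gt0 d; have h5 : 0 < 1 - d by lra.
rewrite -(ler_pM2r h5); have h6 : 0 <= d * (1 - 2 * d) by apply: mulr_ge0 => //; lra.
apply: (@le_trans _ _ 1); last by lra.
by rewrite -h3 ler_pM2l //; lra.
Qed.

Lemma expR_sub_le (x y : R) : `|x - y| <= 2^-1 ->
  `|expR x - expR y| <= expR y * (2 * `|x - y|).
Proof.
move=> le1; have -> : expR x - expR y = expR y * (expR (x - y) - 1).
  by rewrite mulrBr mulr1 -expRD [y + _]addrC subrK.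
rewrite normrM gtr0_norm ?expR_gt0 // ler_wpM2l ?expR_ge0 //.
set d := x - y in le1 *; have h1 := expR_ge1Dx d.
have [d0|d0] := lerP 0 d.
  rewrite (ger0_norm d0) in le1 *; rewrite ger0_norm; last by lra.
  by have := @expR_le_inv d; rewrite d0 le1 => /(_ isT); lra.
rewrite (ltr0_norm d0); rewrite ler0_norm; first by lra.
by rewrite subr_le0 expR_le1 ltW.
Qed.

Lemma expR_le_pow4 (n : nat) (x : R) : x <= n%:R -> expR x <= 4 ^+ n.
Proof.
move=> lex; apply: (@le_trans _ _ (expR n%:R)); first by rewrite ler_expR.
rewrite -[n%:R]mulr1 expRM_natl lerXn2r ?nnegrE ?expR_ge0 //.
have -> : (1 : R) = 2^-1 + 2^-1 by field.
have := @expR_le_inv 2^-1; rewrite lexx invr_ge0 ler0n => /(_ isT).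
by rewrite expRD; have := expR_gt0 (2^-1 : R); nra.
Qed.

End TruncatedExp.

(** * Baker's auxiliary function and its extrapolation *)

Section Extrapolation.
Local Open Scope ring_scope.
Variables (R : realType) (n L1 : nat) (i0 : 'I_n.+1).
Variables (alpha : 'I_n.+1 -> nat) (b : 'I_n.+1 -> int).
Hypothesis alpha_gt0 : forall i, (0 < alpha i)%N.
Hypothesis bi0 : b i0 != 0.

Notation box := {ffun 'I_n.+1 -> 'I_L1}.

Definition linform : R := \sum_i (b i)%:~R * ln (alpha i)%:R.

(* With log alpha_{i0} eliminated through the linear form, the exponents of the
   remaining logarithms become [gam lam r / b i0]. *)
Definition gam (lam : box) (r : 'I_n) : int :=
  b i0 * (lam (lift i0 r) : nat)%:Z - b (lift i0 r) * (lam i0 : nat)%:Z.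
Definition mon (m : 'I_n -> nat) (lam : box) : int := \prod_r gam lam r ^+ m r.
Definition apow (lam : box) : nat := (\prod_i alpha i ^ lam i)%N.
(** Up to powers of logarithms and of [b i0], a partial derivative of order [m] of Baker's auxiliary
    function at the diagonal point [(l, ..., l)], with [expR (th lam * l)] replaced by
    [apow lam ^ l]. The replacement makes it an integer, and changes little when [linform] is
    small. *)
Definition aux (p : box -> int) (m : 'I_n -> nat) (l : nat) : int :=
  \sum_lam p lam * mon m lam * (apow lam ^ l)%:Z.

(* Up to a multiple of [linform], [ps] is the logarithm of [apow lam] and [th] is
   what remains of it when log alpha_{i0} is eliminated. *)
Definition ps (lam : box) : R := \sum_i (lam i : nat)%:R * ln (alpha i)%:R.
Definition th (lam : box) : R :=
  (\sum_r (gam lam r)%:~R * ln (alpha (lift i0 r))%:R) / (b i0)%:~R.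

Lemma apow_gt0 lam : (0 < apow lam)%N.
Proof. by apply: prodn_gt0 => i; rewrite expn_gt0 alpha_gt0. Qed.

Lemma expR_ps lam : expR (ps lam) = (apow lam)%:R.
Proof.
rewrite /ps expR_sum /apow natr_prod; apply: eq_bigr => i _.
by rewrite expRM_natl lnK ?natrX // posrE ltr0n.
Qed.

Lemma th_ps lam : ps lam - th lam = (lam i0 : nat)%:R * linform / (b i0)%:~R.
Proof.
have b0 : (b i0)%:~R != 0 :> R by rewrite intr_eq0.
apply: (mulIf b0); rewrite mulrBl /th !divfK //.
rewrite /ps /linform !(bigD1_ord i0 (P := xpredT)) //=.
rewrite mulrDl mulrDr mulr_suml mulr_sumr -addrA -sumrN -!big_split /=.
congr (_ + _); first by ring.
by apply: eq_bigr => r _; rewrite /gam rmorphB !rmorphM /=; ring.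
Qed.

(** The factors [th lam ^ j] arise as the [j]-th derivative of a sum of exponentials
    [exp (th lam z)]. Now [th lam] is a combination of the [gam lam r] with coefficients independent
    of [lam], so each such factor raises the total order of [mon] by one; they are removed one at a
    time. *)
Lemma aux_shift p j m l :
  (forall m', (\sum_r m' r < \sum_r m r + j.+1)%N -> aux p m' l = 0) ->
  \sum_lam (p lam)%:~R * (mon m lam)%:~R * th lam ^+ j * (apow lam ^ l)%:R = 0 :> R.
Proof.
elim: j m => [|j IHj] m aux0.
  have := aux0 m; rewrite addn1 ltnSn => /(_ isT) /(congr1 (fun z : int => z%:~R : R)).
  rewrite rmorph_sum rmorph0 => e; rewrite -[RHS]e; apply: eq_bigr => lam _.
  by rewrite expr0 mulr1 !rmorphM.
rewrite (eq_bigr (fun lam => \sum_r (ln (alpha (lift i0 r))%:R / (b i0)%:~R) *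
  ((p lam)%:~R * (mon (fun r' => m r' + (r' == r)) lam)%:~R * th lam ^+ j *
   (apow lam ^ l)%:R))) => [|lam _]; last first.
  rewrite exprSr {2}/th !mulrA mulr_sumr !mulr_suml.
  apply: eq_bigr => r _.
  have -> : mon (fun r' => m r' + (r' == r))%N lam = mon m lam * gam lam r.
    rewrite /mon; under eq_bigr do rewrite exprD.
    rewrite big_split /= (bigD1 r) //= [X in _ * X](bigD1 r) //= eqxx expr1.
    by rewrite [X in _ * (_ * X)]big1 ?mulr1 // => r' /negbTE ->.
  by rewrite rmorphM /=; ring.
rewrite exchange_big big1 //= => r _; rewrite -mulr_sumr IHj ?mulr0 // => m' lt_m'.
apply: aux0; apply: leq_trans lt_m' _; rewrite big_split /=.
have -> : (\sum_(r' < n) (r' == r) = 1)%N.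
  by rewrite (bigD1 r) //= eqxx big1 // => r' /negbTE ->.
by rewrite -addnA.
Qed.

(* By [schwarz], the integer [aux p m l] has absolute value less than 1. *)
Lemma extrapolate (p : box -> int) (T R0 R1 P G E : nat) (Th : R) :
  (0 < L1)%N -> (R0 <= R1)%N -> (0 < R0)%N -> (0 < T)%N -> (0 < P)%N -> (0 < G)%N ->
  (forall lam, `|p lam| <= P)%N ->
  (forall lam r, `|gam lam r| <= G)%N ->
  (forall lam, `|th lam| <= Th) -> 1 <= Th ->
  (forall m l, (l < R0)%N -> (\sum_r m r < T.*2)%N -> aux p m l = 0) ->
  let Z := (#|{: box}| * P * G ^ T)%:R : R in
  (4 * Z * expR (Th * (4 * R1%:R)) <= 2 ^+ (R0 * T)) ->
  (4 * Z * (1 + Th ^+ T * (1 + 2 * T%:R * R1%:R) ^+ (R0 * T)) <= 2 ^+ E) ->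
  (forall lam c, (c < R1)%N ->
     (apow lam ^ c)%:R * (4 * R1%:R * L1%:R * `|linform|) <= 2 ^- E.+1) ->
  forall m l, (l < R1)%N -> (\sum_r m r < T)%N -> aux p m l = 0.
Proof.
move=> L1gt0 le_R R0gt0 T0 P0 G0 leP leG leTh Th1 zero Z H1 H2 H3 m x ltx ltm.
have E0 : 0 < (2 ^- E.+1 : R) by rewrite invr_gt0 exprn_gt0.
have R10 : 0 < (R1%:R : R) by rewrite ltr0n (leq_trans R0gt0).
have b1 : 1 <= `|(b i0)%:~R : R| by rewrite -intr_norm ler1z; lia.
have [D0 hD] := pexp_cvg_fin
  (fun lc : box * 'I_R1 => th lc.1 * (lc.2 : nat)%:R) E0.
(* A derivative of order [j] shortens the truncation to [D - j]; the extra [T] keeps it in the range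
   where the exponential is well approximated. *)
pose D := (D0 + T)%N.
have approx lam c j : (c < R1)%N -> (j <= T)%N ->
    `|pexp (D - j) (th lam * c%:R) - (apow lam ^ c)%:R| <= 2 ^- E.
  move=> ltc lej; have := hD (D - j)%N (lam, Ordinal ltc).
  rewrite /= /D -addnBA // leq_addr => /(_ isT) h.
  have apE : (apow lam ^ c)%:R = expR (ps lam * c%:R).
    by rewrite mulrC expRM_natl expR_ps natrX.
  have ap1 : 1 <= ((apow lam ^ c)%:R : R) by rewrite ler1n expn_gt0 apow_gt0.
  have dif : `|th lam * c%:R - ps lam * c%:R| <= R1%:R * L1%:R * `|linform|.
    rewrite -mulrBl normrM distrC th_ps !normrM normfV !normr_nat.
    have c1 : (c%:R : R) <= R1%:R by rewrite ler_nat ltnW.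
    have l1 : ((lam i0 : nat)%:R : R) <= L1%:R by rewrite ler_nat ltnW.
    have l2 : `|linform| / `|(b i0)%:~R| <= `|linform|.
      by rewrite ler_pdivrMr ?(lt_le_trans _ b1) // ler_peMr.
    have -> : R1%:R * L1%:R * `|linform| = (L1%:R * `|linform|) * R1%:R by ring.
    by apply: ler_pM; rewrite ?mulr_ge0 ?invr_ge0 // -mulrA ler_pM ?mulr_ge0 ?invr_ge0.
  have h3 := H3 lam c ltc.
  have le12 : (2 ^- E.+1 : R) <= 2^-1.
    by rewrite exprS invfM ler_piMr ?invr_ge0 // invf_le1 ?exprn_gt0 ?exprn_ege1 // ler1n.
  have lin0 : 0 <= R1%:R * L1%:R * `|linform| by rewrite !mulr_ge0.
  have dif2 : `|th lam * c%:R - ps lam * c%:R| <= 2^-1.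
    apply: (le_trans dif); apply: le_trans le12; apply: le_trans h3.
    rewrite -!mulrA (mulrA R1%:R); nra.
  have := expR_sub_le dif2; rewrite -apE => h4.
  have -> : pexp (D0 + (T - j)) (th lam * c%:R) - (apow lam ^ c)%:R =
     (pexp (D0 + (T - j)) (th lam * c%:R) - expR (th lam * c%:R)) +
     (expR (th lam * c%:R) - (apow lam ^ c)%:R) by ring.
  apply: (le_trans (ler_normD _ _)).
  have -> : 2 ^- E = 2 ^- E.+1 + 2 ^- E.+1 :> R.
    by rewrite exprS invfM -mulrDl (_ : 2^-1 + 2^-1 = 1) ?mul1r //; field.
  apply: lerD; [exact: h | apply: (le_trans h4); apply: le_trans h3].
  by rewrite ler_wpM2l ?ler0n //; lra.
pose w lam := ((p lam * mon m lam)%:~R : R).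
have w_le lam : `|w lam| <= (P * G ^ T)%:R.
  rewrite /w -intr_norm -abszE -pmulrn ler_nat abszM leq_mul //.
  have -> : `|mon m lam|%N = (\prod_r `|gam lam r| ^ m r)%N.
    by rewrite /mon (big_morph _ abszM absz1); apply: eq_bigr => r _; rewrite abszX.
  apply: leq_trans (leq_pexp2l G0 (ltnW ltm)).
  rewrite expn_sum; apply: leq_prod => r _.
  by case: (m r) => // k; rewrite leq_exp2r.
have sumw (F : box -> R) (B : R) : (forall lam, `|F lam| <= B) ->
    `|\sum_lam w lam * F lam| <= Z * B.
  move=> leF; apply: (le_trans (ler_norm_sum _ _ _)).
  have -> : Z * B = \sum_(lam : box) (P * G ^ T)%:R * B.
    by rewrite sumr_const -[RHS]mulr_natl [RHS]mulrA; congr (_ * _); rewrite -natrM mulnA.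
  by apply: ler_sum => lam _; rewrite normrM ler_pM.
(* At integers [c], [phi] approximates [aux p m c]. With its derivatives of order below [T] it is
   small at all [c < R0], and [schwarz] carries this over to the [x < R1]. *)
pose phi := \sum_lam w lam *: texp D (th lam).
have phiN c j : (j <= T)%N ->
    phi^`N(j).[c%:R] = \sum_lam w lam * (th lam ^+ j / j`!%:R * pexp (D - j) (th lam * c%:R)).
  move=> lej; rewrite /phi linear_sum horner_sum; apply: eq_bigr => lam _.
  by rewrite /= nderivnZ hornerZ texp_nderivn // /D (leq_trans lej) ?leq_addl.
have fact1 j : 1 <= (j`!%:R : R) by rewrite ler1n fact_gt0.
have thj lam j : (j <= T)%N -> `|th lam ^+ j / j`!%:R| <= Th ^+ T.
  move=> lej; rewrite normrM normfV normr_nat normrX.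
  rewrite ler_pdivrMr ?(lt_le_trans ltr01) //.
  apply: (@le_trans _ _ (Th ^+ j)); first by rewrite lerXn2r ?nnegrE // (le_trans ler01).
  apply: (@le_trans _ _ (Th ^+ T)); first by rewrite ler_weXn2l.
  by rewrite ler_peMr // exprn_ge0 // (le_trans ler01).
have data c j : (c < R0)%N -> (j < T)%N -> `|phi^`N(j).[c%:R]| <= Z * (Th ^+ T * 2 ^- E).
  move=> ltc ltj; rewrite phiN ?(ltnW ltj) //.
  (* The order of [m] and the order [j] of the derivative are both below [T] and add up to less than
     [T.*2]: this is where half of the order of vanishing is lost. *)
  have zero' : \sum_lam w lam * (th lam ^+ j / j`!%:R * (apow lam ^ c)%:R) = 0.
    transitivity (j`!%:R^-1 * \sum_lam (p lam)%:~R * (mon m lam)%:~R * th lam ^+ j * (apow lam ^ c)%:R).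
      rewrite mulr_sumr; apply: eq_bigr => lam _; rewrite /w rmorphM /=; ring.
    rewrite aux_shift ?mulr0 // => m' lt_m'; apply: zero => //.
    by apply: (leq_trans lt_m'); rewrite -addnn addnS; apply: leq_trans (leq_add ltm (ltnW ltj)); rewrite addSn.
  rewrite -[X in `|X|]subr0 -[X in _ - X]zero' -sumrB.
  under eq_bigr do rewrite -mulrBr -mulrBr.
  apply: sumw => lam; rewrite normrM ler_pM ?thj ?(ltnW ltj) //.
  by apply: approx; rewrite ?(ltnW ltj) ?(leq_trans ltc).
pose nodes := flatten [seq nseq T c | c <- iota 0 R0].
have size_nodes : size nodes = (R0 * T)%N.
  rewrite size_flatten /shape -map_comp (@eq_map _ _ _ (fun=> T)); last first.
    by move=> c; rewrite /= size_nseq.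
  by rewrite sumnE big_map big_const_seq count_predT size_iota iter_addn_0 mulnC.
have mem_nodes c : c \in nodes -> (c < R0)%N.
  by move=> /flattenP[s /mapP[c']]; rewrite mem_iota => lt -> /nseqP[-> _].
have count_nodes c : (count_mem c nodes <= T)%N.
  rewrite count_flatten -map_comp sumnE big_map.
  rewrite (eq_bigr (fun i => (i == c) * T)%N) => [|i _]; last by rewrite /= count_nseq.
  rewrite -big_distrl /= -[leqRHS]mul1n leq_mul2r; apply/orP; right.
  have -> : (\sum_(i <- iota 0 R0) (i == c) = count_mem c (iota 0 R0))%N.
    by rewrite -sum1_count [RHS]big_mkcond; apply: eq_bigr => i _ /=; case: eqP.
  by rewrite count_uniq_mem ?iota_uniq // leq_b1.
have eps0 : 0 <= Z * (Th ^+ T * 2 ^- E).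
  by rewrite !mulr_ge0 ?ler0n ?invr_ge0 ?exprn_ge0 // (le_trans ler01).
have data' c j : (j < count_mem c nodes)%N -> `|phi^`N(j).[c%:R]| <= Z * (Th ^+ T * 2 ^- E).
  move=> ltj; apply: data; last exact: leq_trans ltj (count_nodes c).
  by apply: mem_nodes; rewrite -has_pred1 has_count (leq_trans _ ltj).
have ltR c : c \in nodes -> (c < R1)%N by move=> /mem_nodes/leq_trans; apply.
have := schwarz T0 (leq_trans R0gt0 le_R) ltx eps0 ltR count_nodes data'.
rewrite size_nodes => bphi.
have nphi : wnorm (4 * R1%:R) phi <= Z * expR (Th * (4 * R1%:R)).
  have R14 : 0 <= 4 * R1%:R :> R by lra.
  apply: (le_trans (wnorm_sum _ R14)).
  have -> : Z * expR (Th * (4 * R1%:R)) = \sum_(lam : box) (P * G ^ T)%:R * expR (Th * (4 * R1%:R)).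
    by rewrite sumr_const -[RHS]mulr_natl [RHS]mulrA; congr (_ * _); rewrite -natrM mulnA.
  apply: ler_sum => lam _; rewrite wnormZ ler_pM ?w_le //.
    by apply: sumr_ge0 => i _; rewrite mulr_ge0 ?exprn_ge0.
  by apply: (le_trans (wnorm_texp _ _ R14)); rewrite ler_expR ler_wpM2r.
have close : `|(aux p m x)%:~R - phi.[x%:R]| <= Z * 2 ^- E.
  have := phiN x 0%N; rewrite nderivn0 leq0n => /(_ isT) ->.
  rewrite /aux rmorph_sum -sumrB.
  rewrite (eq_bigr (fun lam => w lam * ((apow lam ^ x)%:R - pexp (D - 0) (th lam * x%:R)))).
    by apply: sumw => lam; rewrite distrC; apply: approx.
  by move=> lam _; rewrite expr0 fact0 invr1 mulr1 mul1r !rmorphM /w rmorphM /=; ring.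
suff : `|(aux p m x)%:~R : R| < 1 by rewrite -intr_norm ltrz1; lia.
have -> : (aux p m x)%:~R = ((aux p m x)%:~R - phi.[x%:R]) + phi.[x%:R] by ring.
apply: (le_lt_trans (ler_normD _ _)); apply: (le_lt_trans (lerD close bphi)).
set W := (1 + 2 * T%:R * R1%:R) ^+ (R0 * T) in H2 *.
have k1 : 0 < (2 ^+ E : R) by rewrite exprn_gt0.
have k2 : 0 < (2 ^+ (R0 * T) : R) by rewrite exprn_gt0.
have l1 : Z * 2 ^- E + Z * (Th ^+ T * 2 ^- E) * W <= 4^-1.
  have -> : Z * 2 ^- E + Z * (Th ^+ T * 2 ^- E) * W = Z * (1 + Th ^+ T * W) / 2 ^+ E by ring.
  by rewrite ler_pdivrMr //; lra.
have l2 : 2 ^- (R0 * T) * wnorm (4 * R1%:R) phi <= 4^-1.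
  apply: (@le_trans _ _ (2 ^- (R0 * T) * (Z * expR (Th * (4 * R1%:R))))).
    by rewrite ler_wpM2l // invr_ge0 ltW.
  by rewrite mulrC ler_pdivrMr //; lra.
by rewrite addrA; lra.
Qed.

End Extrapolation.

Section Vandermonde.
Local Open Scope ring_scope.

(** Nonsingularity of the Vandermonde matrix, by pairing the relations with the coefficients of the
    Lagrange polynomial [Q], which vanishes at every node except [a i]. *)
Lemma power_sums_eq0 (I : finType) (a : I -> nat) (p : I -> int) : injective a ->
  (forall l, (l < #|I|)%N -> \sum_i p i * (a i ^ l)%:Z = 0) -> forall i, p i = 0.
Proof.
move=> inj_a zero i.
pose Q : {poly int} := \prod_(j | j != i) ('X - (a j)%:Z%:P).
have szQ : size Q = #|I|.
  rewrite /Q -big_enum size_prod_XsubC -cardE cardC1 prednK //.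
  by apply/card_gt0P; exists i.
have Q0 j : j != i -> Q.[(a j)%:Z] = 0.
  move=> neji; apply/eqP; rewrite /Q horner_prod (bigD1 j) //=.
  by rewrite !hornerE subrr mul0r.
have Qi : Q.[(a i)%:Z] != 0.
  rewrite /Q horner_prod; apply/prodf_neq0 => j neji; rewrite !hornerE subr_eq0.
  by apply: contra neji => /eqP[/inj_a->].
have : \sum_(l < size Q) Q`_l * (\sum_j p j * (a j ^ l)%:Z) = 0.
  by rewrite big1 // => l _; rewrite zero ?mulr0 // -szQ.
under eq_bigr do rewrite mulr_sumr.
rewrite exchange_big (bigD1 i) //= [X in _ + X]big1 => [|j neji].
  rewrite addr0 (eq_bigr (fun l : 'I__ => p i * (Q`_l * (a i)%:Z ^+ l))) => [|l _].
    by rewrite -mulr_sumr -horner_coef => /eqP; rewrite mulf_eq0 (negbTE Qi) orbF => /eqP.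
  by rewrite mulrCA -!natz natrX.
rewrite (eq_bigr (fun l : 'I__ => p j * (Q`_l * (a j)%:Z ^+ l))) => [|l _].
  by rewrite -mulr_sumr -horner_coef Q0 ?mulr0.
by rewrite mulrCA -!natz natrX.
Qed.

End Vandermonde.

(** * Parameters of the extrapolation *)

Lemma self_lt_exp2 u : u < 2 ^ u. Proof. exact: ltn_expl. Qed.

Lemma sqr_le_exp2 u : 4 <= u -> u * u <= 2 ^ u.
Proof.
elim: u => // u IHu; rewrite leq_eqVlt => /predU1P[<- //|le4]; move: (IHu le4).
by rewrite expnS; nia.
Qed.

(** The base 4 comes from the induction in [baker]: eliminating one number replaces [H] by [H ^ 2],
    which doubles the exponent, and the other factor 2 pays for the integer by which the form gets
    multiplied. *)
Definition baker_exp n := 4 ^ n.+2.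
Definition baker_height n := 2 ^ (8 * n.+1 ^ 2 + 16).

Lemma exp_poly_le d u H : 2 * d + 4 <= u -> 2 ^ u <= H -> 2 * H ^ d <= 2 ^ H.
Proof.
move=> led leH.
have H0 : 0 < H by apply: leq_trans leH; rewrite expn_gt0.
have [lo hi] := andP (trunc_log_bounds (isT : 1 < 2) H0).
set v := trunc_log 2 H in lo hi.
have leuv : u <= v by rewrite -ltnS -(ltn_exp2l _ _ (isT : 1 < 2)) (leq_ltn_trans leH).
apply: (@leq_trans (2 * (2 ^ v.+1) ^ d)).
  by rewrite leq_mul2l /=; case: d {led} => // d; rewrite leq_exp2r // ltnW.
rewrite -expnM -expnS leq_exp2l //; apply: leq_trans lo.
have := @sqr_le_exp2 v; nia.
Qed.

Section BakerParams.
Variables n H : nat.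
Hypothesis leH : baker_height n <= H.
Let d := 4 * n + 3.
Let J := d * n.+1.

Lemma height_ge_lin : 18 * n.+2 <= H.
Proof.
apply: leq_trans leH; rewrite /baker_height; set u := (X in 2 ^ X).
have le4 : 4 <= u by rewrite /u; lia.
by apply: leq_trans (sqr_le_exp2 le4); rewrite /u; nia.
Qed.

Lemma height_ge_exp : 2 ^ J.+1 <= H.
Proof. by apply: leq_trans leH; rewrite /baker_height leq_exp2l // /J /d; nia. Qed.

Lemma height_ge_steps : J + 12 <= H.
Proof.
apply: leq_trans leH; rewrite /baker_height; set u := (X in 2 ^ X).
by apply: leq_trans (ltnW (self_lt_exp2 u)); rewrite /u /J /d; nia.
Qed.

Lemma height_pow_d : 2 * H ^ d <= 2 ^ H.
Proof. by apply: exp_poly_le leH; rewrite /d; nia. Qed.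

Lemma height_pow4 : 2 * H ^ 4 <= 2 ^ H.
Proof. by apply: exp_poly_le leH; nia. Qed.

(** This makes the unknowns at least twice as many as the equations. Bounding [2] and [2 ^ J.+1] by
    [H], the left side is at most [H ^ (3 + (4 + d) * n)], and [d = 4 * n + 3] is the value for
    which this exponent equals [d * n.+1]. *)
Lemma siegel_params : 2 * (H ^ 2 * (2 ^ J.+1 * (H ^ 3 * H ^ d)) ^ n) <= (H ^ d) ^ n.+1.
Proof.
have h18 := height_ge_lin; have hJ := height_ge_exp.
apply: (@leq_trans (H * (H ^ 2 * (H * (H ^ 3 * H ^ d)) ^ n))).
  apply: leq_mul; first by lia.
  rewrite leq_mul2l; apply/orP; right.
  by case: {h18} n => // k; rewrite leq_exp2r // leq_mul2r hJ orbT.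
rewrite -(expnD H 3) -(expnS H (3 + d)) -expnM -(expnD H 2) -expnS -expnM.
rewrite leq_pexp2l //; first by lia.
by rewrite /d; nia.
Qed.

(* Exponents of 2 in two of the hypotheses of [extrapolate]. *)
Lemma extrapolate_params j T T0 : j < J ->
  T = H ^ 3 * H ^ d * 2 ^ (J - j) -> T0 = 2 ^ J.+1 * (H ^ 3 * H ^ d) ->
  2 + (H * n.+1 + (H * n.+1 + (2 * H * (n * T0) + H * (n.+1 * H ^ d * H ^ 2))) + 2 * H * T)
    + 8 * (n.+2 * H ^ d * H) * H ^ (3 + j) <= H ^ (2 + j) * T.
Proof.
move=> ltj defT defT0; have h18 := height_ge_lin.
have L0 : 0 < H ^ d by rewrite expn_gt0; apply/orP; left; lia.
have [Hj Hj0] : 2 ^ j <= H ^ j /\ 0 < H ^ j.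
  split; last by rewrite expn_gt0; apply/orP; left; lia.
  by case: j {ltj defT} => // j; rewrite leq_exp2r //; lia.
have T0E : T0 = T * (2 * 2 ^ j).
  rewrite defT0 defT -{1}(subnK (ltnW ltj)) -addSn expnD expnS; nia.
have T1 : H ^ 3 * H ^ d <= T by rewrite defT leq_pmulr // expn_gt0.
rewrite (expnD H 3) (expnD H 2) T0E; move: T1.
move: (H ^ d) (H ^ j) (2 ^ j) L0 Hj Hj0 => L X Y L0 Hj Hj0 T1 {T0 defT defT0 T0E}.
have H1 : 0 < H by lia.
have z2 : 2 <= T * X.
  have H3L : 2 <= H ^ 3 * L.
    by apply: leq_trans (leq_pmulr _ L0); rewrite !expnS; nia.
  by rewrite -[2]muln1 leq_mul // (leq_trans H3L).
have a1 : 2 + H * n.+1 + H * n.+1 <= n.+2 * H * (T * X).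
  apply: (@leq_trans (n.+2 * H * 2)); first by nia.
  by rewrite leq_mul2l z2 orbT.
have a2 : 2 * H * (n * (T * (2 * Y))) + 2 * H * T <= 4 * n.+2 * H * (T * X).
  have -> : 2 * H * (n * (T * (2 * Y))) + 2 * H * T = H * T * (4 * n * Y + 2) by lia.
  have -> : 4 * n.+2 * H * (T * X) = H * T * (4 * n.+2 * X) by lia.
  by rewrite leq_mul2l; apply/orP; right; nia.
have a3 : H * (n.+1 * L * H ^ 2) + 8 * (n.+2 * L * H) * (H ^ 3 * X)
    <= 9 * n.+2 * H * (H ^ 3 * L) * X.
  have -> : 9 * n.+2 * H * (H ^ 3 * L) * X =
     H ^ 3 * L * (n.+2 * H * X) + 8 * (n.+2 * L * H) * (H ^ 3 * X) by lia.
  rewrite leq_add2r (_ : H * _ = H ^ 3 * L * n.+1); last by rewrite !expnS; lia.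
  by rewrite leq_mul2l; apply/orP; right; nia.
have a4 : 9 * n.+2 * H * (H ^ 3 * L) * X <= 9 * n.+2 * H * T * X.
  by rewrite leq_mul2r leq_mul2l T1 !orbT.
have a5 : 14 * n.+2 * H * (T * X) <= H ^ 2 * X * T.
  have -> : H ^ 2 * X * T = H * H * (T * X) by rewrite !expnS; lia.
  by rewrite leq_mul2r; apply/orP; right; rewrite leq_mul2r; apply/orP; right; lia.
apply: leq_trans a5.
by lia.
Qed.

End BakerParams.

(** * Multiplicatively independent numbers *)

Section Independent.
Local Open Scope ring_scope.
Variables (R : realType) (n H : nat) (i0 : 'I_n.+1).
Variables (alpha : 'I_n.+1 -> nat) (b : 'I_n.+1 -> int).
Hypothesis leH : (baker_height n <= H)%N.
Hypothesis alpha_bnd : forall i, (2 <= alpha i <= 2 ^ H)%N.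
Hypothesis b_bnd : forall i, (`|b i| <= 2 ^ H)%N.
Hypothesis bi0 : b i0 != 0.
Notation d := (4 * n + 3)%N.
Notation J := ((4 * n + 3) * n.+1)%N.
Notation L1 := (H ^ (4 * n + 3))%N.
Hypothesis indep : forall c : 'I_n.+1 -> int, (forall i, (`|c i| <= L1)%N) ->
  \sum_i (c i)%:~R * ln (alpha i)%:R = 0 :> R -> forall i, c i = 0.
Notation Lam := (linform R alpha b).
Hypothesis small : `|Lam| < 2 ^- (H ^ (4 * n ^ 2 + 11 * n + 15)).
Notation box := {ffun 'I_n.+1 -> 'I_L1}.
Notation T0 := (2 ^ J.+1 * (H ^ 3 * L1))%N.

Let alpha_gt0 i : (0 < alpha i)%N.
Proof. by have := alpha_bnd i; lia. Qed.

Let H18 : (18 * n.+2 <= H)%N := height_ge_lin leH.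
Let H0 : (0 < H)%N. Proof. by move: H18; lia. Qed.
Let L1gt0 : (0 < L1)%N. Proof. by rewrite expn_gt0 H0. Qed.
Let leL : (2 * L1 <= 2 ^ H)%N := height_pow_d leH.

Lemma ln_alpha i : 0 <= (ln (alpha i)%:R : R) <= H%:R.
Proof.
have /andP[a1 a2] := alpha_bnd i.
rewrite ln_ge0 ?ler1n //=; apply: (@le_trans _ _ (ln ((2 ^ H)%N)%:R)).
  by rewrite ler_ln ?posrE ?ltr0n ?expn_gt0 // ler_nat.
rewrite natrX lnXn ?ltr0n // lerMn2r; apply/orP; right.
by have := @le_ln1Dx R 1; rewrite (_ : 1 + 1 = 2) //; apply; lra.
Qed.

(** This is what independence is for: the Vandermonde argument at the end needs distinct numbers. *)
Lemma apow_inj : injective (apow alpha : box -> nat).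
Proof.
move=> lam mu eq_a; apply/ffunP => i; apply/val_inj => /=.
suff /(_ i) : forall i, (lam i : nat)%:Z - (mu i : nat)%:Z = 0.
  by move/eqP; rewrite subr_eq0 => /eqP[].
apply: indep => [k|].
  have := ltn_ord (lam k); have := ltn_ord (mu k).
  by set x := nat_of_ord (lam k); set y := nat_of_ord (mu k); clearbody x y; lia.
have := congr1 (fun a : nat => ln (a%:R : R)) eq_a.
rewrite -!(expR_ps R alpha_gt0) !expRK /ps => /eqP; rewrite -subr_eq0 -sumrB => /eqP e.
by rewrite -[RHS]e; apply: eq_bigr => k _; rewrite rmorphB /= mulrBl.
Qed.

Lemma card_box : #|{: box}| = (L1 ^ n.+1)%N.
Proof. by rewrite card_ffun !card_ord. Qed.

Lemma gam_bnd (lam : box) r : (`|gam i0 b lam r| <= 2 ^ (2 * H))%N.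
Proof.
have hL k : (lam k <= L1)%N by apply: ltnW.
rewrite /gam; have := b_bnd i0; have := b_bnd (lift i0 r).
have := hL i0; have := hL (lift i0 r).
rewrite (_ : 2 ^ (2 * H) = 2 ^ H * 2 ^ H)%N; last by rewrite -expnD addnn -mul2n.
move: leL (b i0) (b _) (nat_of_ord _) (nat_of_ord _).
move: (2 ^ H)%N L1 => h L leL' b1 b2 l1 l2 h1 h2 h3 h4.
have : (`|(b1 * l2%:Z - b2 * l1%:Z)%R| <= h * L + h * L)%N.
  have tri (x y : int) : (`|(x - y)%R| <= `|x| + `|y|)%N by lia.
  by apply: leq_trans (tri _ _) _; rewrite !abszM leq_add // leq_mul.
by move/leq_trans; apply; nia.
Qed.

Lemma th_bnd (lam : box) : `|th R i0 alpha b lam| <= (n.+2 * L1 * H)%:R.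
Proof.
have -> : th R i0 alpha b lam = ps R alpha lam - (ps R alpha lam - th R i0 alpha b lam).
  by ring.
apply: (le_trans (ler_normB _ _)).
have -> : (n.+2 * L1 * H)%:R = (n.+1 * L1 * H)%:R + (L1 * H)%:R :> R.
  by rewrite -natrD; congr _%:R; nia.
apply: lerD.
  rewrite /ps; apply: (le_trans (ler_norm_sum _ _ _)).
  have -> : (n.+1 * L1 * H)%:R = \sum_(i < n.+1) (L1%:R * H%:R) :> R.
    by rewrite sumr_const card_ord -[RHS]mulr_natl !natrM mulrA.
  apply: ler_sum => i _; have /andP[l0 l1] := ln_alpha i.
  by rewrite normrM normr_nat ler_pM // ?ler_nat 1?ltnW // ger0_norm.
rewrite (th_ps R alpha bi0) !normrM normfV normr_nat natrM.
have b1 : 1 <= `|(b i0)%:~R : R| by rewrite -intr_norm ler1z; lia.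
have s1 : `|Lam| <= 1.
  by rewrite (le_trans (ltW small)) // invf_le1 ?exprn_gt0 // exprn_ege1 // ler1n.
rewrite -mulrA ler_pM ?mulr_ge0 ?invr_ge0 // ?ler_nat 1?ltnW //.
rewrite ler_pdivrMr ?(lt_le_trans ltr01) // (le_trans s1) //.
by rewrite mulr_ege1 // ler1n.
Qed.

Lemma aux_start : exists p : box -> int, [/\ exists lam, p lam != 0,
  forall lam, (`|p lam| <= 2 ^ (H * n.+1 + (2 * H * (n * T0) + H * (n.+1 * L1 * H ^ 2))))%N &
  forall m l, (l < H ^ 2)%N -> (\sum_r m r < T0)%N -> aux i0 alpha b p m l = 0].
Proof.
set pe := (2 * H * (n * T0) + H * (n.+1 * L1 * H ^ 2))%N.
have T0gt0 : (0 < T0)%N by rewrite !muln_gt0 !expn_gt0 H0.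
(* Every [m] with entries below [T0] gets an equation; these include all [m] of total order below
   [T0], and their number is a plain power. *)
pose I := ('I_(H ^ 2) * {ffun 'I_n -> 'I_T0})%type.
pose a (lm : I) (lam : box) : int :=
  mon i0 b (fun r => lm.2 r) lam * (apow alpha lam ^ lm.1)%:Z.
have a_bnd i lam : (`|a i lam| <= 2 ^ pe)%N.
  rewrite /a abszM /pe (expnD 2) leq_mul //.
    rewrite /mon (big_morph _ abszM absz1).
    have -> : (2 ^ (2 * H * (n * T0)) = \prod_(r < n) 2 ^ (2 * H * T0))%N.
      by rewrite prod_nat_const card_ord -expnM; congr (_ ^ _)%N; lia.
    apply: leq_prod => r _; rewrite abszX expnM.
    apply: (@leq_trans ((2 ^ (2 * H)) ^ i.2 r)).
      by case: (nat_of_ord (i.2 r)) => // k; rewrite leq_exp2r // gam_bnd.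
    by rewrite leq_pexp2l ?expn_gt0 // ltnW.
  rewrite absz_nat; apply: (@leq_trans ((2 ^ (H * (n.+1 * L1))) ^ i.1)).
    case: (nat_of_ord i.1) => // k; rewrite leq_exp2r //.
    have -> : (2 ^ (H * (n.+1 * L1)) = \prod_(r < n.+1) 2 ^ (H * L1))%N.
      by rewrite prod_nat_const card_ord -expnM; congr (_ ^ _)%N; lia.
    apply: leq_prod => r _; rewrite expnM; have /andP[a1 a2] := alpha_bnd r.
    apply: (@leq_trans ((2 ^ H) ^ lam r)).
      by case: (nat_of_ord (lam r)) => // k'; rewrite leq_exp2r.
    by rewrite leq_pexp2l ?expn_gt0 // ltnW.
  by rewrite -expnM leq_exp2l // -(mulnA H) !leq_mul2l (ltnW (ltn_ord _)) !orbT.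
have cardI : #|{: I}| = (H ^ 2 * T0 ^ n)%N.
  by rewrite card_prod card_ffun !card_ord.
have leI : (2 * #|{: I}| <= #|{: box}|)%N.
  by rewrite cardI card_box; exact: (siegel_params leH).
have I0 : (0 < #|{: I}|)%N by rewrite cardI muln_gt0 !expn_gt0 H0 T0gt0.
have leX : (#|{: box}| * 2 ^ pe <= 2 ^ (H * n.+1 + pe))%N.
  rewrite (expnD 2) leq_mul2r card_box; apply/orP; right; rewrite expnM leq_exp2r //.
  by apply: leq_trans leL; lia.
(* Let [X] be the bound on the unknowns. As [#|box| * 2 ^ pe <= X] and the unknowns are at least
   twice as many as the equations, Siegel's condition reduces to [X ^ 2 + 1 < (X + 1) ^ 2]. *)
have [|p [nz bnd zero]] := siegel (X := 2 ^ (H * n.+1 + pe)) a_bnd.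
  apply: (@leq_ltn_trans (((2 ^ (H * n.+1 + pe)) ^ 2).+1 ^ #|{: I}|)).
    by rewrite leq_exp2r // ltnS -mulnn leq_mul2r leX orbT.
  apply: (@leq_trans ((2 ^ (H * n.+1 + pe)).+1 ^ (2 * #|{: I}|))); last first.
    by rewrite leq_pexp2l.
  rewrite expnM ltn_exp2r //; have : (0 < 2 ^ (H * n.+1 + pe))%N by rewrite expn_gt0.
  by move: (2 ^ _)%N => X X0; rewrite -!mulnn; lia.
exists p; split => // m l ltl ltm.
have ltmr r : (m r < T0)%N.
  by apply: leq_ltn_trans ltm; rewrite (bigD1 r) //= leq_addr.
have := zero (Ordinal ltl, [ffun r => Ordinal (ltmr r)]).
move=> e; rewrite -[RHS]e; apply: eq_bigr => lam _; rewrite /a /= mulrC mulrA.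
rewrite mulrAC; congr (_ * _); rewrite mulrC; congr (_ * _).
by apply: eq_bigr => r _; rewrite ffunE.
Qed.

Lemma natr2X k : (2 ^+ k : R) = (2 ^ k)%:R. Proof. by rewrite natrX. Qed.

(* Each step multiplies the range of [l] by [H] and halves the order of vanishing;
   at the end [l] takes more values than the number of [lam] in [box]. *)
Lemma aux_zero (p : box -> int) :
  (forall lam, (`|p lam| <= 2 ^ (H * n.+1 + (2 * H * (n * T0) + H * (n.+1 * L1 * H ^ 2))))%N) ->
  (forall m l, (l < H ^ 2)%N -> (\sum_r m r < T0)%N -> aux i0 alpha b p m l = 0) ->
  forall j, (j <= J)%N -> forall m l, (l < H ^ (2 + j))%N ->
  (\sum_r m r < H ^ 3 * L1 * 2 ^ (J.+1 - j))%N -> aux i0 alpha b p m l = 0.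
Proof.
pose pe := (H * n.+1 + (2 * H * (n * T0) + H * (n.+1 * L1 * H ^ 2)))%N.
rewrite -/pe => p_bnd start; elim=> [|j IHj] ltj.
  by move=> m l; rewrite addn0 subn0 [(H ^ 3 * _ * _)%N]mulnC; apply: start.
pose T := (H ^ 3 * L1 * 2 ^ (J - j))%N.
pose z := (H * n.+1 + pe + 2 * H * T)%N.
pose R0 := (H ^ (2 + j))%N; pose R1 := (H ^ (3 + j))%N.
pose ThN := (n.+2 * L1 * H)%N.
pose E := ((J + 12) * H * (R0 * T))%N.
have X0 k : (0 < H ^ k)%N by rewrite expn_gt0 H0.
have T1 : (0 < T)%N by rewrite /T !muln_gt0 H0 X0 expn_gt0.
have leH2 : (H <= 2 ^ H)%N by apply: ltnW; apply: self_lt_exp2.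
have leL2 : (L1 <= 2 ^ H)%N by apply: leq_trans leL; apply: leq_pmull.
have h4 := height_pow4 leH; have hJ := height_ge_exp leH; have hJ12 := height_ge_steps leH.
have leT : (T <= H ^ 4 * L1)%N.
  rewrite /T (expnS H 3) -(mulnA H) [leqLHS]mulnC leq_mul2r; apply/orP; right.
  by apply: leq_trans hJ; rewrite leq_exp2l //; lia.
have par : (2 + z + 8 * ThN * R1 <= R0 * T)%N.
  have := extrapolate_params leH ltj (erefl T) (erefl T0).
  by rewrite /z /pe /ThN /R0 /R1 /T; lia.
have Zle : (#|{: box}| * 2 ^ pe * (2 ^ (2 * H)) ^ T <= 2 ^ z)%N.
  rewrite -(expnM 2 (2 * H)) /z (expnD 2 (H * n.+1 + pe)) (expnD 2 (H * n.+1)).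
  rewrite leq_mul2r leq_mul2r card_box (expnM 2 H n.+1).
  by rewrite leq_exp2r // leL2 !orbT.
have Zle' : 4 * (#|{: box}| * 2 ^ pe * (2 ^ (2 * H)) ^ T)%:R *
     expR (ThN%:R * (4 * R1%:R)) <= 2 ^+ (R0 * T) :> R.
  apply: (@le_trans _ _ (4 * (2 ^ z)%:R * 4 ^+ (ThN * (4 * R1))%N)).
    apply: ler_pM; rewrite ?mulr_ge0 ?ler0n ?expR_ge0 //.
      by rewrite ler_pM2l ?ler_nat // ltr0n.
    by apply: expR_le_pow4; rewrite -!natrM.
  have -> : (4 : R) = 2 ^+ 2 by rewrite expr2; ring.
  rewrite natrX -exprM -!exprD ler_weXn2l ?ler1n //.
  by apply: leq_trans par; lia.
apply: (@extrapolate R n L1 i0 alpha b alpha_gt0 bi0 p T R0 R1 (2 ^ pe) (2 ^ (2 * H)) E ThN%:R) => //.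
- by rewrite leq_pexp2l.
- exact: X0.
- by rewrite expn_gt0.
- by rewrite expn_gt0.
- exact: gam_bnd.
- exact: th_bnd.
- by rewrite ler1n !muln_gt0 X0 H0.
- move=> m l ltl ltm; apply: IHj => //; first exact: ltnW.
  by apply: leq_trans ltm _; rewrite /T -muln2 -mulnA -expnSr subSn // ltnW.
- have ZT : 4 * (#|{: box}| * 2 ^ pe * (2 ^ (2 * H)) ^ T)%:R <= 2 ^+ (R0 * T) :> R.
    apply: le_trans Zle'; rewrite ler_peMr ?mulr_ge0 ?ler0n //.
    by rewrite -[leLHS]expR0 ler_expR -!natrM ler0n.
  apply: (@le_trans _ _ ((2 ^ (R0 * T) * (1 + ThN ^ T * (1 + 2 * T * R1) ^ (R0 * T)))%N%:R)).
    rewrite [leRHS]natrM; apply: ler_pM; rewrite ?addr_ge0 ?mulr_ge0 ?exprn_ge0 ?ler0n //.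
    - by rewrite !addr_ge0 ?mulr_ge0 ?ler0n.
    - by rewrite natrX.
    rewrite (natrD _ 1) (natrM _ (ThN ^ T)) (natrX _ ThN) (natrX _ _ (R0 * T)).
    by rewrite (natrD _ 1 (2 * T * R1)) (natrM _ (2 * T) R1) (natrM _ 2 T).
  rewrite natr2X ler_nat.
  have t1 : (ThN <= 2 ^ (2 * H))%N.
    rewrite mul2n -addnn (expnD 2) /ThN mulnAC leq_mul //.
    apply: leq_trans h4; apply: leq_trans (leq_pmull _ (isT : 0 < 2)%N).
    apply: (@leq_trans (H ^ 2)); last by rewrite leq_pexp2l.
    by rewrite -mulnn leq_mul2r; apply/orP; right; move: H18; clear; lia.
  have t2 : (1 + 2 * T * R1 <= 2 ^ ((J + 7) * H))%N.
    have -> : ((J + 7) * H = 2 + H + H + (2 * H + H * (J + 3) - 2))%N.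
      by move: J H0; clear => J' H0; nia.
    rewrite !(expnD 2); have : (R1 <= 2 ^ (2 * H + H * (J + 3) - 2))%N.
      apply: (@leq_trans (2 ^ (H * (3 + j)))); last first.
        by rewrite leq_exp2l //; move: J ltj H0; clear => J' ltj H0; nia.
      by rewrite expnM leq_exp2r.
    have : (T <= 2 ^ H * 2 ^ H)%N.
      exact: leq_trans leT (leq_mul (leq_trans (leq_pmull _ (isT : 0 < 2)%N) h4) leL2).
    have := X0 (3 + j)%N; rewrite -/R1; move: T1; clear.
    move: (2 ^ H * 2 ^ H)%N (2 ^ _)%N R1 => x y r.
    by rewrite -!mulnA; move=> *; nia.
  apply: (@leq_trans (2 ^ (R0 * T) * (2 * (2 ^ (2 * H * T) * 2 ^ ((J + 7) * H * (R0 * T)))))).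
    rewrite leq_mul2l; apply/orP; right; rewrite [leqRHS]mul2n -addnn leq_add //.
      by rewrite muln_gt0 !expn_gt0.
    have powr x y k : (x <= y -> x ^ k <= y ^ k)%N by case: k => // k xy; rewrite leq_exp2r.
    rewrite (expnM 2 (2 * H)) (expnM 2 ((J + 7) * H)).
    exact: leq_mul (powr _ _ _ t1) (powr _ _ _ t2).
  rewrite -(expnD 2) -expnS -(expnD 2) leq_exp2l // /E.
  have gen (x h t r : nat) : (0 < h -> 0 < r -> t <= r ->
      r + (2 * h * t + (x + 7) * h * r).+1 <= (x + 12) * h * r)%N.
    clear; move=> h0 r0 letr; have h1 : (r <= h * r)%N by exact: leq_pmull.
    have h2 : (2 * h * t <= 2 * (h * r))%N by rewrite -mulnA leq_mul2l leq_mul2l letr !orbT.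
    by rewrite -!mulnA; nia.
  by apply: gen => //; [rewrite muln_gt0 X0 | rewrite leq_pmull // X0].
move=> lam c ltc.
pose V := (H ^ (4 * n ^ 2 + 11 * n + 15))%N.
have small' : `|Lam| <= 2 ^- V by exact: ltW small.
pose e3 := (H * (n.+1 * L1) * R1 + 2 + H * (3 + J) + H)%N.
have a1 : (apow alpha lam ^ c <= 2 ^ (H * (n.+1 * L1) * R1))%N.
  apply: (@leq_trans ((2 ^ (H * (n.+1 * L1))) ^ c)).
    case: c {ltc} => // k; rewrite leq_exp2r //.
    have -> : (2 ^ (H * (n.+1 * L1)) = \prod_(r < n.+1) 2 ^ (H * L1))%N.
      by rewrite prod_nat_const card_ord -expnM; congr (_ ^ _)%N; lia.
    apply: leq_prod => r _; rewrite expnM; have /andP[b1 b2] := alpha_bnd r.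
    apply: (@leq_trans ((2 ^ H) ^ lam r)).
      by case: (nat_of_ord (lam r)) => // k'; rewrite leq_exp2r.
    by rewrite leq_pexp2l ?expn_gt0 // ltnW.
  by rewrite -expnM leq_exp2l // leq_mul2l (ltnW ltc) orbT.
have a2 : (4 * R1 * L1 <= 2 ^ (2 + H * (3 + J) + H))%N.
  rewrite !(expnD 2) !leq_mul //; apply: (@leq_trans (2 ^ (H * (3 + j)))).
    by rewrite expnM leq_exp2r.
  by rewrite leq_exp2l //; move: J ltj; clear => J' ltj; nia.
(* With [d = 4 * n + 3], the exponent [4 * n ^ 2 + 11 * n + 15] is [J + d + 9]: each of three terms
   is at most [H ^ (J + d + 8)], and one more factor [H] absorbs their number. *)
have a3 : (e3 + E.+1 <= V)%N.
  have -> : V = (H * H ^ (J + (4 * n + 3) + 8))%N.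
    by rewrite /V -expnS; congr (_ ^ _)%N; rewrite -mulnn; clear; nia.
  have R1le : (R1 <= H ^ (2 + J))%N by rewrite leq_pexp2l.
  have R0le : (R0 <= H ^ (1 + J))%N by rewrite leq_pexp2l.
  have [n1H n3H] : (n.+1 <= H /\ 3 <= H)%N by move: H18; clear; lia.
  have b1 : (H * (n.+1 * L1) * R1 <= H ^ (J + (4 * n + 3) + 8))%N.
    apply: (@leq_trans (H * (H * L1) * H ^ (2 + J))).
      by rewrite leq_mul // leq_mul2l leq_mul2r n1H !orbT.
    rewrite -(expnS H (4 * n + 3)) -expnS -expnD leq_pexp2l //.
    by move: J; clear; lia.
  have b2 : (E <= H ^ (J + (4 * n + 3) + 8))%N.
    apply: (@leq_trans (H * H * (H ^ (1 + J) * (H ^ 4 * L1)))).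
      exact: leq_mul (leq_mul hJ12 (leqnn H)) (leq_mul R0le leT).
    rewrite -(expnD H 4) -(expnD H (1 + J)) mulnn -expnD leq_pexp2l //.
    by move: J; clear; lia.
  have b3 : (3 + H * (3 + J) + H <= H ^ (J + (4 * n + 3) + 8))%N.
    apply: (@leq_trans (H ^ 3)).
      by rewrite !expnS expn0; move: J hJ12; clear => J' hJ12; nia.
    by rewrite leq_pexp2l //; move: J; clear; lia.
  rewrite /e3; move: (H ^ (_ + 8))%N (H * (3 + J))%N b1 b2 b3 => x y b1 b2 b3.
  apply: (@leq_trans (3 * x)); last by rewrite leq_mul2r n3H orbT.
  by move: b1 b2 b3; move: (H * _ * R1)%N E; clear; lia.
apply: (@le_trans _ _ ((2 ^ e3)%:R * 2 ^- V)).
  have -> : e3 = (H * (n.+1 * L1) * R1 + (2 + H * (3 + J) + H))%N by rewrite /e3 -!addnA.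
  rewrite (expnD 2) natrM -[leRHS]mulrA.
  apply: ler_pM; rewrite ?ler0n ?ler_nat ?mulr_ge0 //.
  apply: ler_pM; rewrite ?mulr_ge0 ?ler0n //.
  by rewrite -!natrM ler_nat.
rewrite natrX ler_pdivrMr ?exprn_gt0 // mulrC ler_pdivlMr ?exprn_gt0 // -exprD.
by rewrite ler_weXn2l ?ler1n.
Qed.

(** At [m = 0] the values of [aux] are power sums of the distinct numbers [apow lam]. They vanish
    for enough [l] to force [p = 0], against the choice of [p]. *)
Lemma baker_indep : False.
Proof.
have [p [[lam nz] p_bnd start]] := aux_start.
have zero := aux_zero p_bnd start (leqnn J).
case/eqP: nz; apply: (power_sums_eq0 apow_inj) => l ltl.
have := zero (fun=> 0)%N l; rewrite big1 // => /(_ _ _).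
have e : aux i0 alpha b p (fun=> 0)%N l = \sum_i p i * (apow alpha i ^ l)%:Z.
  by apply: eq_bigr => i _; rewrite /mon big1 // mulr1.
rewrite -e; apply.
  apply: leq_trans ltl _; rewrite card_box -expnM leq_pexp2l //; lia.
by rewrite !muln_gt0 !expn_gt0 H0.
Qed.

End Independent.

Lemma baker_exp_ge n : 4 * n ^ 2 + 11 * n + 15 <= baker_exp n.+1.
Proof.
rewrite /baker_exp !expnS muln1; elim: n => // n; rewrite !expnS; nia.
Qed.

Section Baker.
Local Open Scope ring_scope.
Variable R : realType.

(* If the numbers [alpha i] satisfy a relation with small exponents, it eliminates
   one of them; otherwise [baker_indep] applies. *)
Theorem baker n H (alpha : 'I_n -> nat) (b : 'I_n -> int) :
  (baker_height n <= H)%N -> (forall i, (2 <= alpha i <= 2 ^ H)%N) ->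
  (forall i, (`|b i| <= 2 ^ H)%N) ->
  `|\sum_i (b i)%:~R * ln (alpha i)%:R : R| < 2 ^- (H ^ baker_exp n) ->
  \sum_i (b i)%:~R * ln (alpha i)%:R = 0 :> R.
Proof.
elim: n H alpha b => [|n IHn] H alpha b leH a_bnd b_bnd small.
  by rewrite big_ord0.
have leHn : (baker_height n <= H)%N.
  by apply: leq_trans leH; rewrite leq_exp2l // leq_add2r leq_mul2l leq_exp2r //=.
have H18 := height_ge_lin leHn; have H4 := height_pow4 leHn; have leL := height_pow_d leHn.
have [H0 H3] : (0 < H /\ 3 <= H)%N by move: H18; clear; lia.
have [[i0 bi0]|b0] := pselect (exists i, b i != 0); last first.
  rewrite big1 // => i _; have [->|bi] := eqVneq (b i) 0; first by rewrite mul0r.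
  by case: b0; exists i.
have [[c [c_bnd rel [i1 ci1]]]|indep] := pselect (exists c : 'I_n.+1 -> int,
    [/\ forall i, (`|c i| <= H ^ (4 * n + 3))%N,
     \sum_i (c i)%:~R * ln (alpha i)%:R = 0 :> R & exists i, c i != 0]); last first.
  exfalso; apply: (@baker_indep R n H i0 alpha b leHn a_bnd b_bnd bi0).
    move=> c c_bnd rel i; apply/eqP; apply: contra_notT indep => ci.
    by exists c; split => //; exists i.
  apply: (lt_le_trans small); rewrite lef_pV2 ?posrE ?exprn_gt0 //.
  by rewrite ler_weXn2l ?ler1n // leq_pexp2l // baker_exp_ge.
set Lam := \sum_i _ in small *.
(* Cross-multiplication with the relation [c] cancels the term of [alpha i1] and multiplies the form
   by [c i1], which is nonzero. *)
pose b' r := c i1 * b (lift i1 r) - b i1 * c (lift i1 r).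
have eqLam : \sum_r (b' r)%:~R * ln (alpha (lift i1 r))%:R = (c i1)%:~R * Lam.
  have -> : (c i1)%:~R * Lam = (c i1)%:~R * Lam -
    (b i1)%:~R * \sum_i (c i)%:~R * ln (alpha i)%:R by rewrite rel mulr0 subr0.
  rewrite /Lam !(bigD1_ord i1 (P := xpredT)) //= !mulrDr !mulr_sumr opprD addrACA -sumrN -big_split /=.
  rewrite [X in X + _](_ : _ = 0) ?add0r; last by ring.
  by apply: eq_bigr => r _; rewrite /b' rmorphB !rmorphM /=; ring.
have c0 : (c i1)%:~R != 0 :> R by rewrite intr_eq0.
apply/eqP; rewrite -[_ == 0](mulrI_eq0 _ (lregP c0)) -eqLam; apply/eqP.
have L2 : (H ^ (4 * n + 3) <= 2 ^ H)%N by apply: leq_trans leL; apply: leq_pmull.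
have HH : (H + H <= H ^ 2)%N by rewrite -mulnn addnn -mul2n leq_mul2r (ltnW H3) orbT.
(* The new coefficients are at most [2 ^ (H + H)], which the height [H ^ 2] covers. *)
apply: (IHn (H ^ 2)%N).
- by apply: (leq_trans leHn); rewrite -mulnn leq_pmulr.
- move=> r; have /andP[a1 a2] := a_bnd (lift i1 r); rewrite a1 /=.
  by apply: (leq_trans a2); rewrite leq_exp2l // -mulnn leq_pmulr.
- move=> r; apply: (@leq_trans (2 ^ H * 2 ^ H)); last by rewrite -expnD leq_exp2l.
  have := b_bnd i1; have := b_bnd (lift i1 r); have := c_bnd i1; have := c_bnd (lift i1 r).
  have tri (x y : int) : (`|(x - y)%R| <= `|x| + `|y|)%N by clear; lia.
  move=> k1 k2 k3 k4; apply: leq_trans (tri _ _) _; rewrite !abszM.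
  apply: leq_trans (leq_add (leq_mul k2 k3) (leq_mul k4 k1)) _.
  rewrite mulnC -mulnDr leq_mul2l addnn -mul2n.
  by rewrite leL orbT.
have Lam0 : 0 <= `|Lam| by [].
rewrite eqLam normrM; apply: (@le_lt_trans _ _ ((2 ^ H)%N%:R * `|Lam|)).
  rewrite ler_wpM2r // -intr_norm -abszE -pmulrn ler_nat.
  exact: leq_trans (c_bnd _) L2.
apply: (@lt_le_trans _ _ ((2 ^ H)%N%:R * 2 ^- (H ^ baker_exp n.+1))).
  by rewrite ltr_pM2l // ltr0n expn_gt0.
rewrite natrX ler_pdivrMr ?exprn_gt0 // mulrC ler_pdivlMr ?exprn_gt0 // -exprD.
rewrite ler_weXn2l ?ler1n // -expnM.
have -> : (baker_exp n.+1 = 4 * baker_exp n)%N by rewrite /baker_exp expnS.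
have k1 : (0 < baker_exp n)%N by rewrite expn_gt0.
apply: (@leq_trans (H * H ^ (2 * baker_exp n))).
  have : (H ^ 1 <= H ^ (2 * baker_exp n))%N by rewrite leq_pexp2l // muln_gt0.
  rewrite expn1; move: H3; clear; move: (H ^ _)%N => x; nia.
by rewrite -expnS leq_pexp2l //; move: k1; clear; lia.
Qed.

End Baker.

(** * The numbers (q^F - 1) / (q - 1) *)

Definition rep q F := \sum_(i < F) q ^ i.

Lemma rep_pred q F : 0 < q -> q.-1 * rep q F = q ^ F - 1.
Proof. by move=> q0; rewrite subn1 predn_exp. Qed.

Lemma rep_recl q F : rep q F.+1 = 1 + q * rep q F.
Proof.
rewrite /rep big_ord_recl expn0 big_distrr /=; congr (_ + _).
by apply: eq_bigr => i _; rewrite expnS.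
Qed.

Lemma rep_gt0 q F : 0 < F -> 0 < rep q F.
Proof. by case: F => // F _; rewrite rep_recl. Qed.

Lemma leq_rep q F : 0 < F -> q ^ F.-1 <= rep q F.
Proof. by case: F => // F _; rewrite /rep big_ord_recr leq_addl. Qed.

Lemma rep_lt q F : 1 < q -> rep q F < q ^ F.
Proof.
move=> q1; have := rep_pred F (ltnW q1); have : 0 < q ^ F by rewrite expn_gt0 ltnW.
by move: (rep q F) (q ^ F) => x y y0 e; have : 1 * x <= q.-1 * x; [rewrite leq_mul2r; lia | lia].
Qed.

Lemma rep_ltX q F : 1 < q -> 0 < F -> rep q F < 2 * q ^ F.-1.
Proof.
move=> q1; case: F => // F _; rewrite /rep big_ord_recr /= -/(rep q F).
by have := rep_lt F q1; lia.
Qed.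

Lemma leq_rep_mono q q' F : q <= q' -> rep q F <= rep q' F.
Proof. by move=> h; apply: leq_sum => i _; case: (nat_of_ord i) => // k; rewrite leq_exp2r. Qed.

Lemma rep_inj F : 1 < F -> injective (rep^~ F).
Proof.
have lt q q' : 1 < F -> q < q' -> rep q F < rep q' F.
  case: F => // F F1 ltq; rewrite !rep_recl ltn_add2l.
  have := leq_rep_mono F (ltnW ltq); have := @rep_gt0 q F F1; nia.
by move=> F1 q q' e; case: (ltngtP q q') => // /(lt _ _ F1); rewrite e ltnn.
Qed.

(** * Lifting the exponent *)

Section LTE.
Variable p : nat.
Hypotheses (p_pr : prime p) (p_odd : odd p).

Lemma expnD_mod y z k : exists r, (y + z) ^ k = y ^ k + k * z * y ^ k.-1 + z ^ 2 * r.
Proof.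
elim: k => [|k [r IH]]; first by exists 0; rewrite !expn0; lia.
have -> : (y + z) ^ k.+1 = (y + z) * (y ^ k + k * z * y ^ k.-1 + z ^ 2 * r) by rewrite expnS IH.
case: k {IH} => [|k]; first by exists ((y + z) * r); rewrite !expn0 expn1 /=; lia.
exists (k.+1 * y ^ k + (y + z) * r); rewrite /= !expnS; nia.
Qed.

(** Write [x = y + t p]. Modulo [p ^ 2] the sum is [p y ^ p.-1] plus [t p y ^ p.-2] times
    [0 + ... + p.-1 = p p.-1 / 2]. As [p] is odd, the last number is a multiple of [p], so exactly
    one factor [p] remains. *)
Lemma logn_geom_p x y : y < x -> p %| x - y -> ~~ (p %| y) ->
  logn p (\sum_(i < p) x ^ (p.-1 - i) * y ^ i) = 1.
Proof.
move=> ltyx /dvdnP[t def_t] ndvd.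
have def_x : x = y + t * p by lia.
have p1 := prime_gt1 p_pr; have p3 : 2 < p by case: p p_odd p1 => [|[|[]]].
set S := \sum_(i < p) _.
have [r hS] : exists r, S = p * (y ^ p.-1 + p * r).
  have /fin_all_exists[r hr] : forall i : 'I_p, exists r, x ^ (p.-1 - i) * y ^ i =
     y ^ p.-1 + (p.-1 - i) * (t * p) * y ^ p.-2 + (t * p) ^ 2 * r.
    move=> i; have [r e] := expnD_mod y (t * p) (p.-1 - i); move: e; rewrite -def_x => ->.
    exists (r * y ^ i); rewrite !mulnDl -expnD subnK; last by have := ltn_ord i; lia.
    rewrite -mulnA; congr (_ + _ + _); last by rewrite mulnA.
    have [->|ni] := eqVneq (p.-1 - i) 0; first by rewrite !mul0n.
    by rewrite -!mulnA -expnD; congr (_ * (_ * (_ * _ ^ _))); lia.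
  rewrite /S (eq_bigr _ (fun i _ => hr i)) !big_split /= sum_nat_const card_ord.
  exists (t * y ^ p.-2 * p.-1./2 + t ^ 2 * \sum_i r i).
  rewrite -big_distrr -!big_distrl /=.
  have -> : \sum_(i < p) (p.-1 - i) = p * p.-1./2.
    rewrite (reindex_inj rev_ord_inj) /= (eq_bigr (fun i : 'I_p => i : nat)) => [|i _].
      rewrite -(big_mkord xpredT id) bin2_sum bin2.
      have e : p.-1 = p.-1./2.*2.
        by rewrite -[LHS]odd_double_half (_ : odd p.-1 = false) //; case: p p_odd => //= k /negbTE.
      by rewrite {1}e -doubleMr doubleK.
    by have := ltn_ord i; lia.
  by rewrite mulnDr !expnS !expn0; nia.
have pos : 0 < y ^ p.-1 + p * r.
  by rewrite addn_gt0 expn_gt0; case: y {ltyx def_t def_x S hS} ndvd; rewrite ?dvdn0.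
rewrite hS (lognM _ (prime_gt0 p_pr) pos).
rewrite (logn_prime p p_pr) eqxx -[RHS]addn0; congr (_ + _).
apply/eqP; rewrite lognE p_pr /=; case: ifP => // /andP[_].
by rewrite dvdn_addl ?dvdn_mulr // Euclid_dvdX // (negbTE ndvd).
Qed.

Lemma logn_geom_ndvd n x y : y < x -> p %| x - y -> ~~ (p %| y) -> ~~ (p %| n) ->
  logn p (\sum_(i < n) x ^ (n.-1 - i) * y ^ i) = 0.
Proof.
move=> ltyx dvd ndvd ndvdn; apply/eqP; rewrite lognE p_pr /=; case: ifP => // /andP[_].
have xy : x = y %[mod p] by apply/eqP; rewrite eqn_mod_dvd // ltnW.
have -> : (p %| \sum_(i < n) x ^ (n.-1 - i) * y ^ i) = (p %| n * y ^ n.-1).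
  rewrite /dvdn; congr (_ == _); rewrite -[n in n * _]card_ord -sum_nat_const.
  elim/big_ind2: _ => // [a b c d|i _]; first by rewrite -modnDm => -> ->; rewrite modnDm.
  rewrite -modnMml -modnXm xy modnXm modnMml -expnD subnK //.
  by have := ltn_ord i; lia.
by rewrite Euclid_dvdM // Euclid_dvdX // (negbTE ndvd) (negbTE ndvdn).
Qed.

Theorem logn_subX n x y : y < x -> p %| x - y -> ~~ (p %| y) -> 0 < n ->
  logn p (x ^ n - y ^ n) = logn p (x - y) + logn p n.
Proof.
elim/ltn_ind: n x y => n IHn x y ltyx dvd ndvd n0.
have sub0 : 0 < x - y by rewrite subn_gt0.
have y0 : 0 < y by case: y {ltyx dvd sub0} ndvd => //; rewrite dvdn0.
have geom0 k : 0 < k -> 0 < \sum_(i < k) x ^ (k.-1 - i) * y ^ i.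
  case: k => // k _; rewrite big_ord_recl addn_gt0 muln_gt0 !expn_gt0.
  by rewrite (leq_ltn_trans _ ltyx) ?y0.
have [/dvdnP[m def_n]|ndvdn] := boolP (p %| n); last first.
  rewrite subn_exp lognM ?geom0 // logn_geom_ndvd //.
  by rewrite [logn p n]lognE (negbTE ndvdn) !andbF.
have p0 := prime_gt0 p_pr.
have m0 : 0 < m by move: n0; rewrite def_n muln_gt0 => /andP[].
have ltmn : m < n by rewrite def_n -[ltnLHS]muln1 ltn_mul2l m0 prime_gt1.
rewrite def_n mulnC !expnM IHn //.
- rewrite subn_exp lognM ?geom0 // logn_geom_p // lognM // (logn_prime p p_pr) eqxx.
  by rewrite addnA.
- by rewrite ltn_exp2r.
- by rewrite subn_exp dvdn_mulr.
- by rewrite Euclid_dvdX // (negbTE ndvd).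
Qed.

End LTE.

Lemma expn_gcd1 p q m n : q ^ m = 1 %[mod p] -> q ^ n = 1 %[mod p] -> 0 < m ->
  q ^ gcdn m n = 1 %[mod p].
Proof.
move=> e1 e2 m0; case: (egcdnP n m0) => km kn e _.
have h : q ^ (km * m) = 1 %[mod p] by rewrite mulnC expnM -modnXm e1 modnXm exp1n.
have h2 : q ^ (kn * n) = 1 %[mod p] by rewrite mulnC expnM -modnXm e2 modnXm exp1n.
by move: h; rewrite e expnD -modnMml h2 modnMml mul1n.
Qed.

(** If [p] divides [rep q F] and [d = gcd (F, p - 1)], then already [q ^ d = 1] modulo [p], and
    lifting the exponent bounds the [p]-part of [q ^ F - 1] by [(q ^ d - 1) * (F / d)]. The point is
    that [F] enters linearly and not as an exponent of [q]. *)
Lemma logn_rep_bound p q F : prime p -> odd p -> 1 < q -> 0 < F ->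
  p ^ logn p (rep q F) <= q ^ p * F.
Proof.
move=> p_pr p_odd q1 F0; have q0 := ltnW q1.
have [dvd|ndvd] := boolP (p %| rep q F); last first.
  by rewrite lognE (negbTE ndvd) !andbF expn0 muln_gt0 expn_gt0 q0.
have XF0 : 0 < q ^ F - 1 by rewrite subn_gt0 -{1}(exp1n F) ltn_exp2r.
have dvdF : p %| q ^ F - 1 by rewrite -rep_pred // dvdn_mull.
have q1F : q ^ F = 1 %[mod p] by apply/eqP; rewrite eqn_mod_dvd // expn_gt0 q0.
have cop : coprime q p.
  rewrite coprime_sym prime_coprime //; apply/negP => dvdq.
  have : p %| q ^ F by case: F F0 {dvd XF0 dvdF q1F} => // F _; rewrite expnS dvdn_mulr.
  move=> dvdqF; have := dvdn_sub dvdqF dvdF; rewrite subKn ?expn_gt0 ?q0 //.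
  by rewrite dvdn1 => /eqP p1; move: p_pr; rewrite p1.
set d := gcdn F p.-1.
have q1d : q ^ d = 1 %[mod p].
  by apply: expn_gcd1 => //; have := Euler_exp_totient cop; rewrite totient_prime.
have d0 : 0 < d by rewrite gcdn_gt0 F0.
have [m def_F] := dvdnP (dvdn_gcdl F p.-1); rewrite -/d in def_F.
have m0 : 0 < m by move: F0; rewrite def_F muln_gt0 => /andP[].
have lemF : m <= F by rewrite def_F leq_pmulr.
have qd1 : 1 < q ^ d by rewrite -{1}(exp1n d) ltn_exp2r.
apply: (@leq_trans (p ^ logn p (q ^ F - 1))).
  by rewrite leq_exp2l ?prime_gt1 // dvdn_leq_log // -rep_pred // dvdn_mull.
rewrite {1}def_F [m * d]mulnC expnM -(exp1n m) logn_subX //; last 2 first.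
- by rewrite -eqn_mod_dvd ?(ltnW qd1) //; apply/eqP.
- by rewrite dvdn1; case: p p_pr {p_odd dvd dvdF q1F cop d q1d d0 def_F qd1} => [|[|]].
rewrite expnD leq_mul //.
  apply: leq_trans (dvdn_leq _ (pfactor_dvdnn p _)) _; first by rewrite subn_gt0.
  apply: leq_trans (leq_subr _ _) _; rewrite leq_pexp2l //.
  have p1 : 0 < p.-1 by case: p p_pr {p_odd dvd dvdF q1F cop d q1d d0 def_F qd1} => [|[|]].
  exact: leq_trans (dvdn_leq p1 (dvdn_gcdr F p.-1)) (leq_pred p).
exact: leq_trans (dvdn_leq m0 (pfactor_dvdnn p _)) lemF.
Qed.

Lemma prod_logn_sub (S : seq nat) n : uniq S -> 0 < n ->
  {subset primes n <= S} -> n = \prod_(p <- S) p ^ logn p n.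
Proof.
move=> uS n0 sub; rewrite {1}(prod_prime_decomp n0) prime_decompE big_map /=.
rewrite (perm_big (seq.filter (mem (primes n)) S)) /=; last first.
  apply: uniq_perm; rewrite ?primes_uniq ?filter_uniq // => p.
  by rewrite mem_filter andb_idr //; apply: sub.
rewrite big_filter big_mkcond; apply: eq_bigr => p _.
by case: ifP => //; rewrite inE => /negbT; rewrite -logn_gt0 -eqn0Ngt => /eqP->.
Qed.

(** * Primes q with F large *)

Lemma logn_prodX (I : finType) (a e : I -> nat) l : (forall i, 0 < a i) ->
  logn l (\prod_i a i ^ e i) = \sum_i e i * logn l (a i).
Proof.
move=> a0; have [] // : 0 < \prod_i a i ^ e i /\
  logn l (\prod_i a i ^ e i) = \sum_i e i * logn l (a i).
elim/big_rec2: _ => [|i y x _ [x0 IH]]; first by rewrite logn1.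
have ai0 : 0 < a i ^ e i by rewrite expn_gt0 a0.
by rewrite muln_gt0 ai0 x0 lognM // lognX IH.
Qed.

Section LogRelations.
Local Open Scope ring_scope.
Variable R : realType.

Lemma ln_prodX (I : finType) (a e : I -> nat) : (forall i, 0 < a i)%N ->
  ln ((\prod_i a i ^ e i)%N%:R : R) = \sum_i (e i)%:R * ln (a i)%:R.
Proof.
move=> a0; apply: expR_inj; rewrite lnK ?posrE ?ltr0n ?prodn_gt0 // => [|i]; last first.
  by rewrite expn_gt0 a0.
rewrite expR_sum natr_prod; apply: eq_bigr => i _.
by rewrite expRM_natl lnK ?natrX // posrE ltr0n.
Qed.

(** Exponentiating the relation, with positive and negative coefficients on different sides, gives
    an equality of two natural numbers; compare their [l]-adic valuations. *)
Lemma ln_rel_logn n (alpha : 'I_n -> nat) (b : 'I_n -> int) l :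
  (forall i, 0 < alpha i)%N -> \sum_i (b i)%:~R * ln (alpha i)%:R = 0 :> R ->
  \sum_i b i * (logn l (alpha i))%:Z = 0.
Proof.
move=> a0 rel.
pose pos i := (if (0 <= b i)%R then `|b i| else 0)%N.
pose neg i := (if (0 <= b i)%R then 0 else `|b i|)%N.
have bE i : b i = (pos i)%:Z - (neg i)%:Z by rewrite /pos /neg; case: ifP; lia.
have eq_prod : (\prod_i alpha i ^ pos i = \prod_i alpha i ^ neg i)%N.
  have p0 (e : 'I_n -> nat) : ((\prod_i alpha i ^ e i)%N%:R : R) \in Num.pos.
    by rewrite posrE ltr0n; apply: prodn_gt0 => i; rewrite expn_gt0 a0.
  apply/eqP; rewrite -(eqr_nat R); apply/eqP/(ln_inj (p0 _) (p0 _)).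
  apply/eqP; rewrite -subr_eq0 !ln_prodX // -sumrB -[X in _ == X]rel; apply/eqP.
  by apply: eq_bigr => i _; rewrite [in RHS]bE rmorphB /= mulrBl.
have := congr1 (logn l) eq_prod; rewrite !logn_prodX // => e.
rewrite (eq_bigr (fun i => (pos i * logn l (alpha i))%N%:Z - (neg i * logn l (alpha i))%N%:Z)).
  rewrite sumrB -!(big_morph Posz PoszD (erefl 0%:Z)) e.
  by rewrite subrr.
by move=> i _; rewrite [in LHS]bE mulrBl !PoszM.
Qed.

Lemma ln1B_bound (x : R) : 0 <= x <= 2^-1 -> `|ln (1 - x)| <= 2 * x.
Proof.
move=> /andP[x0 x1]; have x2 : 0 < 1 - x by lra.
rewrite ler0_norm; last by rewrite ln_le0 //; lra.
rewrite -lnV ?posrE // (_ : (1 - x)^-1 = 1 + x / (1 - x)); last by field; lra.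
have q0 : 0 <= x / (1 - x) by rewrite divr_ge0 // ltW.
apply: (le_trans (le_ln1Dx _)); first by apply: lt_le_trans q0; lra.
by rewrite ler_pdivrMr //; nra.
Qed.

End LogRelations.

Section DependentReps.
Variable R : realType.
Variables (K : nat) (q F : 'I_K.+1 -> nat) (p : 'I_K -> nat) (u : 'I_K -> 'I_K.+1 -> nat).
Variables (U H : nat).
Notation m := (K.+1 + K.+1).
Hypothesis q_pr : forall j, prime (q j).
Hypothesis q_inj : injective q.
Hypothesis q_bnd : forall j, 3 <= q j <= 2 ^ H.
Hypothesis p_gt0 : forall i, 0 < p i.
Hypothesis rep_q : forall j, rep (q j) (F j) = \prod_i p i ^ u i j.
Hypothesis u_bnd : forall i j, u i j <= U.
Hypothesis U_gt0 : 0 < U.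
Hypothesis F_bnd : forall j, (K.+1 * U) ^ K * F j <= 2 ^ H.
Hypothesis leH : baker_height m <= H.
Hypothesis F_large : forall j, H ^ (baker_exp m).+1 <= F j.
Local Open Scope ring_scope.

Let H0 : (4 <= H)%N.
Proof. by apply: leq_trans leH; rewrite (@leq_trans (2 ^ 2)) // leq_exp2l //; lia. Qed.

Let F_gt0 j : (0 < F j)%N.
Proof. by apply: leq_trans (F_large j); rewrite expn_gt0; case: H H0. Qed.

(* Siegel's lemma gives [c] with [prod_j rep (q j) (F j) ^ c j = 1]; the linear form
   [sum_j c j * (F j * ln (q j) - ln (q j - 1))] is then tiny, hence zero, which is
   absurd for the largest [q j] with [c j <> 0]: it divides no other [q i] or
   [q i - 1]. *)
Lemma dependent_reps_absurd : False.
Proof.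
(* Siegel's bound for [K] equations in [K.+1] unknowns: [(K.+1 * U * X.+1) ^ K = X * X.+1 ^ K < X.+1
   ^ K.+1]. *)
pose X := ((K.+1 * U) ^ K)%N.
have [|c [[j1 nz] c_bnd rel]] := @siegel _ _ (fun i j => (u i j)%:Z) U X u_bnd.
  rewrite !card_ord; apply: (@leq_ltn_trans ((K.+1 * U * X.+1) ^ K)).
    case: (K) => // k; rewrite leq_exp2r // mulnS -addn1 addnC leq_add2r.
    by rewrite muln_gt0.
  by rewrite expnMn expnS ltn_mul2r expn_gt0 /= ltnS.
have q0 j : (0 < q j)%N by apply: prime_gt0.
have lnrep j : ln ((rep (q j) (F j))%:R : R) =
    (F j)%:R * ln (q j)%:R + ln (1 - (q j)%:R ^- F j) - ln (q j).-1%:R.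
  have /andP[q3 _] := q_bnd j.
  have qF0 : 0 < (q j)%:R ^+ F j :> R by rewrite exprn_gt0 // ltr0n.
  have q1 : 0 < (q j).-1%:R :> R by rewrite ltr0n; case: (q j) q3 => [|[]].
  have qF1 : 1 < (q j)%:R ^+ F j :> R by rewrite exprn_egt1 // ?ltr1n ?prime_gt1 // -lt0n.
  have qi : 0 < 1 - (q j)%:R ^- F j :> R by rewrite subr_gt0 invf_lt1.
  have r0 : 0 < (rep (q j) (F j))%:R :> R by rewrite ltr0n rep_gt0.
  have := rep_pred (F j) (q0 j) => /(congr1 (fun x : nat => x%:R : R)).
  rewrite natrM natrB ?expn_gt0 ?q0 // natrX => e.
  suff <- : ln (rep (q j) (F j))%:R + ln (q j).-1%:R =
      (F j)%:R * ln (q j)%:R + ln (1 - (q j)%:R ^- F j) :> R by rewrite addrK.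
  rewrite -lnM ?posrE // [X in ln X]mulrC e.
  have -> : (F j)%:R * ln (q j)%:R = ln ((q j)%:R ^+ F j) :> R.
    by rewrite lnXn ?ltr0n // mulr_natl.
  by rewrite -lnM ?posrE // mulrBr mulr1 divff ?gt_eqF.
have relln : \sum_j (c j)%:~R * ln ((rep (q j) (F j))%:R : R) = 0.
  rewrite (eq_bigr (fun j => \sum_i (c j)%:~R * ((u i j)%:R * ln (p i)%:R))) => [|j _].
    rewrite exchange_big big1 //= => i _.
    transitivity ((\sum_j (u i j)%:Z * c j)%:~R * ln ((p i)%:R : R)); last first.
      by rewrite rel mul0r.
    rewrite rmorph_sum mulr_suml; apply: eq_bigr => j _; rewrite rmorphM /=.
    by rewrite mulrA [_ * (u i j)%:R]mulrC.
  by rewrite rep_q ln_prodX // mulr_sumr.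
pose alpha (k : 'I_m) := match fintype.split k with inl j => q j | inr j => (q j).-1 end.
pose b (k : 'I_m) : int := match fintype.split k with inl j => c j * (F j)%:Z | inr j => - c j end.
(* As [rep (q j) (F j)] is [(q j ^ F j - 1) / (q j - 1)] and the weighted sum of its logarithms is
   zero, only the corrections [ln (1 - q j ^- F j)] survive, of order at most [2 ^- F j]. *)
have sumE : \sum_k (b k)%:~R * ln (alpha k)%:R =
    - \sum_j (c j)%:~R * ln (1 - (q j)%:R ^- F j) :> R.
  rewrite -[RHS]add0r -[X in _ = X + _]relln -sumrN big_split_ord /= -!big_split /=.
  apply: eq_bigr => j _; rewrite /b /alpha !(unsplitK (inl _)) !(unsplitK (inr _)) lnrep.
  by rewrite rmorphM rmorphN /=; ring.
have X1 : (0 < X)%N by rewrite expn_gt0 muln_gt0 U_gt0.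
have XH (j : 'I_K.+1) : (X <= 2 ^ H)%N by apply: leq_trans (F_bnd j); rewrite leq_pmulr.
have alpha_bnd k : (2 <= alpha k <= 2 ^ H)%N.
  by rewrite /alpha; case: (fintype.split k) => j; have := q_bnd j; [lia | case: (q j) => //= x; lia].
have b_bnd k : (`|b k| <= 2 ^ H)%N.
  rewrite /b; case: (fintype.split k) => j; rewrite ?abszN; last exact: leq_trans (c_bnd j) (XH j).
  by rewrite abszM (leq_trans _ (F_bnd j)) // leq_mul2r c_bnd orbT.
have Phi j : (H ^ (baker_exp m).+1 <= F j)%N := F_large j.
have m0 : (2 * K.+1 <= 2 ^ H)%N.
  by apply: leq_trans (ltnW (self_lt_exp2 _)); have := height_ge_lin leH; clear; lia.
have small : `|\sum_k (b k)%:~R * ln (alpha k)%:R : R| < 2 ^- (H ^ baker_exp m).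
  rewrite sumE normrN; apply: (le_lt_trans (ler_norm_sum _ _ _)).
  apply: (@le_lt_trans _ _ (\sum_(j < K.+1) X%:R * (2 * 2 ^- (H ^ (baker_exp m).+1)))).
    apply: ler_sum => j _; rewrite normrM ler_pM //.
      by rewrite -intr_norm -abszE -pmulrn ler_nat.
    have q2 : 2 <= (q j)%:R :> R by rewrite ler_nat prime_gt1.
    have qinv : (q j)%:R ^- F j <= 2 ^- F j :> R.
      by rewrite lef_pV2 ?posrE ?exprn_gt0 ?ltr0n // lerXn2r ?nnegrE ?ler0n.
    have half : 2 ^- F j <= 2^-1 :> R.
      by rewrite lef_pV2 ?posrE ?exprn_gt0 // -[leLHS]expr1 ler_weXn2l ?ler1n.
    apply: (le_trans (ln1B_bound _)).
      by rewrite invr_ge0 exprn_ge0 ?ler0n //= (le_trans qinv).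
    rewrite ler_pM2l //; apply: (le_trans qinv).
    by rewrite lef_pV2 ?posrE ?exprn_gt0 // ler_weXn2l ?ler1n.
  rewrite sumr_const card_ord -[ltLHS]mulr_natl !mulrA.
  rewrite ltr_pdivrMr ?exprn_gt0 // [ltRHS]mulrC ltr_pdivlMr ?exprn_gt0 //.
  rewrite -!natrX -!natrM ltr_nat.
  apply: (@leq_ltn_trans (2 ^ (H + H + H ^ baker_exp m))).
    rewrite !(expnD 2) leq_mul2r; apply/orP; right.
    by rewrite mulnAC leq_mul ?(XH ord0) // mulnC.
  rewrite ltn_exp2l // expnS.
  have kb : (H ^ 1 <= H ^ baker_exp m)%N by rewrite leq_pexp2l ?expn_gt0 //; case: H H0.
  rewrite expn1 in kb; move: H0 kb; clear; move: (H ^ _)%N => x; nia.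
have zero := baker leH alpha_bnd b_bnd small.
have [j0 cj0 j0max] := @arg_maxnP _ j1 (fun j => c j != 0) q nz.
have alpha0 k : (0 < alpha k)%N by have := alpha_bnd k; lia.
have := ln_rel_logn (q j0) alpha0 zero.
rewrite big_split_ord /= [X in _ + X]big1 => [|j _]; last first.
  rewrite /b /alpha (unsplitK (inr _)).
  have [->|cj] := eqVneq (c j) 0; first by rewrite oppr0 mul0r.
  have le_q := j0max j cj; rewrite (_ : logn _ _ = 0)%N ?mulr0 //.
  have /andP[q3 _] := q_bnd j.
  apply/eqP; rewrite -leqn0 leqNgt logn_gt0 mem_primes negb_and; apply/orP; right.
  rewrite negb_and; apply/orP; right; apply/negP => /dvdn_leq.
  by move: q3 le_q; clear; lia.
rewrite addr0 (bigD1 j0) //= big1 => [|j nej].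
  rewrite addr0 /b /alpha (unsplitK (inl _)) logn_prime // eqxx mulr1.
  by move/eqP; rewrite mulf_eq0 (negbTE cj0) /= => /eqP[e]; have := F_gt0 j0; rewrite e.
rewrite /b /alpha (unsplitK (inl _)) logn_prime // (_ : _ == _ = false) ?mulr0 //.
by apply/negP => /eqP /q_inj e; rewrite e eqxx in nej.
Qed.

End DependentReps.

(** * Long exponents among the [q] with a common largest prime *)

Definition long_kappa K := baker_exp (K.+1 + K.+1).
Definition long_coef K := K.+1 * (long_kappa K).+1 * (2 * K + 10).
(** Twice the exponent required by [long_reps_core], because the height at which that lemma is
    applied may reach [h ^ 2]. *)
Definition long_exp K := 2 * (long_kappa K).+1.
Definition long_height K := baker_height (K.+1 + K.+1) + 2 ^ (4 * long_kappa K + 20) + 2 * long_coef K + K.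

Section LongReps.
Variables (K : nat) (S : seq nat) (F : nat -> nat).
Hypotheses (uS : uniq S) (szS : size S = K) (S_pr : {in S, forall p, prime p}).

(** Among [K.+1] elements of [Q], the exponent vectors over the [K] primes of [S] are linearly
    dependent. *)
Lemma long_reps_core (Q : seq nat) U H : uniq Q ->
  {in Q, forall q, prime q /\ 3 <= q <= 2 ^ H} ->
  {in Q, forall q, {subset primes (rep q (F q)) <= S}} ->
  {in Q & S, forall q p, logn p (rep q (F q)) <= U} -> 0 < U ->
  {in Q, forall q, (K.+1 * U) ^ K * F q <= 2 ^ H} ->
  {in Q, forall q, H ^ (long_kappa K).+1 <= F q} ->
  baker_height (K.+1 + K.+1) <= H -> size Q <= K.
Proof.
move=> uQ Q_pr Q_sub Q_logn U0 Q_F Q_large leH; rewrite leqNgt; apply/negP => szQ.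
have memQ (j : 'I_K.+1) : nth 0 Q j \in Q by rewrite mem_nth // (leq_trans _ szQ).
have memS (i : 'I_K) : nth 1 S i \in S by rewrite mem_nth // szS.
have H0 : 0 < H by apply: leq_trans leH; rewrite expn_gt0.
apply: (@dependent_reps_absurd Rdefinitions.R K (fun j => nth 0 Q j) (fun j => F (nth 0 Q j))
  (fun i => nth 1 S i) (fun i j => logn (nth 1 S i) (rep (nth 0 Q j) (F (nth 0 Q j)))) U H) => //.
- by move=> j; case: (Q_pr _ (memQ j)).
- move=> i j /eqP; rewrite nth_uniq ?(leq_trans _ szQ) // => /eqP; exact: val_inj.
- by move=> j; case: (Q_pr _ (memQ j)).
- by move=> i; apply/prime_gt0/S_pr.
- move=> j; rewrite {1}(prod_logn_sub uS _ (Q_sub _ (memQ j))); last first.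
    by apply: rep_gt0; apply: leq_trans (Q_large _ (memQ j)); rewrite expn_gt0 H0.
  by rewrite (big_nth 1) big_mkord szS.
- by move=> i j; apply: Q_logn.
- by move=> j; apply: Q_F.
- by move=> j; apply: Q_large.
Qed.

End LongReps.

(** Resolves an inequality in which [F] also occurs through its logarithm [x]: if [F > W ^ 2], then
    [16 F ^ 2 <= W ^ 2 x ^ 2 <= W ^ 2 F < F ^ 2]. *)
Lemma sqr_lin_bound W x F : 4 <= x -> 2 ^ x <= F -> 16 <= W -> 4 * F <= W * x -> F <= W ^ 2.
Proof.
move=> x4 xF W16 FW; have xx := leq_trans (sqr_le_exp2 x4) xF.
rewrite -mulnn leqNgt; apply/negP => WF.
have : (4 * F) * (4 * F) <= (W * x) * (W * x) by apply: leq_mul.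
have : (W * W) * (x * x) <= F * F by apply: leq_mul => //; apply: ltnW.
have : 0 < F by lia.
nia.
Qed.

Lemma lin_exp_bound x : 4 * x + 5 <= 2 ^ (x + 3).
Proof. by rewrite expnD; elim: x => // x IH; rewrite expnS; lia. Qed.

Lemma len_bound lam K h F tl : 0 < lam -> 0 < K -> 0 < h -> 2 ^ tl <= F ->
  F.-1 <= K * lam * (h * 2 ^ lam + tl) -> F <= 2 ^ (4 * lam + 2 * K + 2 * h + 8).
Proof.
move=> l0 K0 h0 tlF leF; pose W := 16 * (K * lam * (h * 2 ^ lam)).
have X0 : 0 < 2 ^ lam by rewrite expn_gt0.
have W16 : 16 <= W by rewrite /W leq_pmulr // !muln_gt0 l0 K0 h0.
have KW : 16 * (K * lam) <= W.
  by rewrite /W leq_mul2l /= leq_pmulr // muln_gt0 h0.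
have FW : F <= W ^ 2.
  have [t4|t4] := leqP 4 tl.
    apply: (sqr_lin_bound t4 tlF W16).
    have arith y z : 0 < y -> z <= y -> F <= 1 + y + z * tl -> 4 * F <= 16 * y * tl.
      clear -t4 => y0 zy; have : z * tl <= y * tl by rewrite leq_mul2r zy orbT.
      have : y * 4 <= y * tl by rewrite leq_mul2l t4 orbT.
      by rewrite -mulnA; move: (y * tl) (z * tl) => a b; lia.
    apply: (arith _ (K * lam)); rewrite ?muln_gt0 ?K0 ?l0 ?h0 // ?leq_pmulr ?muln_gt0 ?h0 //.
    by rewrite -addnA -mulnDr; move: leF; move: (K * _ * _) => a; clear; lia.
  have : F <= 1 + K * lam * (h * 2 ^ lam) + K * lam * 4.
    rewrite -addnA -mulnDr; apply: (@leq_trans (F.-1 + 1)); first by lia.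
    rewrite addnC leq_add2l; apply: leq_trans leF _.
    by rewrite leq_mul2l leq_add2l (ltnW t4) orbT.
  rewrite -mulnn; move: W16 KW; rewrite /W; move: (K * lam * (h * 2 ^ lam)) (K * lam) => y z.
  by clear; nia.
apply: (leq_trans FW).
have -> : 4 * lam + 2 * K + 2 * h + 8 = (4 + (K + lam + (h + lam))) * 2 by lia.
rewrite expnM leq_exp2r // /W !(expnD 2) !leq_mul //; exact: ltnW (self_lt_exp2 _).
Qed.

Lemma small_exponent K k w h : 0 < h ->
  (K + (h + (4 + K + w.+1) * k.+1)) * K + (4 + K + w.+1) * k.+1 <=
  K.+1 * k.+1 * (2 * K + 10) * (w.+1 + h).
Proof.
move=> h0; rewrite -!(mulnA K.+1) [_ * K]mulnC.
apply: (@leq_trans (K.+1 * (K + (h + (4 + K + w.+1) * k.+1)))); first by nia.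
by rewrite leq_mul2l /=; nia.
Qed.

Lemma small_class_exponent h K l w X y : y <= l + h + K -> h < w -> K <= h -> 4 <= w -> 0 < X ->
  X * (w * (w * (w * w))) <= y -> h * X <= l.
Proof.
move=> w1 hw hK w4 X1 hy; have : 4 * (X * w) <= y.
  apply: leq_trans hy; rewrite mulnC -mulnA leq_mul2l; apply/orP; right.
  by rewrite leq_mul2l; apply/orP; right; nia.
have : h * X <= w * X by rewrite leq_mul2r (ltnW hw) orbT.
have : w <= X * w by rewrite leq_pmull.
by rewrite [w * X]mulnC; lia.
Qed.

Section ClassBound.
Variables (K h p : nat) (S : seq nat) (F : nat -> nat) (Q : seq nat).
Hypotheses (uS : uniq S) (szS : size S = K).
Hypothesis S_pr : {in S, forall p', prime p' /\ odd p'}.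
Hypotheses (pS : p \in S) (uQ : uniq Q) (leh : long_height K <= h).
Hypothesis Q_pr : {in Q, forall q, prime q /\ 3 <= q <= 2 ^ h}.
Hypothesis Q_sub : {in Q, forall q, {subset primes (rep q (F q)) <= S}}.
Hypothesis Q_top : {in Q, forall q, p %| rep q (F q) /\
  (forall p', p' \in primes (rep q (F q)) -> p' <= p)}.
Hypothesis Q_large : {in Q, forall q, h ^ long_exp K <= F q}.
Notation kap := (long_kappa K).
Let lam := (trunc_log 2 p).+1.
Let H1 := 10 * K.+1 * (lam + h + K).
Let p_pr : prime p. Proof. by case: (S_pr pS). Qed.
Let K0 : 0 < K. Proof. by rewrite -szS; case: S pS. Qed.

Let lhE : [/\ baker_height (K.+1 + K.+1) <= h, 2 ^ (4 * kap + 20) <= h, 2 * long_coef K <= h & K <= h].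
Proof. by have := leh; rewrite /long_height; split; lia. Qed.

Let h1 : 4 <= h.
Proof. by case: lhE => _ h2 _ _; apply: leq_trans h2; rewrite (@leq_exp2l 2 2) //; lia. Qed.

Let F1 q : q \in Q -> 1 < F q.
Proof.
move=> qQ; apply: leq_trans (Q_large qQ); apply: (@leq_trans h); first exact: leq_trans h1.
by rewrite -[leqLHS]expn1 leq_pexp2l // ?(leq_trans _ h1) // /long_exp; lia.
Qed.

Let plam : 2 ^ lam.-1 <= p < 2 ^ lam.
Proof. by apply: trunc_log_bounds => //; apply: prime_gt0. Qed.

Lemma class_logn q p' : q \in Q -> p' \in S ->
  logn p' (rep q (F q)) <= h * 2 ^ lam + trunc_log 2 (F q).
Proof.
move=> qQ p'S; have [p'_pr p'_odd] := S_pr p'S.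
have [q_pr /andP[q3 qh]] := Q_pr qQ; have q0 := prime_gt0 q_pr; have Fq := F1 qQ.
have r0 : 0 < rep q (F q) by apply: rep_gt0; apply: ltnW.
have [->//|] := posnP (logn p' (rep q (F q))).
rewrite logn_gt0 => dvd; have [_ /(_ _ dvd) le_p] := Q_top qQ.
have := logn_rep_bound p'_pr p'_odd (prime_gt1 q_pr) (ltnW Fq).
set u := logn _ _ => leu; rewrite -ltnS -(@ltn_exp2l 2) //.
apply: (@leq_ltn_trans (p' ^ u)).
  by case: (u) => // k; rewrite leq_exp2r // prime_gt1.
apply: (leq_ltn_trans leu); rewrite -addnS expnD.
have /andP[_ ltF] := trunc_log_bounds (isT : 1 < 2) (ltnW Fq).
apply: leq_ltn_trans (_ : 2 ^ (h * 2 ^ lam) * F q < _).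
  rewrite leq_mul2r expnM; apply/orP; right.
  apply: (@leq_trans ((2 ^ h) ^ p')); first by rewrite leq_exp2r // prime_gt0.
  rewrite leq_pexp2l ?expn_gt0 // (leq_trans le_p) // ltnW //.
  by case/andP: plam.
by rewrite ltn_mul2l expn_gt0.
Qed.

Lemma class_rep_bound q B : q \in Q -> {in S, forall p', logn p' (rep q (F q)) <= B} ->
  rep q (F q) <= 2 ^ (lam * B * K).
Proof.
move=> qQ leB; have r0 : 0 < rep q (F q) by apply: rep_gt0; apply/ltnW/F1.
rewrite {1}(prod_logn_sub uS r0 (Q_sub qQ)) -szS expnM.
have -> : (2 ^ (lam * B)) ^ size S = \prod_(p' <- S) 2 ^ (lam * B).
  by rewrite big_const_seq count_predT iter_muln_1.
rewrite !big_seq; apply: leq_prod => p' p'S; rewrite expnM.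
have [->|] := posnP (logn p' (rep q (F q))); first by rewrite expn0 !expn_gt0.
move=> pos; have := pos; rewrite logn_gt0 => dvd; have [_ /(_ _ dvd) le_p] := Q_top qQ.
apply: (@leq_trans ((2 ^ lam) ^ logn p' (rep q (F q)))).
  by rewrite leq_exp2r // (leq_trans le_p) // ltnW //; case/andP: plam.
by rewrite leq_pexp2l ?expn_gt0 // leB.
Qed.

Lemma class_F_bound q : q \in Q -> F q <= 2 ^ (4 * lam + 2 * K + 2 * h + 8).
Proof.
move=> qQ; have [q_pr /andP[q3 qh]] := Q_pr qQ; have Fq := F1 qQ.
apply: (@len_bound lam K h (F q) (trunc_log 2 (F q))) => //; first exact: leq_trans h1.
  by case/andP: (trunc_log_bounds (isT : 1 < 2) (ltnW Fq)).
rewrite [K * lam]mulnC mulnAC -(@leq_exp2l 2) //.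
apply: (leq_trans _ (leq_trans (leq_rep q (ltnW Fq)) (class_rep_bound qQ (fun p' => @class_logn q p' qQ)))).
by case: (F q) Fq => [|[|k]] // _; rewrite leq_exp2r // ltnW.
Qed.

Let Theta := H1 ^ kap.+1.

(** The exponents and the [F q] are at most 2 to a power linear in [lam], [h] and [K], where [lam]
    is the binary length of the largest prime [p]. Hence Baker's theorem can be used at a height
    [H1] linear in [lam], and it applies once [F q] reaches the power [Theta] of [H1]. *)
Lemma class_large : size [seq q <- Q | Theta <= F q] <= K.
Proof.
pose U := 2 * 2 ^ (lam + h + K + 4).
have hH : h <= H1 by rewrite /H1; nia.
apply: (@long_reps_core K S F uS szS _ _ U H1).
- by move=> p' /S_pr[].
- exact: filter_uniq.
- move=> q; rewrite mem_filter => /andP[_ /Q_pr[q_pr /andP[q3 qh]]]; split => //.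
  by rewrite q3 (leq_trans qh) // leq_exp2l.
- by move=> q; rewrite mem_filter => /andP[_ qQ]; apply: Q_sub.
- move=> q p'; rewrite mem_filter => /andP[_ qQ] p'S; apply: leq_trans (class_logn qQ p'S) _.
  have ltl : trunc_log 2 (F q) <= 4 * lam + 2 * K + 2 * h + 8.
    by rewrite -(@leq_exp2l 2) // (leq_trans _ (class_F_bound qQ)) // trunc_logP // ltnW // F1.
  have lb : 4 * (lam + h + K + 1) + 5 <= 2 ^ (lam + h + K + 4).
    by have := lin_exp_bound (lam + h + K + 1); rewrite -(addnA _ 1 3).
  have : h * 2 ^ lam <= 2 ^ (lam + h + K + 4).
    apply: (@leq_trans (2 ^ h * 2 ^ lam)); first by rewrite leq_mul2r (ltnW (self_lt_exp2 _)) orbT.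
    by rewrite -expnD leq_exp2l //; lia.
  have gen X Y t l : 4 * (l + h + K + 1) + 5 <= X -> Y <= X ->
    t <= 4 * l + 2 * K + 2 * h + 8 -> Y + t <= 2 * X by clear; lia.
  by move=> hl; apply: gen lb hl ltl.
- by rewrite muln_gt0 expn_gt0.
- move=> q; rewrite mem_filter => /andP[_ qQ].
  apply: (@leq_trans ((2 ^ K.+1 * U) ^ K * 2 ^ (4 * lam + 2 * K + 2 * h + 8))).
    rewrite leq_mul ?class_F_bound // leq_exp2r // leq_mul2r.
    by rewrite (ltnW (self_lt_exp2 _)) orbT.
  rewrite /U -expnS -expnD -expnM -expnD leq_exp2l // /H1.
  by have : 0 < lam by []; move: lam K0; clear; move=> l K0 l0; nia.
- by move=> q; rewrite mem_filter => /andP[].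
- by case: lhE => h2 _ _ _; apply: leq_trans hH.
Qed.

(** Here the exponents are bounded through [F q] rather than through [p], by
    [rep q (F q) < 2 ^ (h * Theta)]. As [Theta] is a power of [H1], the height [H2] grows only with
    [w], the logarithm of [lam]. *)
Lemma class_small : size [seq q <- Q | F q < Theta] <= K.
Proof.
case: lhE => hB hk hC hK.
pose w := (trunc_log 2 (lam + h + K)).+1; pose H2 := long_coef K * (w + h).
have /andP[w1 w2] : 2 ^ w.-1 <= lam + h + K < 2 ^ w.
  by apply: trunc_log_bounds => //; rewrite addn_gt0 addn_gt0.
have C0 : 0 < long_coef K by rewrite /long_coef !muln_gt0 addn_gt0 orbT.
have hH2 : h <= H2.
  by apply: leq_trans (leq_pmull _ C0); apply: leq_addl.
have H1w : H1 <= 2 ^ (4 + K + w).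
  rewrite !(expnD 2) /H1; apply: leq_mul (ltnW w2).
  by apply: leq_mul => //; apply: self_lt_exp2.
have Thw : Theta <= 2 ^ ((4 + K + w) * kap.+1) by rewrite expnM leq_exp2r.
apply: (@long_reps_core K S F uS szS _ _ (h * Theta) H2).
- by move=> p' /S_pr[].
- exact: filter_uniq.
- move=> q; rewrite mem_filter => /andP[_ /Q_pr[q_pr /andP[q3 qh]]]; split => //.
  by rewrite q3 (leq_trans qh) // leq_exp2l.
- by move=> q; rewrite mem_filter => /andP[_ qQ]; apply: Q_sub.
- move=> q p'; rewrite mem_filter => /andP[ltF qQ] p'S.
  have [q_pr /andP[q3 qh]] := Q_pr qQ; have [p'_pr _] := S_pr p'S.
  rewrite -(@leq_exp2l 2) //; apply: (@leq_trans (p' ^ logn p' (rep q (F q)))).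
    by case: (logn _ _) => // k; rewrite leq_exp2r // prime_gt1.
  apply: (@leq_trans (rep q (F q))).
    by apply: dvdn_leq (pfactor_dvdnn _ _); apply: rep_gt0; apply/ltnW/F1.
  apply: (leq_trans (ltnW (rep_lt _ (prime_gt1 q_pr)))).
  apply: (@leq_trans ((2 ^ h) ^ F q)); first by rewrite leq_exp2r // ltnW // F1.
  by rewrite -expnM leq_exp2l // leq_mul2l ltnW ?orbT.
- rewrite muln_gt0 (leq_trans _ h1) // /Theta expn_gt0 /H1.
  by rewrite !muln_gt0 !addn_gt0 K0 !orbT.
- move=> q; rewrite mem_filter => /andP[ltF qQ].
  set e := (4 + K + w) * kap.+1 in Thw.
  apply: (@leq_trans ((2 ^ K * (2 ^ h * 2 ^ e)) ^ K * 2 ^ e)).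
    rewrite leq_mul ?(leq_trans (ltnW ltF)) // leq_exp2r //.
    by rewrite !leq_mul // ?(self_lt_exp2 K) // ltnW // self_lt_exp2.
  rewrite -!expnD -expnM -expnD leq_exp2l // /H2 /long_coef /e.
  by apply: small_exponent; apply: leq_trans h1.
- move=> q; rewrite mem_filter => /andP[_ qQ].
  have [wh|hw] := leqP w h.
    apply: leq_trans (Q_large qQ); rewrite /long_exp expnM leq_exp2r // /H2.
    apply: (@leq_trans (long_coef K * (h + h))); first by rewrite leq_mul2l leq_add2r wh orbT.
    by rewrite addnn -mul2n mulnA [long_coef K * 2]mulnC -mulnn leq_mul2r hC orbT.
  have [q_pr /andP[q3 qh]] := Q_pr qQ.
  (* When [w] exceeds [h], the required size of [F q] comes from [p] itself: [p] divides
     [rep q (F q) < 2 ^ (h * F q)], so [F q >= lam / h], where [lam] is about [2 ^ w] and exceeds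
     the power of [w] in question. *)
  have lamF : lam <= h * F q.
    rewrite /lam -(@ltn_exp2l 2) //; case/andP: plam => pl _; apply: (leq_ltn_trans pl).
    have [dvd _] := Q_top qQ.
    apply: (leq_ltn_trans (dvdn_leq (rep_gt0 _ (ltnW (F1 qQ))) dvd)).
    apply: (leq_trans (rep_lt _ (prime_gt1 q_pr))).
    by rewrite expnM leq_exp2r // ltnW // F1.
  apply: (@leq_trans ((w ^ 2) ^ kap.+1)).
    rewrite leq_exp2r // /H2; apply: (@leq_trans (long_coef K * (w + w))).
      by rewrite leq_mul2l leq_add2l (ltnW hw) orbT.
    by rewrite addnn -mul2n mulnA [long_coef K * 2]mulnC -mulnn leq_mul2r (leq_trans hC) ?orbT // ltnW.
  have big : 2 * w ^ (2 * kap + 6) <= 2 ^ w.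
    apply: exp_poly_le (leq_trans hk (ltnW hw)); by move: kap; clear; lia.
  have w4 : 4 <= w by apply: leq_trans h1 (ltnW hw).
  rewrite -expnM (_ : 2 * kap.+1 = 2 * kap + 2); last by rewrite mulnS addnC.
  have e6 : 2 * kap + 6 = 2 * kap + 2 + 4 by rewrite -addnA.
  move: big; rewrite e6 (expnD w _ 4).
  have X1 : 1 <= w ^ (2 * kap + 2) by rewrite expn_gt0; case: w w4 {w1 w2 H1w Thw H2 hH2 hw}.
  move: X1; move: (w ^ (2 * kap + 2)) => X X1 big.
  have w2' : 2 ^ w = 2 * 2 ^ w.-1 by rewrite -expnS.
  have h0 : 0 < h by apply: leq_trans h1.
  rewrite -(leq_pmul2l h0); apply: leq_trans lamF.
  have : X * (w * (w * (w * w))) <= 2 ^ w.-1.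
    by move: big; rewrite w2' leq_mul2l /= !expnS expn0 muln1.
  by move=> hy; apply: (small_class_exponent w1 hw hK w4 X1 hy).
- by apply: leq_trans hH2.
Qed.

Lemma class_bound : size Q <= 2 * K.
Proof.
rewrite -(count_predC (fun q => Theta <= F q)) -!size_filter mul2n -addnn.
apply: leq_add; first exact: class_large.
rewrite (eq_filter (a2 := fun q => F q < Theta)); first exact: class_small.
by move=> q /=; rewrite ltnNge.
Qed.

End ClassBound.

Theorem few_long_reps K h (S Q : seq nat) (F : nat -> nat) :
  uniq S -> size S = K -> {in S, forall p, prime p /\ odd p} ->
  uniq Q -> long_height K <= h -> {in Q, forall q, prime q /\ 3 <= q <= 2 ^ h} ->
  {in Q, forall q, {subset primes (rep q (F q)) <= S}} ->
  {in Q, forall q, h ^ long_exp K <= F q} -> size Q <= K * (2 * K).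
Proof.
move=> uS szS S_pr uQ leh Q_pr Q_sub Q_large.
have h1 : 2 <= h.
  apply: leq_trans leh; rewrite /long_height.
  by have : 2 <= baker_height (K.+1 + K.+1); [rewrite -[2]/(2 ^ 1) leq_exp2l // addn_gt0 orbT | lia].
pose top q := max_pdiv (rep q (F q)).
have F1 q : q \in Q -> 1 < F q.
  move=> qQ; apply: leq_trans (Q_large _ qQ); apply: (leq_trans h1).
  by rewrite -[leqLHS]expn1 leq_pexp2l // ?(ltnW h1) // /long_exp muln_gt0.
have rep1 q : q \in Q -> 1 < rep q (F q).
  move=> qQ; have [q_pr _] := Q_pr _ qQ; apply: leq_trans (leq_rep _ (ltnW (F1 _ qQ))).
  case: (F q) (F1 q qQ) => [|[|k]] // _; rewrite -[2]/(2 ^ 1).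
  apply: leq_trans (leq_pexp2l (prime_gt0 q_pr) (isT : 0 < k.+1)).
  by rewrite leq_exp2r // prime_gt1.
have -> : size Q = \sum_(p <- S) size [seq q <- Q | top q == p].
  under eq_bigr do rewrite size_filter -sum1_count.
  rewrite (exchange_big_dep xpredT) //= -sum1_size [LHS]big_seq [RHS]big_seq.
  apply: eq_bigr => q qQ; rewrite sum1_count (eq_count (a2 := pred1 (top q))); last first.
    by move=> p /=; rewrite eq_sym.
  rewrite count_uniq_mem // (Q_sub q qQ) // mem_primes max_pdiv_dvd.
  by rewrite max_pdiv_prime ?rep1 // (ltnW (rep1 _ qQ)).
apply: (@leq_trans (\sum_(p <- S) 2 * K)); last first.
  by rewrite big_const_seq count_predT iter_addn_0 szS mulnC.
rewrite [leqLHS]big_seq [leqRHS]big_seq; apply: leq_sum => p pS.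
apply: (@class_bound K h p S F) => //.
- exact: filter_uniq.
- by move=> q; rewrite mem_filter => /andP[_]; apply: Q_pr.
- by move=> q; rewrite mem_filter => /andP[_]; apply: Q_sub.
- move=> q; rewrite mem_filter => /andP[/eqP <- qQ]; split; first exact: max_pdiv_dvd.
  by move=> p'; rewrite mem_primes => /and3P[p'_pr r0 dvd]; apply: max_pdiv_max; rewrite mem_primes p'_pr r0.
- by move=> q; rewrite mem_filter => /andP[_]; apply: Q_large.
Qed.

(** * Auxiliary polynomials of Thue type *)

Section RepPoly.
Local Open Scope ring_scope.

Definition reppoly F : {poly int} := \sum_(i < F) 'X^i.

Lemma horner_reppoly F (x : nat) : (reppoly F).[x%:Z] = (rep x F)%:Z.
Proof.
rewrite /reppoly /rep horner_sum (big_morph Posz PoszD (erefl 0%:Z)).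
by apply: eq_bigr => i _; rewrite hornerXn -!natz natrX.
Qed.

Lemma Xn_mod_reppoly F e : (0 < F)%N ->
  exists D, 'X^e = 'X^(e %% F) + reppoly F * D :> {poly int}.
Proof.
move=> F0; rewrite {1}(divn_eq e F) exprD mulnC exprM.
exists (('X - 1) * (\sum_(i < e %/ F) ('X^F) ^+ i) * 'X^(e %% F)).
have h : ('X - 1) * reppoly F = 'X^F - 1 :> {poly int}.
  by rewrite [RHS]subrX1.
by rewrite !mulrA [reppoly F * _]mulrC h -subrX1; ring.
Qed.

(** Modulo [reppoly F], a divisor of [X ^ F - 1], exponents may be reduced modulo [F]; the result is
    a multiple as soon as all its [F] coefficients agree. Comparing each of them with the one at
    residue 0 costs only [F.-1] equations, which matters for the count of unknowns. *)
Lemma reppoly_dvd F (J : finType) (c : J -> int) (e : J -> nat) : (0 < F)%N ->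
  (forall r, (r < F.-1)%N ->
    \sum_j c j * ((e j %% F == r.+1)%N%:Z - (e j %% F == 0)%N%:Z) = 0) ->
  exists C, \sum_j c j *: 'X^(e j) = reppoly F * C.
Proof.
move=> F0 H.
have [D hD] := fin_all_exists (fun j => Xn_mod_reppoly (e j) F0).
pose E r := \sum_j c j * (e j %% F == r)%N%:Z.
have EE r : (r < F)%N -> E r = E 0%N.
  case: r => // r ltr; apply/eqP; rewrite -subr_eq0 -sumrB; apply/eqP.
  rewrite -[RHS](H r); last by rewrite -ltnS prednK.
  by apply: eq_bigr => j _; rewrite mulrBr.
exists (\sum_j c j *: D j + (E 0%N)%:P).
have -> : \sum_j c j *: 'X^(e j) = \sum_j c j *: 'X^(e j %% F) + reppoly F * \sum_j c j *: D j.
  rewrite mulr_sumr -big_split /=; apply: eq_bigr => j _.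
  by rewrite {1}hD scalerDr scalerAr.
rewrite mulrDr addrC; congr (_ + _).
have -> : \sum_j c j *: 'X^(e j %% F) = \sum_(r < F) (E r)%:P * 'X^r :> {poly int}.
  rewrite /E; under [RHS]eq_bigr do rewrite rmorph_sum mulr_suml.
  rewrite exchange_big /=; apply: eq_bigr => j _.
  rewrite (bigD1 (Ordinal (ltn_pmod (e j) F0))) //= eqxx mulr1 mul_polyC.
  rewrite big1 ?addr0 // => r ner; rewrite (_ : _ == _ = false) ?mulr0 ?mul0r //.
  by apply/negbTE; apply: contra ner => /eqP h; apply/eqP/val_inj.
rewrite /reppoly mulr_suml; apply: eq_bigr => r _.
by rewrite EE // mulrC.
Qed.

End RepPoly.

Section Auxiliary.
Local Open Scope ring_scope.
Variables (F tau : nat).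
Hypotheses (F3 : (3 <= F)%N) (tau_gt0 : (0 < tau)%N).
Notation f := F.-1.
(* Order of contact, degree, and coefficient bound of the auxiliary polynomials. *)
Definition aux_order := (8 * tau)%N.
Definition aux_deg := ((4 * f - 3) * tau)%N.
Definition aux_height := (((2 * aux_deg + aux_order + 2) * 2 ^ (aux_deg + aux_order)) ^ (4 * f))%N.
Notation t := aux_order.
Notation n := aux_deg.

(* [A - y B] vanishes to order [t] at every [y <> 1] with [y^F = 1]. *)
Lemma aux_polys : exists A B : {poly int},
  [/\ (size A <= (n + t).+1)%N, (size B <= n.+1)%N,
      (A != 0) || (B != 0),
      (forall i, `|(A`_i)%R| <= aux_height)%N /\ (forall i, `|(B`_i)%R| <= aux_height)%N &
      forall k, (k < t)%N -> exists C, A^`N(k) - 'X * B^`N(k) = reppoly F * C].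
Proof.
pose J := ('I_(n + t).+1 + 'I_n.+1)%type.
(* Exponents and coefficients of the monomials in the Hasse derivative of order [k] of [A] and in
   minus ['X] times that of [B]. For [j < k] the binomial vanishes, so the truncated subtraction is
   harmless. *)
pose e k (j : J) := (match j with inl j => j - k | inr j => (j - k).+1 end)%N.
pose c k (j : J) : int := match j with inl j => 'C(j, k)%:Z | inr j => - 'C(j, k)%:Z end.
pose a (kr : 'I_t * 'I_f) (j : J) : int :=
  c kr.1 j * ((e kr.1 j %% F == kr.2.+1)%N%:Z - (e kr.1 j %% F == 0)%N%:Z).
have binle (m k : nat) : (m <= n + t)%N -> ('C(m, k) <= 2 ^ (n + t))%N.
  move=> lem; have [lek|ltk] := leqP k m; last by rewrite bin_small.
  apply: (@leq_trans (2 ^ m)); last by rewrite leq_exp2l.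
  rewrite -[2%N]/(1 + 1)%N expnDn (bigD1 (Ordinal (lek : (k < m.+1)%N))) //=.
  by rewrite !exp1n !muln1 leq_addr.
have a_bnd kr j : (`|a kr j| <= 2 ^ (n + t))%N.
  rewrite /a abszM; apply: (@leq_trans (`|c kr.1 j| * 1)).
    by rewrite leq_mul2l; apply/orP; right; case: (_ == _); case: (_ == _).
  rewrite muln1; case: j => j /=; rewrite ?abszN ?absz_nat; apply: binle; have := ltn_ord j; rewrite ltnS //.
  by move/leq_trans; apply; apply: leq_addr.
have cardJ : #|{: J}| = (2 * n + t + 2)%N by rewrite card_sum !card_ord; lia.
have cardI : #|{: 'I_t * 'I_f}| = (8 * tau * f)%N by rewrite card_prod !card_ord.
(* There are [8 * tau * f] equations and [2 * tau + 2] more unknowns; the quotient of [8 * tau * f]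
   by [2 * tau] is the exponent [4 * f] in [aux_height]. *)
have eJ : (2 * n + t + 2 = 8 * tau * f + (2 * tau + 2))%N.
  by rewrite /aux_deg /aux_order; move: F3; clear; case: F => [|[|[|k]]] //= _; nia.
have [|x [[j0 nz] x_bnd rel]] := siegel (X := aux_height) a_bnd.
  rewrite cardI cardJ; set Y := ((2 * n + t + 2) * 2 ^ (n + t))%N.
  have Y0 : (0 < Y)%N by rewrite muln_gt0 expn_gt0 addn_gt0 orbT.
  apply: (@leq_ltn_trans ((Y * aux_height.+1) ^ (8 * tau * f))).
    have [->//|] := posnP (8 * tau * f)%N; move=> pos.
    by rewrite leq_exp2r // mulnS -addn1 addnC leq_add2r.
  rewrite eJ expnMn [ltnRHS]expnD mulnC ltn_pmul2l ?expn_gt0 //.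
  have -> : (Y ^ (8 * tau * f) = aux_height ^ (2 * tau))%N.
    by rewrite /aux_height -/Y -expnM; congr (_ ^ _)%N; lia.
  apply: (@leq_trans (aux_height.+1 ^ (2 * tau))); last by rewrite leq_pexp2l // leq_addr.
  by rewrite ltn_exp2r // muln_gt0.
pose A : {poly int} := \sum_(j < (n + t).+1) x (inl j) *: 'X^j.
pose B : {poly int} := \sum_(j < n.+1) x (inr j) *: 'X^j.
have coefA (j : 'I_(n + t).+1) : A`_j = x (inl j).
  rewrite /A coef_sum (bigD1 j) //= coefZ coefXn eqxx mulr1 big1 ?addr0 // => i ne.
  by rewrite coefZ coefXn (_ : _ == _ = false) ?mulr0 //; apply/negbTE; rewrite eq_sym; exact: ne.
have coefB (j : 'I_n.+1) : B`_j = x (inr j).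
  rewrite /B coef_sum (bigD1 j) //= coefZ coefXn eqxx mulr1 big1 ?addr0 // => i ne.
  by rewrite coefZ coefXn (_ : _ == _ = false) ?mulr0 //; apply/negbTE; rewrite eq_sym; exact: ne.
have szA : (size A <= (n + t).+1)%N.
  apply: (leq_trans (size_sum _ _ _)); apply/bigmax_leqP => i _.
  by apply: leq_trans (size_scale_leq _ _) _; rewrite size_polyXn.
have szB : (size B <= n.+1)%N.
  apply: (leq_trans (size_sum _ _ _)); apply/bigmax_leqP => i _.
  by apply: leq_trans (size_scale_leq _ _) _; rewrite size_polyXn.
exists A, B; split => //.
- case: j0 nz => j; [rewrite -coefA | rewrite -coefB] => nz; apply/orP; [left|right];
    by apply: contraNneq nz => ->; rewrite coef0.
- split=> i.
    by have [lt|le] := ltnP i (n + t).+1; [rewrite (coefA (Ordinal lt)) | rewrite nth_default // (leq_trans szA)].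
  by have [lt|le] := ltnP i n.+1; [rewrite (coefB (Ordinal lt)) | rewrite nth_default // (leq_trans szB)].
move=> k ltk; have := @reppoly_dvd F J (fun j => x j * c k j) (e k).
have F0 : (0 < F)%N by apply: leq_trans F3.
move=> /(_ F0) [r ltr|C hC].
  rewrite -[RHS](rel (Ordinal ltk, Ordinal ltr)); apply: eq_bigr => j _.
  by rewrite /a /= [RHS]mulrC mulrA.
exists C; rewrite -hC big_sumType /=; congr (_ + _).
  rewrite /A raddf_sum; apply: eq_bigr => j _.
  by rewrite /= nderivnZ nderivnXn -scaler_nat scalerA natz.
rewrite /B raddf_sum mulr_sumr -sumrN; apply: eq_bigr => j _.
rewrite /= nderivnZ nderivnXn -scaler_nat scalerA natz -scalerAr -exprS.
by rewrite mulrN scaleNr.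
Qed.

End Auxiliary.

(** * Multiplicities of roots and Wronskians *)

Section Multiplicity.
Local Open Scope ring_scope.
Variable K : numFieldType.
Implicit Types (P Q W : {poly K}) (z : K).

Lemma nderivn_root_dvd P z m : (forall k, (k < m)%N -> P^`N(k).[z] = 0) ->
  ('X - z%:P) ^+ m %| P.
Proof.
elim: m P => [|m IHm] P Pz; first by rewrite expr0 dvd1p.
have /factor_theorem[Q def_P] : root P z.
  by have := Pz 0%N isT; rewrite nderivn0 /root => ->.
rewrite exprSr def_P; apply: dvdp_mul => //; apply: IHm => k ltk.
have := Pz k.+1 ltk; rewrite def_P mulrBr nderivnB.
rewrite -[Q * 'X]addr0 -polyC0 nderivnMXaddC -[Q * _%:P]mulrC mul_polyC nderivnZ !hornerE.
by rewrite [_ * z]mulrC addrK.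
Qed.

Lemma sum_mult_lt_size (rs : seq K) (e : K -> nat) W : uniq rs -> W != 0 ->
  {in rs, forall z, ('X - z%:P) ^+ e z %| W} -> (\sum_(z <- rs) e z < size W)%N.
Proof.
elim: rs W => [|z rs IHrs] W /=; first by rewrite big_nil size_poly_gt0.
move=> /andP[z_rs u_rs] W0 dvd.
have /dvdpP[Q def_W] := dvd z (mem_head _ _).
have Q0 : Q != 0 by apply: contraNneq W0 => Q0; rewrite def_W Q0 mul0r.
have := IHrs Q u_rs Q0; rewrite big_cons def_W size_Mmonic ?monic_exp ?monicXsubC //.
rewrite size_exp_XsubC addnS /= => IH; rewrite addnC ltn_add2r; apply: IH => z' z'rs.
have := dvd z'; rewrite in_cons z'rs orbT => /(_ isT).
rewrite def_W Gauss_dvdpl // coprimep_expl // coprimep_expr // coprimep_XsubC.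
by rewrite root_XsubC; apply: contraTN z'rs => /eqP e'; first [by rewrite e' | by rewrite -e'].
Qed.

Definition wronskian P Q := P^`() * Q - P * Q^`().

Lemma wronskianB P Q c : wronskian (P - c *: Q) Q = wronskian P Q.
Proof. by rewrite /wronskian derivB derivZ -!mul_polyC; ring. Qed.

(** Subtracting [c *: Q] does not change the Wronskian and differentiation costs one order. So a
    single polynomial records the contact of [P] with [c *: Q] for all constants [c] at once. *)
Lemma wronskian_dvd P Q c z m : ('X - z%:P) ^+ m.+1 %| P - c *: Q ->
  ('X - z%:P) ^+ m %| wronskian P Q.
Proof.
rewrite -(wronskianB _ _ c) => /dvdpP[C ->]; rewrite /wronskian.
have : ('X - z%:P) ^+ m %| ('X - z%:P) ^+ m.+1 by rewrite exprS dvdp_mull.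
move=> dvd; rewrite dvdp_sub //.
  rewrite dvdp_mulr // derivM dvdp_add // ?dvdp_mull //.
  by rewrite deriv_exp -mulr_natr dvdp_mulr // dvdp_mull.
by rewrite dvdp_mulr // dvdp_mull.
Qed.

Lemma coefM_top P Q d e : (size P <= d.+1)%N -> (size Q <= e.+1)%N ->
  (P * Q)`_(d + e) = P`_d * Q`_e.
Proof.
move=> szP szQ; rewrite coefM.
have ltd : (d < (d + e).+1)%N by rewrite ltnS leq_addr.
rewrite (bigD1 (Ordinal ltd)) //= addKn big1 ?addr0 // => i nei.
have [lt|le] := ltnP i d.
  by rewrite [Q`__]nth_default ?mulr0 // (leq_trans szQ) //; lia.
rewrite [P`__]nth_default ?mul0r // (leq_trans szP) // ltn_neqAle le andbT.
by apply: contra nei => /eqP h; apply/eqP/val_inj.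
Qed.

(** In [X P' Q = X P Q'] the top coefficients are those of [P Q] times the degree of [P] and of [Q]
    respectively; in characteristic zero the degrees agree. *)
Lemma wronskian_eq0_size P Q : P != 0 -> Q != 0 -> wronskian P Q = 0 -> size P = size Q.
Proof.
move=> P0 Q0 W0; pose d := (size P).-1; pose e := (size Q).-1.
have szP : size P = d.+1 by rewrite prednK // size_poly_gt0.
have szQ : size Q = e.+1 by rewrite prednK // size_poly_gt0.
have XW : ('X * P^`()) * Q = P * ('X * Q^`()).
  have /eqP := W0; rewrite /wronskian subr_eq0 => /eqP h.
  by rewrite -mulrA h mulrCA.
have coefXD (R : {poly K}) k : ('X * R^`())`_k = R`_k *+ k.
  by rewrite coefXM coef_deriv; case: k.
have szXD (R : {poly K}) : (size ('X * R^`())%R <= size R)%N.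
  apply/leq_sizeP => k lek; rewrite coefXD nth_default ?mul0rn //.
have := congr1 (fun p : {poly K} => p`_(d + e)) XW.
rewrite /= (coefM_top (d := d) (e := e)) ?(leq_trans (szXD _)) ?szP ?szQ //.
rewrite (coefM_top (d := d) (e := e)) ?(leq_trans (szXD _)) ?szP ?szQ // !coefXD.
have lP : P`_d != 0 by rewrite -lead_coefE lead_coef_eq0.
have lQ : Q`_e != 0 by rewrite -lead_coefE lead_coef_eq0.
rewrite mulrnAl mulrnAr; set l := P`_d * Q`_e.
have l0 : l != 0 by rewrite mulf_neq0.
rewrite -[l *+ d]mulr_natr -[l *+ e]mulr_natr => /(mulfI l0) /eqP h.
by congr _.+1; apply/eqP; rewrite -(eqr_nat K).
Qed.

(** Choose [c] so that the leading terms cancel. If [P - c *: Q] were nonzero, it would have the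
    size of [Q], its Wronskian with [Q] being zero too; but its coefficient in that degree is
    zero. *)
Lemma wronskian_eq0 P Q : Q != 0 -> wronskian P Q = 0 -> exists c, P = c *: Q.
Proof.
move=> Q0 W0; have [->|P0] := eqVneq P 0; first by exists 0; rewrite scale0r.
have sz := wronskian_eq0_size P0 Q0 W0.
have lQ : lead_coef Q != 0 by rewrite lead_coef_eq0.
pose c := lead_coef P / lead_coef Q; exists c; apply/eqP; rewrite -subr_eq0.
apply/eqP/eqP; apply: contraT => D0.
have := wronskian_eq0_size D0 Q0; rewrite wronskianB => /(_ W0) => e.
have : lead_coef (P - c *: Q) = 0.
  by rewrite lead_coefE e coefB coefZ -[Q`__]lead_coefE /c divfK // lead_coefE sz subrr.
by move/eqP; rewrite lead_coef_eq0 (negbTE D0).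
Qed.

End Multiplicity.

Section Nonvanishing.
Local Open Scope ring_scope.
Variables (F tau : nat) (A B : {poly int}).
Hypotheses (F3 : (3 <= F)%N) (tau_gt0 : (0 < tau)%N).
Notation f := F.-1.
Notation t := (aux_order tau).
Notation n := (aux_deg F tau).
Hypotheses (szA : (size A <= (n + t).+1)%N) (szB : (size B <= n.+1)%N).
Hypothesis AB0 : (A != 0) || (B != 0).
Hypothesis AB_dvd : forall k, (k < t)%N ->
  exists C, A^`N(k) - 'X * B^`N(k) = reppoly F * C.

Let a : {poly algC} := map_poly intr A.
Let b : {poly algC} := map_poly intr B.

Let sza : (size a <= (n + t).+1)%N.
Proof. by rewrite size_map_inj_poly // => x y /eqP; rewrite eqr_int => /eqP. Qed.
Let szb : (size b <= n.+1)%N.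
Proof. by rewrite size_map_inj_poly // => x y /eqP; rewrite eqr_int => /eqP. Qed.
Let map0 (P : {poly int}) : (map_poly intr P == 0 :> {poly algC}) = (P == 0).
Proof.
by rewrite -!size_poly_eq0 size_map_inj_poly // => x y /eqP; rewrite eqr_int => /eqP.
Qed.

(** Excludes the degenerate cases: for [B = 0], [A] would have [f] zeros of order [t] with degree at
    most [n + t]; for [A = c B], [B] would have at least [f - 1] of them with degree at most [n]. So
    the Wronskian is not zero. *)
Lemma aux_deg_lt_order : ((f - 1) * t > n)%N /\ (f * t > n + t)%N.
Proof.
rewrite /aux_order /aux_deg; move: F3 tau_gt0; case: F => [|[|[|k]]] //= _ t0.
have -> : (4 * k.+2 - 3 = 4 * k + 5)%N by lia.
by rewrite !subSS subn0; split; nia.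
Qed.

(* The Wronskian of [A] and [B] is divisible by [((X^F - 1) / (X - 1))^(t - 1)], so
   its multiplicity at [q1] is small. *)
Lemma aux_nonvanishing (q1 : nat) (q2 : int) : (2 <= q1)%N ->
  exists i, (i <= 2 * tau + f)%N /\ (A^`N(i)).[q1%:Z] - q2 * (B^`N(i)).[q1%:Z] != 0.
Proof.
move=> q1_2; have F0 : (0 < F)%N by apply: leq_trans F3.
have [z z_prim] := C_prim_root_exists F0.
pose rs := [seq z ^+ i | i <- iota 1 f].
have zF i : (z ^+ i) ^+ F = 1 by rewrite exprAC (prim_expr_order z_prim) expr1n.
have rs_u : uniq rs.
  rewrite map_inj_in_uniq ?iota_uniq // => i j; rewrite !mem_iota => /andP[_ li] /andP[_ lj] /eqP.
  by rewrite (eq_prim_root_expr z_prim) !modn_small => [/eqP||]; move: li lj F0; clear; lia.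
have rs_root x : x \in rs -> x != 1 /\ x ^+ F = 1.
  move=> /mapP[i]; rewrite mem_iota => /andP[i0 lti] ->; split=> //.
  rewrite -(prim_order_dvd z_prim) gtnNdvd //; move: lti F0; clear; lia.
have dvd_root x : x \in rs -> ('X - x%:P) ^+ t %| a - x *: b.
  move=> /rs_root[x1 xF]; apply: nderivn_root_dvd => k ltk.
  have [C hC] := AB_dvd ltk.
  have s0 : (map_poly intr (reppoly F)).[x] = 0 :> algC.
    have : (x - 1) * (map_poly intr (reppoly F)).[x] = 0.
      rewrite /reppoly rmorph_sum horner_sum.
      rewrite (eq_bigr (fun i : 'I_F => x ^+ i)) => [|i _]; last first.
        by rewrite /= map_polyXn hornerXn.
      by rewrite -subrX1 xF subrr.
    by move/eqP; rewrite mulf_eq0 subr_eq0 (negbTE x1) => /eqP.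
  have := congr1 (fun P : {poly int} => (map_poly intr P).[x] : algC) hC.
  rewrite /= rmorphB !rmorphM /= map_polyX !hornerE s0 mul0r => h.
  by rewrite nderivnB nderivnZ hornerD hornerN hornerZ /a /b !nderivn_map.
have big_const_rs (s : seq algC) (m : nat) : (\sum_(x <- s) m = size s * m)%N.
  by rewrite big_const_seq count_predT iter_addn_0 mulnC.
have sz_rs : size rs = f by rewrite size_map size_iota.
have [lt1 lt2] := aux_deg_lt_order.
have b0 : b != 0.
  apply/negP => b0; have a0 : a != 0.
    by rewrite map0; move: AB0; rewrite -[B == 0]map0 b0 orbF.
  have := @sum_mult_lt_size algC rs (fun=> t) a rs_u a0.
  rewrite big_const_rs sz_rs => h; have : (f * t < size a)%N.
    by apply: h => x xrs; have := dvd_root x xrs; rewrite (eqP b0) scaler0 subr0.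
  by move=> h2; have := leq_trans h2 sza; rewrite ltnS leqNgt lt2.
have W0 : wronskian a b != 0.
  apply/negP => /eqP /(wronskian_eq0 b0)[c def_a].
  pose rs' := [seq x <- rs | x != c].
  have := @sum_mult_lt_size algC rs' (fun=> t) b (filter_uniq _ rs_u) b0.
  rewrite big_const_rs => h; have : (size rs' * t < size b)%N.
    apply: h => x; rewrite mem_filter => /andP[xc xrs].
    have := dvd_root x xrs; rewrite def_a -scalerBl dvdpZr //.
    by rewrite subr_eq0 eq_sym.
  have szrs' : (f - 1 <= size rs')%N.
    rewrite -sz_rs -(count_predC (pred1 c) rs) -/(count_mem c rs) count_uniq_mem //.
    rewrite size_filter (eq_count (a2 := predC (pred1 c))) //.
    by case: (c \in rs) => /=; [rewrite addnC addnK | rewrite add0n leq_subr].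
  move=> h2; have := leq_ltn_trans (leq_mul szrs' (leqnn t)) h2.
  by move=> h3; have := leq_trans h3 szb; rewrite ltnS leqNgt lt1.
(* Chosen so that the total multiplicity [I0 + f * (t - 1)] is equal to [2 * n + t], an upper bound
   for the size of the Wronskian, hence strictly above its degree. *)
pose I0 := (2 * tau + f)%N.
have [/existsP[i Pi]|/existsPn allz] := boolP [exists i : 'I_I0.+1,
    (A^`N(i)).[q1%:Z] - q2 * (B^`N(i)).[q1%:Z] != 0].
  by exists i; split => //; rewrite -ltnS.
have dvdq : ('X - (q1%:R)%:P) ^+ I0 %| wronskian a b.
  apply: (@wronskian_dvd algC a b q2%:~R); apply: nderivn_root_dvd => k ltk.
  have := allz (Ordinal ltk); rewrite negbK => /eqP.
  move/(congr1 (fun x : int => x%:~R : algC)); rewrite /= rmorphB rmorphM /= => h.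
  rewrite nderivnB nderivnZ hornerD hornerN hornerZ /a /b !nderivn_map.
  have -> : q1%:R = (q1%:Z)%:~R :> algC by rewrite pmulrn.
  by rewrite !horner_map.
pose e x := if x == q1%:R :> algC then I0 else t.-1.
have q1_rs : q1%:R \notin rs.
  apply/negP => /rs_root[_ /eqP]; rewrite -natrX -[1]/(1%:R) eqr_nat.
  by rewrite -(exp1n F) eqn_exp2r // => /eqP h; rewrite h in q1_2.
have u' : uniq (q1%:R :: rs) by rewrite /= q1_rs.
have := @sum_mult_lt_size algC (q1%:R :: rs) e _ u' W0.
rewrite big_cons /e eqxx => h.
have {h} : (I0 + \sum_(x <- rs) t.-1 < size (wronskian a b))%N.
  rewrite (eq_big_seq (fun x => if x == q1%:R then I0 else t.-1)); last first.
    by move=> x xrs; case: eqP => // ex; rewrite -ex xrs in q1_rs.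
  apply: h => x; rewrite in_cons; case: eqP => [-> _ //|_ /= xrs].
  apply: (@wronskian_dvd algC a b x); rewrite prednK ?dvd_root //.
  by rewrite /aux_order muln_gt0 tau_gt0.
rewrite big_const_rs sz_rs => h.
have szW : (size (wronskian a b) <= 2 * n + t)%N.
  have szD (P : {poly algC}) m : (size P <= m.+1)%N -> (size P^`() <= m)%N.
    move=> szP; apply/leq_sizeP => j lej.
    by rewrite coef_deriv nth_default ?mul0rn // (leq_trans szP).
  apply: leq_trans (size_polyD _ _) _; rewrite size_polyN geq_max; apply/andP; split.
    apply: leq_trans (size_polyMleq _ _) _.
    have arith x y u v : (x <= u + v -> y <= u.+1 -> (x + y).-1 <= 2 * u + v)%N by clear; lia.
    exact: arith (szD _ _ sza) szb.
  apply: leq_trans (size_polyMleq _ _) _.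
  have arith x y u v : (x <= (u + v).+1 -> y <= u -> (x + y).-1 <= 2 * u + v)%N by clear; lia.
  exact: arith sza (szD _ _ szb).
have := leq_trans h szW; rewrite /I0 /aux_order /aux_deg; move: F3 tau_gt0; clear.
case: F => [|[|[|k]]] //= _ t0; have -> : (4 * k.+2 - 3 = 4 * k + 5)%N by lia.
by have : (8 * tau = (8 * tau).-1.+1)%N; [lia | move: ((8 * tau).-1) => u eu; nia].
Qed.

End Nonvanishing.

(** * Two comparable solutions *)

Lemma bin_mul_bin m i k : i + k <= m ->
  'C(m, i) * 'C(m - i, k) = 'C(m, i + k) * 'C(i + k, i).
Proof.
move=> le_m.
have lei : i <= m by lia.
have lek : k <= m - i by lia.
apply/eqP; rewrite -(eqn_pmul2r (fact_gt0 i)) -(eqn_pmul2r (fact_gt0 k)).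
rewrite -(eqn_pmul2r (fact_gt0 (m - i - k))); apply/eqP.
have h1 := bin_fact lei; have h2 := bin_fact lek.
have h3 := bin_fact le_m; have h4 := bin_fact (leq_addr k i).
rewrite addKn in h4; rewrite subnDA in h3.
transitivity m`!.
  by rewrite -h1 -h2; ring.
by rewrite -h3 -h4; ring.
Qed.

Section Decomposition.
Local Open Scope ring_scope.

Lemma nderivn_nderivn (A : {poly int}) i k :
  (A^`N(i))^`N(k) = A^`N(i + k) *+ 'C(i + k, i).
Proof.
apply/polyP => j; rewrite coefMn !coef_nderivn -!mulrnA addnA; congr (_ *+ _).
have le : (i + k <= i + k + j)%N by exact: leq_addr.
by have := bin_mul_bin le; rewrite -[(i + k + j - i)%N]/(i + k + j - i)%N -{2}addnA addKn mulnC => ->; rewrite mulnC.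
Qed.

Lemma nderivn_bound (P : {poly int}) (N X i x : nat) : (size P <= N.+1)%N ->
  (forall j, `|(P`_j)%R| <= X)%N -> (0 < x)%N -> (i <= N)%N ->
  (`|(P^`N(i).[x%:Z])%R| <= N.+1 * X * 2 ^ N * x ^ (N - i))%N.
Proof.
move=> szP P_bnd x0 lei.
have szPi : (size P^`N(i) <= (N - i).+1)%N.
  apply/leq_sizeP => j lej; rewrite coef_nderivn nth_default ?mul0rn //.
  by apply: leq_trans szP _; move: lej lei; clear; lia.
rewrite (horner_coef_wide _ szPi).
have tri (I : finType) (G : I -> int) : (`|(\sum_j G j)%R| <= \sum_j `|G j|)%N.
  elim/big_rec2: _ => // j a b _ h; apply: leq_trans (_ : `|G j| + `|b| <= _)%N; first by lia.
  by rewrite leq_add2l.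
apply: leq_trans (tri _ _) _.
apply: (@leq_trans (\sum_(j < (N - i).+1) X * 2 ^ N * x ^ (N - i))); last first.
  rewrite sum_nat_const card_ord !mulnA !leq_mul // ltnS leq_subr //.
apply: leq_sum => j _; rewrite abszM abszX absz_nat leq_mul //.
  rewrite coef_nderivn -mulr_natr abszM natz absz_nat leq_mul //.
  have le_N : (i + j <= N)%N by have := ltn_ord j; move: lei; clear; lia.
  apply: (@leq_trans (2 ^ (i + j))); last by rewrite leq_exp2l.
  rewrite -[2%N]/(1 + 1)%N expnDn (bigD1 (Ordinal (leq_addr j i : (i < (i + j).+1)%N))) //=.
  by rewrite !exp1n !muln1 leq_addr.
by rewrite leq_pexp2l // -ltnS.
Qed.

Variables (F tau : nat) (A B : {poly int}).
Notation t := (aux_order tau).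
Hypothesis AB_dvd : forall k, (k < t)%N ->
  exists C, A^`N(k) - 'X * B^`N(k) = reppoly F * C.

(** Expand in powers of [q1 - q2] around [q2]: the terms built from derivatives of order below [t]
    are multiples of [rep q2 F] by the choice of [A] and [B], the others contain
    [(q1 - q2) ^ (t - i)]. *)
Lemma aux_value_decomp (i q1 q2 : nat) : (i <= t)%N ->
  exists Y Z : int, A^`N(i).[q1%:Z] - q2%:Z * B^`N(i).[q1%:Z] =
    (rep q2 F)%:Z * Y + (q1%:Z - q2%:Z) ^+ (t - i) * Z.
Proof.
move=> lei.
pose m := (maxn (size A) (size B) + t)%N.
have szi (P : {poly int}) : (size P <= maxn (size A) (size B))%N -> (size P^`N(i) <= m)%N.
  move=> szP; apply/leq_sizeP => j lej; rewrite coef_nderivn nth_default ?mul0rn //.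
  by apply: leq_trans szP _; move: lej; rewrite /m; clear; lia.
have taylor (P : {poly int}) : (size P <= maxn (size A) (size B))%N ->
    P^`N(i).[q1%:Z] = \sum_(k < m) P^`N(i + k).[q2%:Z] * 'C(i + k, i)%:R * (q1%:Z - q2%:Z) ^+ k.
  move=> szP; have := @nderiv_taylor_wide _ m P^`N(i) q2%:Z (q1%:Z - q2%:Z) (mulrC _ _) (szi _ szP).
  rewrite [X in _.[X]]addrC subrK => ->.
  by apply: eq_bigr => k _; rewrite nderivn_nderivn hornerMn mulr_natr.
rewrite (taylor A) ?leq_maxl // (taylor B) ?leq_maxr // mulr_sumr -sumrB.
have h (k : 'I_m) : exists YZ : int * int,
   A^`N(i + k).[q2%:Z] * 'C(i + k, i)%:R * (q1%:Z - q2%:Z) ^+ k -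
   q2%:Z * (B^`N(i + k).[q2%:Z] * 'C(i + k, i)%:R * (q1%:Z - q2%:Z) ^+ k) =
    (rep q2 F)%:Z * YZ.1 + (q1%:Z - q2%:Z) ^+ (t - i) * YZ.2.
  have -> : A^`N(i + k).[q2%:Z] * 'C(i + k, i)%:R * (q1%:Z - q2%:Z) ^+ k -
     q2%:Z * (B^`N(i + k).[q2%:Z] * 'C(i + k, i)%:R * (q1%:Z - q2%:Z) ^+ k) =
     (A^`N(i + k) - 'X * B^`N(i + k)).[q2%:Z] * ('C(i + k, i)%:R * (q1%:Z - q2%:Z) ^+ k).
    by rewrite hornerD hornerN hornerM hornerX; ring.
  have [lt|le] := ltnP (i + k) t.
    have [C ->] := AB_dvd lt; rewrite hornerM horner_reppoly.
    exists (C.[q2%:Z] * ('C(i + k, i)%:R * (q1%:Z - q2%:Z) ^+ k), 0).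
    by rewrite /= mulr0 addr0 !mulrA.
  have -> : k = (t - i + (k - (t - i)))%N :> nat by move: le lei; clear; lia.
  rewrite exprD; exists (0, (A^`N(i + (t - i + (k - (t - i)))) - 'X * B^`N(i + (t - i + (k - (t - i))))).[q2%:Z] *
     ('C(i + (t - i + (k - (t - i))), i)%:R * (q1%:Z - q2%:Z) ^+ (k - (t - i)))).
  by rewrite /= mulr0 add0r; ring.
have [YZ hYZ] := fin_all_exists h.
exists (\sum_k (YZ k).1), (\sum_k (YZ k).2).
by rewrite !mulr_sumr -big_split /=; apply: eq_bigr.
Qed.

End Decomposition.

Lemma prod_coprime_dvd (S : seq nat) (e : nat -> nat) N : uniq S ->
  {in S, forall p, prime p} -> {in S, forall p, p ^ e p %| N} ->
  \prod_(p <- S) p ^ e p %| N.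
Proof.
elim: S => [|p S IHS] /=; first by rewrite big_nil dvd1n.
move=> /andP[pS uS] S_pr S_dvd; rewrite big_cons Gauss_dvd.
  rewrite S_dvd ?mem_head // IHS // => p' p'S; [apply: S_pr | apply: S_dvd];
  by rewrite in_cons p'S orbT.
rewrite coprime_sym big_seq; elim/big_ind: _ => [|x y|p' p'S]; first exact: coprime1n.
  by rewrite coprimeMl => -> ->.
have p'_pr : prime p' by apply: S_pr; rewrite in_cons p'S orbT.
have p_pr : prime p by apply: S_pr; rewrite mem_head.
rewrite coprimeXl // coprimeXr // prime_coprime // dvdn_prime2 //.
by apply: contraNneq pS => <-.
Qed.

Lemma rep_gt1 q F : 2 <= q -> 1 < F -> 1 < rep q F.
Proof.
by move=> q2; case: F => [|F] // F1; rewrite rep_recl; have := @rep_gt0 q F F1; move: q2; clear; nia.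
Qed.

Definition aux_const F := 60 * F ^ 2.
(* A discretization of [ln (p ^ logn p r) / ln r], where [r = rep q F]. *)
Definition grid X F p q := trunc_log (rep q F) (p ^ (64 * X * logn p (rep q F))).

Lemma grid_le X F p q : prime p -> 2 <= q -> 1 < F -> grid X F p q <= 64 * X.
Proof.
move=> p_pr q2 F1; have r0 : 0 < rep q F by apply/rep_gt0/ltnW.
have r1 : 1 < rep q F by exact: rep_gt1.
rewrite -(@leq_exp2l (rep q F)) //.
apply: leq_trans (trunc_logP r1 _) _; first by rewrite expn_gt0 prime_gt0.
rewrite mulnC expnM; have [->|pos] := posnP (64 * X); first by rewrite !expn0.
by rewrite leq_exp2r // dvdn_leq // pfactor_dvdnn.
Qed.

Lemma leq_expn2 k x y : x <= y -> x ^ k <= y ^ k.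
Proof. by case: k => // k le_xy; rewrite leq_exp2r. Qed.

Lemma min_exponents_le l m t v1 v2 d : minn v1 v2 <= d + l -> m <= t -> 0 < m ->
  minn v2 (m * v1) <= minn v2 (m * d) + t * l.
Proof.
move=> le_min le_tt m0.
have h : m * minn v1 v2 <= m * d + t * l.
  apply: (@leq_trans (m * (d + l))); first by rewrite leq_mul2l le_min orbT.
  by rewrite mulnDr leq_add2l leq_mul2r le_tt orbT.
have h2 : minn v2 (m * v1) <= m * minn v1 v2.
  have [_|_] := leqP v1 v2; first exact: geq_minr.
  by apply: leq_trans (geq_minl _ _) _; apply: leq_pmull.
have [_|_] := leqP v2 (m * d); first exact: leq_trans (geq_minl _ _) (leq_addr _ _).
exact: leq_trans h2 h.
Qed.

Lemma aux_exponent_bound F x : 3 <= F -> 0 < x ->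
  1 + (5 * F * x + 52 * F ^ 2 * x + 5 * F * x + (8 * x + 8)) + 8 * F * x <= 60 * F ^ 2 * x.
Proof.
move=> F3 x0; rewrite -mulnn -!mulnA.
have h1 : 3 * (F * x) <= F * (F * x) by rewrite leq_mul2r F3 orbT.
have h2 : 3 * x <= F * x by rewrite leq_mul2r F3 orbT.
by move: (F * (F * x)) (F * x) h1 h2 => u v; lia.
Qed.

Section TwoSolutions.
Variables (S : seq nat) (X F q1 q2 : nat).
Hypotheses (uS : uniq S) (S_pr : {in S, forall p, prime p /\ odd p}).
Hypotheses (szS : size S <= X) (X0 : 0 < X) (F3 : 3 <= F).
Hypotheses (ltq : q1 < q2) (q1_large : 2 ^ (64 * aux_const F) <= q1).
Hypothesis q2_large : q1 ^ (8 * F * (3 * F + 11)) <= q2.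
Notation s1 := (rep q1 F).
Notation s2 := (rep q2 F).
Hypothesis sub1 : {subset primes s1 <= S}.
Hypothesis eq_mod : {in S, forall p, q1 = q2 %[mod p]}.
Hypothesis eq_grid : {in S, forall p, grid X F p q1 = grid X F p q2}.
Notation f := F.-1.

Let q1_2 : 2 <= q1.
Proof.
apply: leq_trans q1_large; rewrite -(expn1 2) leq_exp2l // /aux_const.
by rewrite !muln_gt0 /= (leq_trans _ F3).
Qed.
Let F0 : 0 < F. Proof. by case: F F3. Qed.
Let f2 : 2 <= f. Proof. by case: F F3 => [|[|[]]]. Qed.
Let q2_2 : 2 <= q2. Proof. exact: leq_trans q1_2 (ltnW ltq). Qed.
Let s1_0 : 0 < s1. Proof. exact: rep_gt0. Qed.
Let s2_0 : 0 < s2. Proof. exact: rep_gt0. Qed.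
Let s1_ge : q1 ^ f <= s1. Proof. exact: leq_rep. Qed.
Let s1_1 : 1 < s1. Proof. by apply: rep_gt1; rewrite // ltnW. Qed.

(** With this choice [t = 8 tau] is [ln s2 / ln s1] up to a bounded error:
    [s1 ^ t <= s2 <= s1 ^ (t + 8)]. *)
Definition aux_scale := trunc_log s1 s2 %/ 8.
Notation tau := aux_scale.
Notation t := (aux_order tau).
Notation n := (aux_deg F tau).

Lemma tau_large : 3 * F + 11 <= tau.
Proof.
rewrite /aux_scale leq_divRL //; apply: trunc_log_max => //.
apply: (@leq_trans ((q1 ^ F) ^ ((3 * F + 11) * 8))).
  by rewrite leq_exp2r ?(ltnW (rep_lt _ q1_2)) // muln_gt0 addn_gt0 orbT.
rewrite -expnM (_ : F * _ = 8 * F * (3 * F + 11)); last by lia.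
apply: (leq_trans q2_large); apply: (@leq_trans (q2 ^ f)); last exact: leq_rep.
by rewrite -{1}(expn1 q2) leq_pexp2l // ltnW // ltnW.
Qed.

Let tau_gt0 : 0 < tau. Proof. by apply: leq_trans tau_large; rewrite addn_gt0 orbT. Qed.

Lemma s1_pow_t : s1 ^ t <= s2.
Proof.
apply: leq_trans (trunc_logP s1_1 s2_0); rewrite leq_pexp2l // /aux_order mulnC.
exact: leq_divM.
Qed.

Lemma q2_bound : q2 <= (2 * q1) ^ (t + 8).
Proof.
rewrite -(@leq_exp2r _ _ f) ?(ltnW f2) //; apply: (leq_trans (leq_rep _ F0)).
apply: (@leq_trans (s1 ^ (t + 8))).
  apply: (leq_trans (ltnW (trunc_log_ltn s2 s1_1))); rewrite leq_pexp2l //.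
  rewrite /aux_order /aux_scale; have := ltn_ceil (trunc_log s1 s2) (isT : 0 < 8).
  by move: (_ %/ 8) => d; clear; lia.
rewrite -expnM [(t + 8) * f]mulnC expnM leq_exp2r; last by rewrite addn_gt0 orbT.
rewrite expnMn (leq_trans (ltnW (rep_ltX q1_2 F0))) // leq_mul2r.
by apply/orP; right; rewrite -{1}(expn1 2) leq_exp2l // ltnW.
Qed.

Variables A B : {poly int}.
Hypothesis AB_dvd : forall k, (k < t)%N ->
  exists C, (A^`N(k) - 'X * B^`N(k) = reppoly F * C)%R.
Variable i : nat.
Hypothesis le_i : i <= 2 * tau + f.
Definition auxval : int := (A^`N(i).[q1%:Z] - q2%:Z * B^`N(i).[q1%:Z])%R.
Hypothesis auxval0 : auxval != 0%R.

Let le_it : i <= t.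
Proof.
by apply: (leq_trans le_i); rewrite /aux_order; have := tau_large; have := f2; case: F => //= k; clear; lia.
Qed.

(* Up to a factor [F ^ t], [auxval] is divisible by a large part of [s2], too large
   for its size: this is the exponent of [p] in that part. *)
Definition minexp p := minn (logn p s2) ((t - i) * logn p s1).

(** Let [d] be the valuation of [q2 - q1]. By [aux_value_decomp], [p] divides [auxval] at least to
    the minimum of [logn p s2] and [(t - i) * d]. Lifting the exponent bounds the smaller of the
    valuations of [s1] and [s2] by [d + logn p F], and [F ^ t] makes up for the last term. *)
Lemma minexp_dvd p : p \in S -> p ^ minexp p %| `|auxval| * F ^ t.
Proof.
move=> pS; have [p_pr p_odd] := S_pr pS.
have [->|] := posnP (minexp p); first by rewrite expn0 dvd1n.
rewrite /minexp leq_min muln_gt0 => /and3P[u2 ti u1].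
pose v1 := logn p s1; pose v2 := logn p s2; rewrite -/v1 -/v2 in u1 u2 *.
have dvd1 : p ^ v1 %| q1 ^ F - 1 by rewrite -(rep_pred F (ltnW q1_2)); apply: dvdn_mull; apply: pfactor_dvdnn.
have dvd2 : p ^ v2 %| q2 ^ F - 1 by rewrite -(rep_pred F (ltnW q2_2)); apply: dvdn_mull; apply: pfactor_dvdnn.
have pq1 : ~~ (p %| q1).
  apply/negP => pq1; have p1 : p %| q1 ^ F - 1.
    by apply: dvdn_trans dvd1; rewrite -{1}(expn1 p) dvdn_exp2l.
  have : p %| q1 ^ F by apply: dvdn_exp.
  move/dvdn_sub/(_ p1); rewrite subKn ?expn_gt0 ?(ltnW q1_2) // dvdn1 => /eqP e.
  by rewrite e in p_pr.
have dvdq : p %| q2 - q1.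
  by rewrite -eqn_mod_dvd ?(ltnW ltq) //; apply/eqP/esym/eq_mod.
have lte := logn_subX p_pr p_odd ltq dvdq pq1 F0.
set d := logn p (q2 - q1) in lte.
have le_min : minn v1 v2 <= d + logn p F.
  rewrite -lte -pfactor_dvdn ?subn_gt0 ?ltn_exp2r //.
  have -> : q2 ^ F - q1 ^ F = (q2 ^ F - 1) - (q1 ^ F - 1).
    by rewrite subnBA ?expn_gt0 ?(ltnW q1_2) // subnK // expn_gt0 (ltnW q2_2).
  apply: dvdn_sub; [apply: dvdn_trans dvd2 | apply: dvdn_trans dvd1]; apply: dvdn_exp2l;
    [exact: geq_minr | exact: geq_minl].
have dvdP : p ^ minn v2 ((t - i) * d) %| `|auxval|.
  have [Y [Z]] := aux_value_decomp AB_dvd q1 q2 le_it; rewrite -/auxval => ->.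
  pose D := (p ^ minn v2 ((t - i) * d))%N; rewrite -/D.
  have w1 : (D%:Z %| ((rep q2 F)%:Z * Y)%R)%Z.
    rewrite dvdzE abszM /=; apply: dvdn_mulr; apply: dvdn_trans (pfactor_dvdnn p s2).
    by apply: dvdn_exp2l; apply: geq_minl.
  have w2 : (D%:Z %| ((q1%:Z - q2%:Z) ^+ (t - i) * Z)%R)%Z.
    rewrite dvdzE abszM abszX /=; apply: dvdn_mulr.
    have -> : `|(q1%:Z - q2%:Z)%R| = q2 - q1 by move: ltq; clear; lia.
    apply: (@dvdn_trans (p ^ ((t - i) * d))); first by apply: dvdn_exp2l; apply: geq_minr.
    by rewrite mulnC expnM; apply: dvdn_exp2r; apply: pfactor_dvdnn.
  by have := rpredD w1 w2; rewrite dvdzE.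
have dvdF : p ^ (t * logn p F) %| F ^ t.
  by rewrite mulnC expnM; apply: dvdn_exp2r; apply: pfactor_dvdnn.
apply: dvdn_trans (dvdn_mul dvdP dvdF); rewrite -expnD dvdn_exp2l //.
have le_tt : t - i <= t by apply: leq_subr.
exact: min_exponents_le.
Qed.

Lemma prod_minexp_le : \prod_(p <- S) p ^ minexp p <= `|auxval| * F ^ t.
Proof.
apply: dvdn_leq; first by rewrite muln_gt0 absz_gt0 auxval0 expn_gt0 F0.
by apply: prod_coprime_dvd => // p; [case/S_pr | apply: minexp_dvd].
Qed.

(** Equal grid values mean that [p] has nearly the same share in [s1] and in [s2], on a logarithmic
    scale of [64 * X] steps. As [s1 ^ t <= s2], both terms of [minexp p] reach this share of
    [s1 ^ (t - i)]. Rounding loses at most one step per prime, so [X] of the [64 * X] steps, and the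
    proportion [63 / 64] remains. *)
Lemma minexp_lower : (s1 ^ (t - i)) ^ 63 <= (`|auxval| * F ^ t) ^ 64.
Proof.
have p0 p : p \in S -> 0 < p by case/S_pr => p_pr _; apply: prime_gt0.
have lowp p : p \in S -> (s1 ^ (t - i)) ^ grid X F p q1 <= (p ^ minexp p) ^ (64 * X).
  move=> pS; have pX k : 0 < p ^ k by rewrite expn_gt0 p0.
  have b1 : (s1 ^ (t - i)) ^ grid X F p q1 <= p ^ (64 * X * logn p s2).
    apply: (@leq_trans (s2 ^ grid X F p q2)); last exact: trunc_logP (rep_gt1 q2_2 (ltnW F3)) _.
    rewrite (eq_grid pS); apply: leq_expn2; apply: leq_trans s1_pow_t.
    by rewrite leq_pexp2l // leq_subr.
  have b2 : (s1 ^ (t - i)) ^ grid X F p q1 <= p ^ (64 * X * ((t - i) * logn p s1)).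
    rewrite -expnM mulnC expnM [64 * X * _]mulnCA mulnC expnM; apply: leq_expn2.
    exact: trunc_logP s1_1 _.
  by rewrite -(expnM p) [minexp p * _]mulnC /minexp;
    case: (leqP (logn p s2) ((t - i) * logn p s1)).
have sum_grid : 63 * X <= \sum_(p <- S) grid X F p q1.
  have : s1 ^ (64 * X) <= s1 ^ (\sum_(p <- S) (grid X F p q1).+1).
    rewrite {1}(prod_logn_sub uS s1_0 sub1) expn_sum.
    rewrite (big_morph _ (fun x y => expnMn x y (64 * X)) (exp1n _)) !big_seq.
    apply: leq_prod => p pS; rewrite -expnM mulnC; apply/ltnW.
    exact: trunc_log_ltn.
  rewrite leq_exp2l // (eq_bigr (fun p => grid X F p q1 + 1)) => [|p _]; last by rewrite addn1.
  rewrite big_split /= sum1_size; move: szS; clear; lia.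
rewrite -(@leq_exp2r _ _ X) // -(expnM _ 63) -(expnM _ 64).
apply: (@leq_trans ((s1 ^ (t - i)) ^ \sum_(p <- S) grid X F p q1)).
  by rewrite leq_pexp2l // expn_gt0 s1_0.
apply: (@leq_trans ((\prod_(p <- S) p ^ minexp p) ^ (64 * X))).
  rewrite expn_sum (big_morph _ (fun x y => expnMn x y (64 * X)) (exp1n _)) !big_seq.
  by apply: leq_prod => p pS; apply: lowp.
by apply: leq_expn2; apply: prod_minexp_le.
Qed.

Hypotheses (szA : size A <= (n + t).+1) (szB : size B <= n.+1).
Hypothesis A_bnd : forall j, `|(A`_j)%R| <= aux_height F tau.
Hypothesis B_bnd : forall j, `|(B`_j)%R| <= aux_height F tau.

(** The two terms of [auxval] have orders [q1 ^ (n + t - i)] and [q2 * q1 ^ (n - i)], and [q2] is at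
    most about [q1 ^ t]. The other factors are powers of 2 with exponents linear in [tau]. *)
Lemma auxval_upper : `|auxval| * F ^ t <= 2 ^ (aux_const F * tau) * q1 ^ (n + t + 8 - i).
Proof.
have q10 := ltnW q1_2.
have tau_ge := tau_large.
have nE : n = (4 * F - 7) * tau by rewrite /aux_deg; congr (_ * _); move: F3; clear; lia.
have le_in : i <= n.
  apply: (leq_trans le_i); rewrite nE; move: tau_ge F3; clear.
  by case: F => [|[|[|k]]] // h _; rewrite (_ : 4 * k.+3 - 7 = 4 * k + 5); [nia | lia].
have le_nt : n <= n + t by apply: leq_addr.
set Y := aux_height F tau.
have hA := nderivn_bound szA A_bnd q10 (leq_trans le_in le_nt).
have hB := nderivn_bound szB B_bnd q10 le_in.
rewrite -/Y in hA hB.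
have e1 : q1 ^ (n + t - i) <= 2 ^ (t + 8) * q1 ^ (n + t + 8 - i).
  apply: (@leq_trans (q1 ^ (n + t + 8 - i))); last by rewrite leq_pmull // expn_gt0.
  by rewrite leq_pexp2l // leq_sub2r // leq_addr.
have e2 : q2 * q1 ^ (n - i) <= 2 ^ (t + 8) * q1 ^ (n + t + 8 - i).
  apply: (@leq_trans ((2 * q1) ^ (t + 8) * q1 ^ (n - i))); first by rewrite leq_mul2r q2_bound orbT.
  rewrite expnMn -mulnA -expnD leq_mul2l; apply/orP; right; rewrite leq_pexp2l //.
  by move: le_in; clear; lia.
have val : `|auxval| <= 2 * ((n + t).+1 * Y * 2 ^ (n + t) * (2 ^ (t + 8) * q1 ^ (n + t + 8 - i))).
  rewrite /auxval; set a := (A^`N(i).[_])%R in hA *; set b := (B^`N(i).[_])%R in hB *.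
  have tri (u v : int) : `|(u - v)%R| <= `|u| + `|v| by clear; lia.
  apply: leq_trans (tri _ _) _; rewrite mul2n -addnn; apply: leq_add.
    by apply: (leq_trans hA); rewrite leq_mul2l e1 orbT.
  rewrite abszM absz_nat; apply: (@leq_trans (q2 * (n.+1 * Y * 2 ^ n * q1 ^ (n - i)))).
    by rewrite leq_mul2l hB orbT.
  rewrite mulnCA; apply: leq_mul => //; rewrite ?e2 //.
  by apply: leq_mul; [rewrite leq_mul2r ltnS le_nt orbT | rewrite leq_exp2l].
apply: (leq_trans (leq_mul val (leqnn _))).
have nt_le : n + t <= 5 * F * tau.
  rewrite nE /aux_order -mulnDl leq_mul2r; apply/orP; right; move: F3; clear; lia.
have FT : 1 <= F * tau by rewrite muln_gt0 F0.
have Yle : Y <= 2 ^ (52 * F ^ 2 * tau).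
  rewrite /Y /aux_height; apply: (@leq_trans ((2 ^ (8 * F * tau) * 2 ^ (5 * F * tau)) ^ (4 * f))).
    apply: leq_expn2; apply: leq_mul; last by rewrite leq_exp2l.
    apply: leq_trans (ltnW (self_lt_exp2 _)); rewrite nE /aux_order.
    move: F3 tau_gt0; clear; case: F => [|[|[|k]]] // _ t0.
    by rewrite (_ : 4 * k.+3 - 7 = 4 * k + 5); [nia | lia].
  rewrite -expnD -expnM leq_exp2l // -mulnDl -mulnDl -mulnA.
  apply: (@leq_trans (13 * F * tau * (4 * F))); first by rewrite -!mulnA !leq_mul // leq_pred.
  by rewrite -mulnn; clear; lia.
have FTle : F ^ t <= 2 ^ (8 * F * tau).
  rewrite (_ : 8 * F * tau = F * t); last by rewrite /aux_order; clear; lia.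
  by rewrite expnM; apply: leq_expn2; apply/ltnW/self_lt_exp2.
have n1 : (n + t).+1 <= 2 ^ (5 * F * tau).
  by apply: leq_trans (self_lt_exp2 _) _; rewrite leq_exp2l.
set Q := q1 ^ _.
apply: (@leq_trans (2 * (2 ^ (5 * F * tau) * 2 ^ (52 * F ^ 2 * tau) * 2 ^ (5 * F * tau) *
    (2 ^ (t + 8) * Q)) * 2 ^ (8 * F * tau))).
  apply: leq_mul FTle; rewrite leq_mul2l /=; apply: leq_mul => //.
  by apply: leq_mul; [apply: leq_mul | rewrite leq_exp2l].
have -> : 2 * (2 ^ (5 * F * tau) * 2 ^ (52 * F ^ 2 * tau) * 2 ^ (5 * F * tau) *
    (2 ^ (t + 8) * Q)) * 2 ^ (8 * F * tau) =
  (2 * (2 ^ (5 * F * tau) * 2 ^ (52 * F ^ 2 * tau) * 2 ^ (5 * F * tau) * 2 ^ (t + 8)) *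
    2 ^ (8 * F * tau)) * Q by lia.
rewrite leq_mul2r; apply/orP; right.
rewrite -!(expnD 2) -(expnS 2) -(expnD 2) leq_exp2l // /aux_const /aux_order -!mulnn.
by rewrite mulnn; apply: aux_exponent_bound => //; exact: tau_gt0.
Qed.

(** Compare exponents of [q1]: for [i] near its maximum [2 * tau + f], about [6 f tau] below in
    [minexp_lower] against [(4 f + 3) tau] above, a contradiction as [f >= 2]. The factor [63 / 64]
    fits in this margin, the size of [q1] absorbs the powers of 2, and [tau >= 3 * F + 11] the
    bounded terms. *)
Lemma two_values_absurd : False.
Proof.
have tau_ge := tau_large.
have nE : n = (4 * F - 7) * tau by rewrite /aux_deg; congr (_ * _); move: F3; clear; lia.
have := minexp_lower; apply/negP; rewrite -ltnNge.
apply: (@leq_ltn_trans ((2 ^ (aux_const F * tau) * q1 ^ (n + t + 8 - i)) ^ 64)).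
  by apply: leq_expn2; apply: auxval_upper.
apply: (@leq_trans (((q1 ^ f) ^ (t - i)) ^ 63)); last by do 2 apply: leq_expn2.
rewrite expnMn -!expnM.
apply: (@leq_ltn_trans (q1 ^ (tau + (n + t + 8 - i) * 64))).
  rewrite expnD leq_mul2r; apply/orP; right.
  rewrite (_ : aux_const F * tau * 64 = 64 * aux_const F * tau); last by clear; lia.
  by rewrite expnM; apply: leq_expn2.
rewrite ltn_exp2l //.
move: le_i le_it tau_ge; rewrite nE /aux_order; move: aux_scale i F3; clear.
case: F => [|[|[|k]]] // x j _; rewrite (_ : 4 * k.+3 - 7 = 4 * k + 5) /=; last by lia.
move=> h1 h2 h3.
have [u eu] : exists u, 8 * x = j + u by exists (8 * x - j); lia.
rewrite eu addKn (_ : (4 * k + 5) * x + (j + u) + 8 - j = (4 * k + 5) * x + u + 8); last by lia.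
nia.
Qed.

End TwoSolutions.

Theorem two_solutions (S : seq nat) X F q1 q2 : uniq S ->
  {in S, forall p, prime p /\ odd p} -> size S <= X -> 0 < X -> 3 <= F -> q1 < q2 ->
  2 ^ (64 * aux_const F) <= q1 -> q1 ^ (8 * F * (3 * F + 11)) <= q2 ->
  {subset primes (rep q1 F) <= S} ->
  {in S, forall p, q1 = q2 %[mod p]} -> {in S, forall p, grid X F p q1 = grid X F p q2} ->
  False.
Proof.
move=> uS S_pr szS X0 F3 ltq q1l q2l sub1 eq_mod eq_grid.
have tau0 : 0 < aux_scale F q1 q2.
  have hh := tau_large uS szS X0 F3 ltq q1l q2l.
  by apply: leq_trans hh; rewrite addnC.
have [A [B [szA szB AB0 [A_bnd B_bnd] AB_dvd]]] := aux_polys F3 tau0.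
have q1_2 : 2 <= q1.
  apply: leq_trans q1l; rewrite -(expn1 2) leq_exp2l // /aux_const.
  by rewrite !muln_gt0 /= (leq_trans _ F3).
have [i [le_i nz]] := aux_nonvanishing F3 tau0 szA szB AB0 AB_dvd q2%:Z q1_2.
exact: (two_values_absurd uS S_pr szS X0 F3 ltq q1l q2l sub1 eq_mod eq_grid AB_dvd le_i nz szA szB A_bnd B_bnd).
Qed.

(** * Counting *)

Lemma uniq_size_inj (T : eqType) (V : finType) (g : T -> V) (s : seq T) :
  uniq s -> {in s &, injective g} -> size s <= #|V|.
Proof.
move=> us inj; rewrite -(size_map g) -[size _](card_uniqP _) ?max_card //.
by rewrite map_inj_in_uniq.
Qed.

Lemma expn_logn_le p n : 0 < n -> p ^ logn p n <= n.
Proof. by move=> n0; apply: dvdn_leq => //; apply: pfactor_dvdnn. Qed.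

(** For given [F], [q] is determined by [rep q F], hence by its exponents over [S], which are below
    [h * D]. The count is polynomial in [h], good enough for sums of reciprocals. *)
Lemma few_short_reps (S Q : seq nat) (F : nat -> nat) h D : uniq S -> uniq Q ->
  {in S, forall p, prime p} ->
  {in Q, forall q, 2 <= q <= 2 ^ h} -> {in Q, forall q, 1 < F q < D} ->
  {in Q, forall q, {subset primes (rep q (F q)) <= S}} ->
  size Q <= D * (h * D) ^ size S.
Proof.
move=> uS uQ S_pr Q_bnd F_bnd sub.
case: Q uQ Q_bnd F_bnd sub => [//|q0 Q'] /=; set Q := q0 :: Q' => uQ Q_bnd F_bnd sub.
have q0Q : q0 \in Q by rewrite mem_head.
have D0 : 0 < D by case/andP: (F_bnd _ q0Q) => _; apply: leq_ltn_trans.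
have h0 : 0 < h by case: (h) (Q_bnd _ q0Q) => //; lia.
have hD0 : 0 < h * D by rewrite muln_gt0 h0.
have rep0 q : q \in Q -> 0 < rep q (F q).
  by move=> /F_bnd /andP[/ltnW F0 _]; apply: rep_gt0.
have exps p q : p \in S -> q \in Q -> logn p (rep q (F q)) < h * D.
  move=> pS qQ; have /andP[q2 qh] := Q_bnd _ qQ; have /andP[_ FD] := F_bnd _ qQ.
  rewrite -(@ltn_exp2l 2) //; apply: (@leq_ltn_trans (rep q (F q))).
    apply: leq_trans (expn_logn_le p (rep0 _ qQ)).
    by case: (logn _ _) => // v; rewrite leq_exp2r // prime_gt1 // S_pr.
  apply: (leq_trans (rep_lt _ q2)); rewrite expnM.
  apply: (@leq_trans (q ^ D)); first by rewrite leq_pexp2l // ltnW.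
  by rewrite leq_exp2r.
pose g q : 'I_D.-1.+1 * {ffun 'I_(size S) -> 'I_(h * D).-1.+1} :=
  (inord (F q), [ffun i => inord (logn (nth 0 S (nat_of_ord i)) (rep q (F q)))]).
have inj : {in Q &, injective g}.
  move=> q q' qQ qQ' [/(congr1 val)].
  rewrite /= !inordK ?prednK //; try by case/andP: (F_bnd _ qQ); case/andP: (F_bnd _ qQ').
  move=> eF /ffunP eE.
  have F1 : 1 < F q by case/andP: (F_bnd _ qQ).
  apply: (rep_inj F1) => /=.
  have subq := sub _ qQ; have subq' := sub _ qQ'; rewrite -eF in subq'.
  rewrite (prod_logn_sub uS _ subq) ?rep_gt0 ?(ltnW F1) //.
  rewrite (prod_logn_sub uS _ subq') ?rep_gt0 ?(ltnW F1) //.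
  apply: eq_big_seq => p pS; congr (_ ^ _).
  have ip : index p S < size S by rewrite index_mem.
  have := eE (Ordinal ip); rewrite !ffunE /= nth_index // => /(congr1 val).
  by rewrite /= !inordK ?prednK // -?eF //; [rewrite eF|]; apply: exps.
have := @uniq_size_inj _ _ g Q uQ inj.
by rewrite card_prod card_ffun !card_ord !prednK.
Qed.

Section Tail.
Local Open Scope ring_scope.

(** Dyadic blocks: the [q] between [2 ^ n] and [2 ^ n.+1] contribute at most [1 / n ^ 2], which is
    at most [1 / (n - 1) - 1 / n]; the sum telescopes. *)
Lemma sum_inv_tail (Q : seq nat) (h1 m : nat) : (1 < h1)%N -> (h1 <= m)%N ->
  (forall h, (h1 <= h)%N -> (count (fun q => q <= 2 ^ h.+1)%N Q * h ^ 2 <= 2 ^ h)%N) ->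
  \sum_(q <- Q | (2 ^ h1 < q <= 2 ^ m)%N) (q%:R^-1 : rat) <= h1.-1%:R^-1 - m.-1%:R^-1.
Proof.
move=> h1_1 /subnK <- cnt; elim: (m - h1)%N => [|d IH].
  rewrite add0n subrr big_pred0 // => q; apply/negP; lia.
rewrite addSn; set n := (d + h1)%N in IH *.
have n1 : (1 < n)%N by rewrite /n; lia.
rewrite (bigID (fun q => q <= 2 ^ n)%N) /=.
rewrite (eq_bigl (fun q => 2 ^ h1 < q <= 2 ^ n)%N); last first.
  move=> q; have : (2 ^ n <= 2 ^ n.+1)%N by rewrite leq_exp2l.
  by lia.
have -> : h1.-1%:R^-1 - n.+1.-1%:R^-1 = (h1.-1%:R^-1 - n.-1%:R^-1) + (n.-1%:R^-1 - n%:R^-1) :> rat.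
  by rewrite addrA subrK.
apply: lerD => //.
have n0 : (0 : rat) < n%:R by rewrite ltr0n ltnW.
have n10 : (0 : rat) < n.-1%:R by rewrite ltr0n; lia.
apply: (@le_trans _ _ (n%:R ^- 2)); last first.
  have -> : n.-1%:R^-1 - n%:R^-1 = (n.-1%:R * n%:R)^-1 :> rat.
    have e : n%:R = n.-1%:R + 1 :> rat by rewrite natr1 prednK // ltnW.
    by rewrite e in n0 *; field; rewrite !gt_eqF.
  by rewrite lef_pV2 ?posrE ?mulr_gt0 // expr2 ler_pM2r // ler_nat leq_pred.
apply: (@le_trans _ _ (\sum_(q <- Q | (q <= 2 ^ n.+1)%N) (2 ^ n)%:R^-1)).
  rewrite big_mkcond [leRHS]big_mkcond /=; apply: ler_sum => q _.
  case: ifP => [|_]; last by case: ifP => // _; rewrite invr_ge0.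
  case/andP=> /andP[_ ->]; rewrite -ltnNge => /ltnW lt.
  by rewrite lef_pV2 ?ler_nat // posrE ltr0n ?expn_gt0 // (leq_trans _ lt) ?expn_gt0.
rewrite big_const_seq iter_addr_0.
have := cnt n (leq_addl _ _); set c := count _ _ => le.
have e0 : (0 : rat) < (2 ^ n)%:R by rewrite ltr0n expn_gt0.
rewrite -[_ *+ c]mulr_natl ler_pdivrMr // mulrC ler_pdivlMr ?exprn_gt0 //.
by rewrite -natrX -natrM ler_nat.
Qed.
End Tail.

Definition smooth_exp X := 4 * X ^ 2 + 2 * X + 2.
Definition sep_exp X := 8 * smooth_exp X * (3 * smooth_exp X + 11).
Definition sep_start X := 2 ^ (64 * aux_const (smooth_exp X)).
Definition sep_classes X := (smooth_exp X).+1 * (X ^ X * (64 * X).+1 ^ X).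

(** Each prime power in [rep q F] is at most [q ^ X * F] by [logn_rep_bound], and there are at most
    [X] of them, so [q ^ F.-1 <= (q ^ X * F) ^ X], where [F] occurs on the right only through its
    logarithm. *)
Lemma rep_smooth_exponent (S : seq nat) X q F : uniq S ->
  {in S, forall p, [/\ prime p, odd p & p <= X]} -> size S <= X -> 0 < X ->
  1 < q -> 0 < F -> {subset primes (rep q F) <= S} -> F <= smooth_exp X.
Proof.
move=> uS S_pr szS X0 q1 F0 sub.
have q0 := ltnW q1.
have h1 : rep q F <= (q ^ X * F) ^ X.
  rewrite (prod_logn_sub uS (rep_gt0 q F0) sub).
  apply: (@leq_trans (\prod_(p <- S) (q ^ X * F))).
    rewrite big_seq [leqRHS]big_seq; apply: leq_prod => p /S_pr[p_pr p_odd pX].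
    by apply: (leq_trans (logn_rep_bound p_pr p_odd q1 F0)); rewrite leq_mul2r leq_pexp2l ?orbT.
  rewrite big_const_seq count_predT iter_muln_1 leq_pexp2l //.
  by rewrite muln_gt0 expn_gt0 q0.
(* With this [u] the bound [F <= q ^ (X.+1 + u)] contributes [u * X <= F / 2] to the final exponent,
   which the left side absorbs. *)
pose u := F %/ (2 * X).
have F_le : F <= q ^ (X.+1 + u).
  apply: (@leq_trans (2 ^ (X.+1 + u))); last by case: (X.+1 + u) => // d; rewrite leq_exp2r.
  have := ltn_ceil F (isT : 0 < 2); have := @ltn_ceil F (2 * X); rewrite -/u muln_gt0 X0 => /(_ isT).
  move=> lt _; apply: (leq_trans (ltnW lt)); rewrite mulnC expnD; apply: leq_mul.
    by rewrite expnS leq_mul2l /= ltnW // self_lt_exp2.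
  exact: self_lt_exp2.
have h2 : q ^ F.-1 <= q ^ ((X + (X.+1 + u)) * X).
  apply: (leq_trans (leq_rep q F0)); apply: (leq_trans h1).
  by rewrite expnM leq_exp2r // expnD leq_mul2l F_le orbT.
rewrite leq_exp2l // in h2.
have hu : 2 * (u * X) <= F by rewrite mulnCA /u leq_divM.
rewrite /smooth_exp -mulnn; move: h2 hu F0; rewrite mulnDl mulnDl mulSn.
move: (X * X) (u * X); clear; lia.
Qed.

Lemma few_separated (S Q : seq nat) (F : nat -> nat) X : uniq S ->
  {in S, forall p, [/\ prime p, odd p & p <= X]} -> size S <= X -> 0 < X -> uniq Q ->
  {in Q &, forall q q', q < q' -> q ^ sep_exp X <= q'} ->
  {in Q, forall q, sep_start X <= q} -> {in Q, forall q, 3 <= F q} ->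
  {in Q, forall q, {subset primes (rep q (F q)) <= S}} ->
  size Q <= sep_classes X.
Proof.
move=> uS S_pr szS X0 uQ sep start F3 sub.
have q1 q : q \in Q -> 1 < q.
  move=> /start; apply: leq_trans; rewrite /sep_start -{1}(expn1 2) leq_exp2l //.
  have s0 : 0 < smooth_exp X by rewrite /smooth_exp addnC.
  by rewrite /aux_const !muln_gt0 s0.
have F_le q : q \in Q -> F q <= smooth_exp X.
  move=> qQ; apply: (rep_smooth_exponent uS S_pr szS X0 (q1 q qQ) _ (sub q qQ)).
  exact: leq_trans (F3 q qQ).
pose g q : 'I_(smooth_exp X).+1 * ({ffun 'I_(size S) -> 'I_X.-1.+1} *
    {ffun 'I_(size S) -> 'I_(64 * X).+1}) :=
  (inord (F q), ([ffun i => inord (q %% nth 0 S (nat_of_ord i))],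
     [ffun i => inord (grid X (F q) (nth 0 S (nat_of_ord i)) q)])).
have inj q q' : q \in Q -> q' \in Q -> q < q' -> g q = g q' -> False.
  move=> qQ qQ' lt [/(congr1 val)]; rewrite /= !inordK ?ltnS ?F_le // => eF /ffunP e1 /ffunP e2.
  have leF := F_le q qQ; have F_3 := F3 q qQ.
  apply: (@two_solutions S X (F q) q q' uS _ szS X0 F_3 lt).
  - by move=> p /S_pr[].
  - apply: leq_trans (start q qQ); rewrite leq_exp2l // leq_mul2l /= /aux_const leq_mul2l /=.
    by rewrite leq_exp2r.
  - apply: leq_trans (sep q q' qQ qQ' lt); rewrite leq_pexp2l ?(ltnW (q1 _ qQ)) //.
    by rewrite /sep_exp; apply: leq_mul; rewrite ?leq_add2r leq_mul2l ?leF ?orbT.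
  - exact: sub.
  - move=> p pS; have [p_pr _ pX] := S_pr p pS; have p0 := prime_gt0 p_pr.
    have ip : index p S < size S by rewrite index_mem.
    have := e1 (Ordinal ip); rewrite !ffunE /= nth_index // => /(congr1 val).
    by rewrite /= !inordK ?prednK ?(leq_trans _ pX) ?ltn_mod.
  move=> p pS; have ip : index p S < size S by rewrite index_mem.
  have := e2 (Ordinal ip); rewrite !ffunE /= nth_index // => /(congr1 val).
  have [p_pr _ _] := S_pr p pS; have F1 : 1 < F q by apply: leq_trans F_3.
  rewrite /= -eF !inordK ?ltnS //; apply: grid_le => //; exact: q1.
have g_inj : {in Q &, injective g}.
  move=> q q' qQ qQ' e; case: (ltngtP q q') => // lt; first by case: (inj q q').
  by case: (inj q' q).
have := @uniq_size_inj _ _ g Q uQ g_inj.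
rewrite !card_prod !card_ffun !card_ord prednK //; move=> h; apply: (leq_trans h).
by rewrite leq_mul2l leq_mul ?orbT // leq_pexp2l.
Qed.

(** * Dickson's argument *)

Lemma logn_prod_seq (T : eqType) p (s : seq T) (P : pred T) (f : T -> nat) :
  {in s, forall c, 0 < f c} ->
  logn p (\prod_(c <- s | P c) f c) = \sum_(c <- s | P c) logn p (f c).
Proof.
move=> f0; rewrite [in LHS]big_seq_cond [in RHS]big_seq_cond.
suff [] : (0 < \prod_(c <- s | (c \in s) && P c) f c) /\
  logn p (\prod_(c <- s | (c \in s) && P c) f c) = \sum_(c <- s | (c \in s) && P c) logn p (f c) by [].
elim/big_ind2: _ => [|x1 x2 y1 y2 [x0 ex] [y0 ey]|c /andP[cs _]]; first by rewrite logn1.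
  by rewrite lognM // ex ey muln_gt0 x0.
by rewrite f0.
Qed.

Section Ineq.
Local Open Scope ring_scope.
Lemma prod_one_sub (T : eqType) (s : seq T) (P : pred T) (f : T -> rat) :
  {in s, forall c, P c -> 0 <= f c <= 1} ->
  0 <= \prod_(c <- s | P c) (1 - f c) <= 1 /\
  1 - \sum_(c <- s | P c) f c <= \prod_(c <- s | P c) (1 - f c).
Proof.
elim: s => [|c s IH] f01; first by rewrite !big_nil subr0 lexx ler01.
have [|/andP[y0 y1] y2] := IH; first by move=> d ds; apply: f01; rewrite inE ds orbT.
rewrite !big_cons; case: ifP => [Pc|_]; last by rewrite y0 y1 y2.
have /andP[x0 x1] := f01 c (mem_head _ _) Pc.
split; first by apply/andP; split; nra.
nra.
Qed.
End Ineq.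

Section Dickson.
Variables (L : seq (nat * nat)) (ab x G : nat).
Hypothesis L_pr : {in L, forall c, [/\ prime c.1, odd c.1 & 0 < c.2]}.
Hypothesis L_eq : \prod_(c <- L) rep c.1 c.2.+1 = ab * \prod_(c <- L) c.1 ^ c.2.
Hypothesis ab0 : 0 < ab.
Hypothesis gap1 : {in L, forall c, ~~ (x < c.1 <= G)}.
Hypothesis gap2 : {in L, forall c, ~~ (x < c.1 ^ c.2 <= G)}.

Let small (c : nat * nat) := c.1 <= x.
Let fixd (c : nat * nat) := c.1 ^ c.2 <= x.
Let n := count small L.
Let V := ab * x ^ n.
Hypothesis le_xG : x <= G.
Hypothesis G_large : n * V.+1 < G.
Hypothesis big_small : (V%:R * \sum_(c <- L | (G < c.1)%N) (c.1%:R^-1 : rat) < 1)%R.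

(* Components are fixed ([p^e <= x]), with small prime only ([p <= x < p^e]), or
   large ([x < p]).  The equation says that [u / v] is close to 1, which forces
   [u = v]; comparing 2-adic valuations leaves no component of the second kind, and
   then none of the third. *)
Let uu (c : nat * nat) := if fixd c then rep c.1 c.2.+1 else c.1.
Let vv (c : nat * nat) := if fixd c then c.1 ^ c.2 else c.1.-1.
Let u := \prod_(c <- L | small c) uu c.
Let v := ab * \prod_(c <- L | small c) vv c.
Local Open Scope ring_scope.
(** For a component [p ^ e] that is not fixed, [rep p e.+1 / p ^ e] is exactly [p / (p - 1)] times
    [1 - defect]. *)
Let defect (c : nat * nat) : rat := if fixd c then 0 else (c.1 ^ c.2.+1)%N%:R^-1.
Let al : rat := \prod_(c <- L | small c) (1 - defect c).
Let excess (c : nat * nat) : rat := 1 - (c.1 ^ c.2)%N%:R / (rep c.1 c.2.+1)%:R.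
Let ga : rat := \prod_(c <- L | ~~ small c) (1 - excess c).

Let p3 c : c \in L -> (2 < c.1)%N.
Proof. by case/L_pr; case: (c.1) => [|[|[]]]. Qed.

Let pow0 c : c \in L -> (0 < c.1 ^ c.2)%N.
Proof. by move/p3 => h; rewrite expn_gt0 (leq_trans _ h). Qed.

Let repP c : c \in L -> (c.1 ^ c.2 < rep c.1 c.2.+1)%N.
Proof.
move=> cL; have [_ _ e0] := L_pr cL; have p_3 := p3 cL.
rewrite /rep big_ord_recr /= -/(rep _ _) -{1}[(_ ^ _)%N]add0n ltn_add2r.
exact: rep_gt0.
Qed.

Let repE c : c \in L -> (c.1.-1 * rep c.1 c.2.+1 = c.1 ^ c.2.+1 - 1)%N.
Proof. by move/p3 => h; apply: rep_pred; apply: leq_trans h. Qed.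

Let vv0 c : c \in L -> (0 < vv c)%N.
Proof.
move=> cL; rewrite /vv; case: ifP => _; first exact: pow0.
by have := p3 cL; case: (c.1) => [|[]].
Qed.
Let uu0 c : c \in L -> (0 < uu c)%N.
Proof.
move=> cL; rewrite /uu; case: ifP => _; first exact: leq_trans (repP cL).
by apply: leq_trans (p3 cL).
Qed.

Let local_small c : c \in L ->
  (uu c)%:R * (1 - defect c) * (c.1 ^ c.2)%N%:R = (vv c)%:R * (rep c.1 c.2.+1)%:R :> rat.
Proof.
move=> cL; rewrite /uu /vv /defect; case: ifP => _; first by rewrite subr0 mulr1 mulrC.
have e0 : (0 : rat) < (c.1 ^ c.2)%N%:R by rewrite ltr0n pow0.
have c0 : (0 : rat) < c.1%:R by rewrite ltr0n (leq_trans _ (p3 cL)).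
rewrite -natrM repE // natrB ?expn_gt0 ?(leq_trans _ (p3 cL)) // expnS natrM.
by field; rewrite !gt_eqF.
Qed.

Let rat_eq : u%:R * al = v%:R * ga.
Proof.
have gaE c : c \in L -> (1 - excess c) * (rep c.1 c.2.+1)%:R = (c.1 ^ c.2)%N%:R.
  move=> cL; rewrite /excess opprB addrC subrK mulfVK // pnatr_eq0 -lt0n.
  exact: leq_trans (repP cL).
have gaP : ga * \prod_(c <- L | ~~ small c) (rep c.1 c.2.+1)%:R =
    \prod_(c <- L | ~~ small c) (c.1 ^ c.2)%N%:R.
  rewrite /ga -big_split /= big_seq_cond [RHS]big_seq_cond.
  by apply: eq_bigr => c /andP[/gaE].
have ualP : u%:R * al * \prod_(c <- L | small c) (c.1 ^ c.2)%N%:R =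
   \prod_(c <- L | small c) (vv c)%:R * \prod_(c <- L | small c) (rep c.1 c.2.+1)%:R.
  rewrite /u /al natr_prod -!big_split /= big_seq_cond [RHS]big_seq_cond.
  by apply: eq_bigr => c /andP[/local_small].
have main : \prod_(c <- L) (rep c.1 c.2.+1)%:R = ab%:R * \prod_(c <- L) (c.1 ^ c.2)%N%:R :> rat.
  by rewrite -!natr_prod L_eq natrM.
rewrite (bigID small) [in RHS](bigID small) /= -gaP in main.
have prod_neq0 (P : pred (nat * nat)) (f : nat * nat -> nat) : {in L, forall c, 0 < f c}%N ->
    \prod_(c <- L | P c) (f c)%:R != 0 :> rat.
  move=> f0; rewrite big_seq_cond; elim/big_ind: _ => //; first exact: mulf_neq0.
  by move=> c /andP[/f0]; rewrite pnatr_eq0 lt0n.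
have nz1 := prod_neq0 small (fun c => c.1 ^ c.2)%N pow0.
have nz2 : \prod_(c <- L | ~~ small c) (rep c.1 c.2.+1)%:R != 0 :> rat.
  by apply: prod_neq0 => c /repP; apply: leq_trans.
move: ualP main nz1 nz2; rewrite /v natrM natr_prod.
move: (\prod_(c <- L | small c) (c.1 ^ c.2)%N%:R) (\prod_(c <- L | ~~ small c) _%:R)
  (\prod_(c <- L | small c) (rep _ _)%:R) => A B C.
move: (\prod_(c <- L | small c) _) => D.
move: (u%:R * al) ga ab%:R => ua g a ualP main A0 B0.
apply: (mulIf A0); apply: (mulIf B0).
rewrite ualP; transitivity (D * (C * B)); first by ring.
by rewrite main; ring.
Qed.

Let ga_bnd : 1 - \sum_(c <- L | ~~ small c) c.1%:R^-1 <= ga <= 1.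
Proof.
have ex c : c \in L -> 0 <= excess c <= c.1%:R^-1.
  move=> cL; have r0 : (0 : rat) < (rep c.1 c.2.+1)%:R.
    by rewrite ltr0n (leq_trans _ (repP cL)).
  have c0 : (0 : rat) < c.1%:R by rewrite ltr0n (leq_trans _ (p3 cL)).
  apply/andP; split.
    by rewrite subr_ge0 ler_pdivrMr // mul1r ler_nat ltnW // repP.
  rewrite /excess lerBlDr -lerBlDl ler_pdivlMr // mulrBl mul1r.
  rewrite lerBlDl -lerBlDr -(ler_pM2l c0) mulrBr mulVKf ?gt_eqF //.
  rewrite -!natrM lerBlDr -natrD ler_nat -expnS.
  have := repE cL; have := p3 cL; move: (rep _ _) (c.1 ^ _)%N => r e; case: (c.1) => //= m _; lia.
have ex01 : {in L, forall c, ~~ small c -> 0 <= excess c <= 1}.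
  move=> c cL _; have /andP[-> h] := ex c cL; apply: (le_trans h).
  by rewrite invf_le1 ?ltr0n ?ler1n (leq_trans _ (p3 cL)).
have [/andP[_ ->] h] := prod_one_sub ex01; rewrite andbT; apply: le_trans h.
rewrite lerB // big_seq_cond [leRHS]big_seq_cond; apply: ler_sum => c /andP[cL _].
by case/andP: (ex c cL).
Qed.

Let notsmall c : c \in L -> ~~ small c = (G < c.1)%N.
Proof.
move=> cL; have := gap1 cL; rewrite /small -ltnNge.
by move: le_xG; case: c {cL} => p e /= h1 h2; apply/idP/idP; lia.
Qed.

Let sum_big : \sum_(c <- L | ~~ small c) (c.1%:R^-1 : rat) = \sum_(c <- L | (G < c.1)%N) c.1%:R^-1.
Proof.
rewrite big_seq_cond [RHS]big_seq_cond; apply: eq_bigl => c.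
by case cL: (c \in L) => //=; rewrite notsmall.
Qed.

Let G0 : (0 : rat) < G%:R. Proof. by rewrite ltr0n (leq_ltn_trans _ G_large). Qed.

Let al_bnd : 0 <= al /\ 1 - n%:R / G%:R <= al <= 1.
Proof.
have df c : c \in L -> 0 <= defect c <= G%:R^-1.
  move=> cL; rewrite /defect; case: ifPn => nfix; first by rewrite lexx invr_ge0 ltW.
  rewrite invr_ge0 ler0n /= lef_pV2 ?posrE ?G0 ?ltr0n ?expn_gt0 ?(leq_trans _ (p3 cL)) //.
  rewrite ler_nat; have := gap2 cL; rewrite /fixd in nfix.
  have : (c.1 ^ c.2 <= c.1 ^ c.2.+1)%N by rewrite leq_exp2l // ltnW // p3.
  by move: nfix; move: (c.1 ^ c.2)%N (c.1 ^ c.2.+1)%N => A B; clear; lia.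
have df01 : {in L, forall c, small c -> 0 <= defect c <= 1}.
  move=> c cL _; have /andP[-> h] := df c cL; apply: (le_trans h).
  by rewrite invf_le1 ?G0 // ler1n; move: G0; rewrite ltr0n.
have [/andP[-> ->] h] := prod_one_sub df01; rewrite andbT; split=> //; apply: le_trans h.
rewrite lerB // /n -sum1_count natr_sum mulr_suml.
rewrite big_seq_cond [leRHS]big_seq_cond; apply: ler_sum => c /andP[cL _].
by rewrite mul1r; case/andP: (df c cL).
Qed.

Let v_le : (v <= V)%N.
Proof.
rewrite /v /V leq_mul2l; apply/orP; right.
rewrite /n -sum1_count expn_sum; apply: leq_prod => c; rewrite /small /vv => cx.
rewrite expn1; case: ifP => // _; exact: leq_trans (leq_pred _) cx.
Qed.

Let v0 : (0 < v)%N.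
Proof.
rewrite /v muln_gt0 ab0 /= big_seq_cond prodn_cond_gt0 // => c /andP[cL _]; exact: vv0.
Qed.

(** Here [u / v = ga / al], and [v <= V]. If [u > v], the quotient would be at least [1 + 1 / V],
    too much for [al >= 1 - n / G]; if [u < v], at most [1 - 1 / V], too little for [ga], whose
    distance to 1 is bounded by the sum of reciprocals beyond [G]. *)
Let u_eq_v : u = v.
Proof.
have [al0 /andP[al1 al2]] := al_bnd; have /andP[ga1 ga2] := ga_bnd.
have e := rat_eq; rewrite sum_big in ga1.
have v0' : (0 : rat) < v%:R by rewrite ltr0n.
apply/eqP; rewrite eqn_leq; apply/andP; split; rewrite leqNgt; apply/negP => lt.
  have h : (v.+1)%:R * (1 - n%:R / G%:R) <= v%:R :> rat.
    apply: (@le_trans _ _ (v%:R * ga)); last by rewrite ler_piMr // ltW.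
    rewrite -e; apply: (@le_trans _ _ (v.+1%:R * al)); first by rewrite ler_pM2l // ltr0n.
    by apply: ler_wpM2r; rewrite // ler_nat.
  move: h; rewrite -natr1 mulrBr mulr1 lerBlDr lerD2l mulrA ler_pdivlMr // mul1r natr1.
  rewrite -natrM ler_nat leqNgt => /negP; apply; apply: leq_trans G_large.
  by rewrite ltnS mulnC leq_mul2l ltnS v_le orbT.
have h : v%:R * (1 - \sum_(c <- L | (G < c.1)%N) c.1%:R^-1) <= v%:R - 1 :> rat.
  apply: (@le_trans _ _ (v%:R * ga)); first by rewrite ler_pM2l.
  rewrite -e; apply: (@le_trans _ _ u%:R); first by rewrite ler_piMr.
  by rewrite lerBrDr natr1 ler_nat.
move: h; rewrite mulrBr mulr1 lerD2l lerN2 leNgt => /negP; apply.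
apply: le_lt_trans big_small; apply: ler_wpM2r; last by rewrite ler_nat.
by apply: sumr_ge0 => c _; rewrite invr_ge0.
Qed.

Let ab_logn : logn 2 ab = logn 2 (\prod_(c <- L) rep c.1 c.2.+1).
Proof.
rewrite L_eq lognM // ?logn_prod_seq // ?big_seq ?prodn_cond_gt0 // ?big1_seq ?addn0 //.
move=> c /andP[_ cL]; have [_ p_odd _] := L_pr cL.
by rewrite lognX lognE /= dvdn2 p_odd andbF muln0.
Qed.

(** The 2-adic valuation of [ab] is that of the product of all [rep], hence at least that of [u], as
    the non-fixed factors of [u] are odd. So [u = v] leaves no factor 2 in the [vv c], but a
    non-fixed component would contribute the even number [c.1.-1]. *)
Let all_fix : {in L, forall c, small c -> fixd c}.
Proof.
have rep0 : {in L, forall c, 0 < rep c.1 c.2.+1}%N by move=> c /repP; apply: leq_trans.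
have := congr1 (logn 2) u_eq_v; rewrite /v lognM //; last first.
  by rewrite big_seq_cond prodn_cond_gt0 // => c /andP[cL _]; apply: vv0.
rewrite ab_logn /u !logn_prod_seq // [in RHS](bigID small) /= => e c0 cL0 sc0.
have : (\sum_(c <- L | small c) logn 2 (vv c) <= 0)%N.
  rewrite -(leq_add2l (\sum_(c <- L | small c) logn 2 (uu c))) addn0 {2}e.
  rewrite leq_add2r (leq_trans _ (leq_addr _ _)) // big_seq_cond [leqRHS]big_seq_cond.
  apply: leq_sum => c /andP[cL _]; rewrite /uu; case: ifP => // _.
  have [p_pr p_odd _] := L_pr cL; rewrite lognE /=.
  by rewrite dvdn2 p_odd andbF.
rewrite leqn0 sum_nat_seq_eq0 => /allP /(_ c0 cL0); rewrite sc0 /=.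
apply: contraTT => nfix; rewrite /vv (negbTE nfix) -lt0n logn_gt0 mem_primes /=.
have [p_pr p_odd _] := L_pr cL0; have := p3 cL0; rewrite dvdn2.
by case: (c0.1) p_odd => [|[|m]] //=; rewrite !negbK => ->.
Qed.

Theorem dickson : {in L, forall c, (c.1 ^ c.2 <= x)%N}.
Proof.
have al1 : al = 1.
  rewrite /al big_seq_cond big1 // => c /andP[cL sc].
  by rewrite /defect all_fix ?subr0.
have ga1 : ga = 1.
  by have := rat_eq; rewrite u_eq_v al1 => /mulfI -> //; rewrite pnatr_eq0 -lt0n.
move=> c cL; case: (boolP (small c)) => sc; first exact: all_fix.
(* A component with [c.1 > x] would put a factor [1 - excess c], strictly below 1, into the product
   [ga], which equals 1. *)
have ex c' : c' \in L -> 0 < excess c' <= 1.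
  move=> cL'; have r0 : (0 : rat) < (rep c'.1 c'.2.+1)%:R.
    by rewrite ltr0n (leq_trans _ (repP cL')).
  by rewrite subr_gt0 ltr_pdivrMr // mul1r ltr_nat repP //= gerBl divr_ge0.
have sub : {in rem c L, forall c', ~~ small c' -> 0 <= excess c' <= 1}.
  by move=> c' /mem_rem /ex /andP[/ltW -> ->].
have := ga1; rewrite /ga (big_rem c) //= sc.
have [/andP[h1 h2] _] := prod_one_sub sub; have /andP[h3 h4] := ex c cL.
move: (\prod_(_ <- _ | _) _) h1 h2 => y h1 h2 e; exfalso; nra.
Qed.
End Dickson.

(** * Iterated exponentials *)

Definition tow j x := iter j (expn 2) x.

Lemma tow_add_height i j x : tow (i + j) x = tow i (tow j x).
Proof. exact: iterD. Qed.

Lemma leq_tow j x : x <= tow j x.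
Proof. by elim: j => //= j IH; apply: leq_trans IH (ltnW (self_lt_exp2 _)). Qed.

Lemma tow_mono i j x y : i <= j -> x <= y -> tow i x <= tow j y.
Proof.
move=> /subnK <- lexy; rewrite tow_add_height; apply: leq_trans (leq_tow _ _).
by elim: i => //= i IH; rewrite leq_exp2l.
Qed.

Section Rules.
Variables (x : nat).
Hypothesis x4 : 4 <= x.
Let t4 j : 4 <= tow j x. Proof. exact: leq_trans x4 (leq_tow j x). Qed.

Lemma tow_mul j A B : A <= tow j x -> B <= tow j x -> A * B <= tow j.+1 x.
Proof. by move=> hA hB; apply: leq_trans (leq_mul hA hB) _; apply: sqr_le_exp2. Qed.

Lemma tow_add j A B : A <= tow j x -> B <= tow j x -> A + B <= tow j.+1 x.
Proof.
move=> hA hB; apply: (leq_trans (leq_add hA hB)); rewrite addnn -mul2n.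
by apply: tow_mul => //; apply: leq_trans (t4 j).
Qed.

Lemma tow_succ j A : A <= tow j x -> A.+1 <= tow j.+1 x.
Proof. by move=> hA; rewrite -addn1; apply: tow_add => //; apply: leq_trans (t4 j). Qed.

Lemma tow_exp j A B : A <= tow j x -> B <= tow j x -> A ^ B <= tow j.+2 x.
Proof.
move=> hA hB; set y := tow j x in hA hB.
have y0 : 0 < y by apply: leq_trans (t4 j).
apply: (@leq_trans (y ^ y)).
  apply: (@leq_trans (y ^ B)); last by rewrite leq_pexp2l.
  by case: B {hB} => // B; rewrite leq_exp2r.
apply: (@leq_trans (2 ^ (y * y))).
  by rewrite expnM; case: (y) => // z; rewrite leq_exp2r // ltnW ?self_lt_exp2.
by rewrite /tow iterS leq_exp2l //=; apply: sqr_le_exp2; apply: t4.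
Qed.

Lemma tow_leaf j A : A <= x -> A <= tow j x.
Proof. by move=> h; apply: leq_trans h (leq_tow j x). Qed.
End Rules.

Ltac is_numeral n := lazymatch n with O => idtac | S ?m => is_numeral m end.

(** Bounds matter only up to iterated exponentials: a sum, a product or a successor costs one floor
    of the tower and a power two, so an estimate can follow the syntax of the term. *)
Ltac tow_bound :=
  repeat match goal with
  | |- is_true (leq (addn _ _) (tow _ _)) => apply: tow_add
  | |- is_true (leq (muln _ _) (tow _ _)) => apply: tow_mul
  | |- is_true (leq (expn _ _) (tow _ _)) => apply: tow_exp
  | |- is_true (leq (S ?A) (tow _ _)) =>
      tryif is_numeral A then fail else apply: tow_succ
  end; try done;
  try (apply: tow_leaf; first [assumption | exact: leqnn | match goal with
    h : is_true (leq 100 _) |- _ => by apply: (leq_trans _ h) end]);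
  try match goal with h : is_true (leq 100 ?x) |- is_true (leq _ ?x) => by apply: (leq_trans _ h) end.

Section Bounds.
Variables (x : nat).
Hypothesis x100 : 100 <= x.
Let x4 : 4 <= x. Proof. exact: leq_trans x100. Qed.
Hint Resolve x4 : core.

Lemma long_kappa_tow K : K <= x -> long_kappa K <= tow 6 x.
Proof.
move=> Kx; rewrite /long_kappa /baker_exp; tow_bound.
Qed.

Lemma long_coef_tow K : K <= x -> long_coef K <= tow 13 x.
Proof.
move=> Kx; rewrite /long_coef; tow_bound.
by apply: leq_trans (long_kappa_tow Kx) _; apply: tow_mono.
Qed.

Lemma long_exp_tow K : K <= x -> long_exp K <= tow 9 x.
Proof.
move=> Kx; rewrite /long_exp; tow_bound.
by apply: leq_trans (long_kappa_tow Kx) _; apply: tow_mono.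
Qed.

Lemma long_height_tow K : K <= x -> long_height K <= tow 20 x.
Proof.
move=> Kx; rewrite /long_height /baker_height; tow_bound.
  by apply: leq_trans (long_kappa_tow Kx) _; apply: tow_mono.
by apply: leq_trans (long_coef_tow Kx) _; apply: tow_mono.
Qed.

Lemma smooth_exp_tow X : X <= x -> smooth_exp X <= tow 5 x.
Proof. by move=> Xx; rewrite /smooth_exp; tow_bound. Qed.

Lemma sep_exp_tow X : X <= x -> sep_exp X <= tow 8 x.
Proof.
move=> Xx; rewrite /sep_exp; tow_bound.
all: by apply: leq_trans (smooth_exp_tow Xx) _; apply: tow_mono.
Qed.

Lemma sep_start_tow X : X <= x -> sep_start X <= tow 10 x.
Proof.
move=> Xx; rewrite /sep_start /aux_const -[tow 10 x]/(2 ^ tow 9 x) leq_exp2l //; tow_bound.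
all: by apply: leq_trans (smooth_exp_tow Xx) _; apply: tow_mono.
Qed.

Lemma sep_classes_tow X : X <= x -> sep_classes X <= tow 20 x.
Proof.
move=> Xx; rewrite /sep_classes; tow_bound.
all: by apply: leq_trans (smooth_exp_tow Xx) _; apply: tow_mono.
Qed.
End Bounds.

(** * The pair M, N *)

Lemma sigma_prime_decomp n : sigma n = \prod_(c <- prime_decomp n) rep c.1 c.2.+1.
Proof.
rewrite /sigma /divisors; elim: (prime_decomp n) => [|[p e] s IH] /=.
  by rewrite big_seq1 big_nil.
rewrite big_cons /= -IH; move: (foldr _ _ _) => D.
elim: e => [|e IHe] /=; first by rewrite /rep big_ord1 mul1n.
rewrite (perm_big _ (permEl (perm_merge _ _ _))) big_cat big_map /= rep_recl mulnDl mul1n addnC.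
congr (_ + _); rewrite -mulnA -IHe big_distrr /=; apply: eq_bigr => i _.
exact: NatTrec.mulE.
Qed.

Lemma sigma_primes n : sigma n = \prod_(p <- primes n) rep p (logn p n).+1.
Proof. by rewrite sigma_prime_decomp prime_decompE big_map. Qed.

Lemma odd_rep q F : odd q -> odd (rep q F) = odd F.
Proof.
move=> oq; elim: F => [|F IH]; first by rewrite /rep big_ord0.
by rewrite rep_recl oddD oddM oq IH.
Qed.

Lemma prime_divisor_odd n p : odd n -> p %| n -> odd p.
Proof. by move=> on /dvdnP[r e]; move: on; rewrite e oddM => /andP[]. Qed.

Lemma exp_count_dvd_prod (T : eqType) d (s : seq T) (P : pred T) (f : T -> nat) :
  {in s, forall c, P c -> d %| f c} -> d ^ count P s %| \prod_(c <- s) f c.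
Proof.
elim: s => [|c s IH] h; first by rewrite big_nil.
rewrite big_cons /= expnD dvdn_mul //; last by apply: IH => c' c's; apply: h; rewrite inE c's orbT.
by case Pc: (P c); rewrite ?expn0 // expn1 h // mem_head.
Qed.

Section Pair.
Variables a k M N : nat.
Hypotheses (oM : odd M) (oN : odd N) (sN : sigma N = a * M) (a0 : 0 < a).
Hypothesis omM : size (primes M) <= k.
Notation F q := (logn q N).+1.

Let N0 : 0 < N. Proof. by case: N oN. Qed.
Let M0 : 0 < M. Proof. by case: M oM. Qed.

Lemma component_ge3 n q : odd n -> q \in primes n -> [/\ prime q, odd q & 3 <= q].
Proof.
move=> on; rewrite mem_primes => /and3P[q_pr _ /(prime_divisor_odd on) oq].
by split=> //; case: q q_pr oq => [|[|[]]].
Qed.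

Lemma rep_dvd q : q \in primes N -> rep q (F q) %| a * M.
Proof. by move=> qN; rewrite -sN sigma_primes (big_rem q) //= dvdn_mulr. Qed.

Lemma count_odd_exponents : count (fun q => odd (logn q N)) (primes N) <= a.
Proof.
set c := count _ _; have : 2 ^ c %| a * M.
  rewrite -sN sigma_primes; apply: exp_count_dvd_prod => q qN oq.
  by have [_ q_odd _] := component_ge3 oN qN; rewrite dvdn2 odd_rep //= oq.
rewrite Gauss_dvdl ?coprimeXl ?coprime2n // => /(dvdn_leq a0).
by apply: leq_trans; apply/ltnW/self_lt_exp2.
Qed.

Definition odd_support := [seq p <- primes (a * M) | odd p].
Notation S := odd_support.
Notation K := (size S).

Lemma odd_support_uniq : uniq S. Proof. by rewrite filter_uniq ?primes_uniq. Qed.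

Lemma odd_supportP : {in S, forall p, prime p /\ odd p}.
Proof. by move=> p; rewrite mem_filter mem_primes => /andP[-> /and3P[]]. Qed.

Lemma size_odd_support : K <= k + a.
Proof.
have sub : {subset S <= primes M ++ iota 1 a}.
  move=> p; rewrite mem_filter primesM // mem_cat => /andP[_ /orP[|->//]].
  rewrite mem_primes mem_iota => /and3P[p_pr _ /(dvdn_leq a0) le].
  by rewrite prime_gt0 //= add1n ltnS le orbT.
apply: (leq_trans (uniq_leq_size odd_support_uniq sub)).
by rewrite size_cat size_iota leq_add2r.
Qed.

Definition even_primes := [seq q <- primes N | ~~ odd (logn q N)].

Lemma even_primes_uniq : uniq even_primes. Proof. by rewrite filter_uniq ?primes_uniq. Qed.

Lemma even_primesP q : q \in even_primes ->
  [/\ prime q, odd q, 3 <= q, 3 <= F q & {subset primes (rep q (F q)) <= S}].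
Proof.
rewrite mem_filter => /andP[ev qN]; have [q_pr oq q3] := component_ge3 oN qN.
have lq : 0 < logn q N by rewrite logn_gt0.
split=> // [|p]; first by case: (logn q N) lq ev => [|[]].
rewrite mem_primes mem_filter mem_primes => /and3P[-> r0 dvd] /=.
rewrite muln_gt0 a0 M0 (dvdn_trans dvd (rep_dvd qN)) !andbT /=.
by apply: prime_divisor_odd dvd; rewrite odd_rep //= ev.
Qed.

Lemma few_long_components x : long_height K <= x ->
  count (fun q => (q <= 2 ^ x) && (x ^ long_exp K <= F q)) even_primes <= K * (2 * K).
Proof.
move=> lx; rewrite -size_filter.
apply: (@few_long_reps K x S [seq q <- even_primes | (q <= 2 ^ x) && (x ^ long_exp K <= F q)] (fun q => F q)) => //.
- exact: odd_support_uniq.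
- exact: odd_supportP.
- by rewrite filter_uniq ?even_primes_uniq.
- by move=> q; rewrite mem_filter => /andP[/andP[qx _] /even_primesP[-> _ -> _ _]].
- by move=> q; rewrite mem_filter => /andP[_ /even_primesP[]].
by move=> q; rewrite mem_filter => /andP[/andP[_ ->]].
Qed.

(** Odd exponents, long even exponents and short even exponents are counted apart. Only the third
    count grows with [h], and polynomially. *)
Lemma count_components h : 1 < h -> long_height K <= h ->
  count (fun q => q <= 2 ^ h) (primes N) <=
  a + (K * (2 * K) + h ^ long_exp K * (h * h ^ long_exp K) ^ K).
Proof.
move=> h1 lh_le; set D := h ^ long_exp K.
pose P1 q := odd (logn q N).
pose P2 q := ~~ odd (logn q N) && ((q <= 2 ^ h) && (D <= F q)).
pose P3 q := ~~ odd (logn q N) && ((q <= 2 ^ h) && (F q < D)).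
apply: (@leq_trans (count P1 (primes N) + (count P2 (primes N) + count P3 (primes N)))).
  rewrite -[count P2 _ + _]count_predUI addnA -(count_predUI P1).
  rewrite -!addnA; apply: leq_trans (leq_addr _ _); apply: sub_count => q /= qh.
  by rewrite /P1 /P2 /P3 qh /=; case: odd => //=; case: ltnP.
apply: leq_add; first exact: count_odd_exponents.
have cf P : count (fun q => ~~ odd (logn q N) && P q) (primes N) = count P even_primes.
  by rewrite count_filter; apply: eq_count => q /=; rewrite andbC.
rewrite /P2 /P3 !cf; apply: leq_add; first exact: few_long_components.
rewrite -size_filter; apply: (@few_short_reps S _ (fun q => F q)).
- exact: odd_support_uniq.
- by rewrite filter_uniq ?even_primes_uniq.
- by move=> p /odd_supportP[].
- by move=> q; rewrite mem_filter => /andP[/andP[-> _] /even_primesP[_ _ /ltnW -> _ _]].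
- by move=> q; rewrite mem_filter => /andP[/andP[_ ->] /even_primesP[_ _ _ /ltnW -> _]].
by move=> q; rewrite mem_filter => /andP[_ /even_primesP[]].
Qed.

Definition tail_exp := 2 + (2 * long_exp K + (2 + 2 * long_exp K) * K).

(** Feeds [sum_inv_tail]: the reciprocals of the primes of [N] have a small tail although the number
    of these primes is not bounded. *)
Lemma tail_count h : long_height K <= h -> a + K * (2 * K) <= h -> 2 ^ (2 * tail_exp.+2 + 4) <= h ->
  count (fun q => q <= 2 ^ h.+1) (primes N) * h ^ 2 <= 2 ^ h.
Proof.
move=> lh_le ah th.
have h2 : 2 < h by apply: leq_trans th; rewrite -[2]/(2 ^ 1) ltn_exp2l // addnC.
have e2 : h.+1 <= h ^ 2 by rewrite -mulnn; move: h2; clear; nia.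
apply: leq_trans (exp_poly_le (leqnn _) th).
apply: (@leq_trans (2 * h ^ tail_exp * h ^ 2)); last by rewrite -mulnA -expnD addn2.
rewrite leq_mul2r; apply/orP; right.
have h12 : 1 < h.+1 by move: h2; clear; lia.
apply: (leq_trans (count_components h12 (leqW lh_le))).
rewrite addnA [2 * h ^ _]mul2n -addnn; apply: leq_add.
  by apply: (leq_trans ah); rewrite -{1}(expn1 h) leq_pexp2l // (leq_trans _ h2).
have hD : h.+1 ^ long_exp K <= h ^ (2 * long_exp K).
  by rewrite expnM; case: (long_exp K) => // d; rewrite leq_exp2r.
apply: (@leq_trans (h ^ (2 * long_exp K) * (h ^ 2 * h ^ (2 * long_exp K)) ^ K)).
  apply: leq_mul => //; have := leq_mul e2 hD; move: (_ * _) (_ * _) => u v uv.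
  by case: (K) => // d; rewrite leq_exp2r.
by rewrite -!expnD -expnM -expnD leq_pexp2l ?leq_addl // (leq_trans _ h2).
Qed.
End Pair.

(** * Windows *)

Lemma free_interval (V : seq nat) (X : nat -> nat) : {homo X : i j / i <= j} ->
  exists2 i, i <= size V & {in V, forall v, ~~ (X i < v <= X i.+1)}.
Proof.
move=> X_mono; pose bad i := has (fun v => X i < v <= X i.+1) V.
have [/allP all_bad|/allPn[i]] := boolP (all bad (iota 0 (size V).+1)); last first.
  by rewrite mem_iota => /andP[_ iV] /hasPn h; exists i.
pose f i := nth 0 V (find (fun v => X i < v <= X i.+1) V).
have fP i : i <= size V -> f i \in V /\ X i < f i <= X i.+1.
  move=> iV; have hb : bad i by apply: all_bad; rewrite mem_iota.
  by split; [rewrite mem_nth // -has_find | apply: (nth_find _ hb)].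
have lt_f i j : i < j -> j <= size V -> f i < f j.
  move=> ij jV; have [_ /andP[_ h1]] := fP i (leq_trans (ltnW ij) jV).
  have [_ /andP[h2 _]] := fP j jV; apply: leq_ltn_trans h2; apply: (leq_trans h1); exact: X_mono.
have : size [seq f i | i <- iota 0 (size V).+1] <= size V.
  apply: uniq_leq_size; last by move=> v /mapP[i]; rewrite mem_iota => /andP[_ /fP[h _]] ->.
  rewrite map_inj_in_uniq ?iota_uniq // => i j; rewrite !mem_iota !add0n !ltnS => iV jV e.
  case: (ltngtP i j) => // ij; first by have := lt_f _ _ ij jV; rewrite e ltnn.
  by have := lt_f _ _ ij iV; rewrite e ltnn.
by rewrite size_map size_iota ltnn.
Qed.

Section Windows.
Variables a b k M N s : nat.
Hypotheses (oM : odd M) (oN : odd N) (sN : sigma N = a * M) (sM : sigma M = b * N).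
Hypotheses (a0 : 0 < a) (b0 : 0 < b) (omM : size (primes M) <= k).
Hypothesis s_large : a + b + k + 100 <= s.
Notation S := (odd_support a M).
Notation K := (size S).
Notation X0 := (tow 30 s).
Notation G := (tow 10).
Definition comps := prime_decomp M ++ prime_decomp N.

Let K_le : K <= s.
Proof.
have := size_odd_support oM a0 omM; move: s_large; move: K => K'; clear; lia.
Qed.
Let s100 : 100 <= s. Proof. by move: s_large; clear; lia. Qed.
Let a_le : a <= s. Proof. by move: s_large; clear; lia. Qed.
Let b_le : b <= s. Proof. by move: s_large; clear; lia. Qed.
Let k_le : k <= s. Proof. by move: s_large; clear; lia. Qed.

Lemma compsP : {in comps, forall c, [/\ prime c.1, odd c.1 & 0 < c.2]}.
Proof.
case=> p e; rewrite mem_cat => /orP[] /mem_prime_decomp[p_pr e0 /= dvd]; split=> //.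
  by apply: (prime_divisor_odd oM); apply: dvdn_trans dvd; rewrite dvdn_exp.
by apply: (prime_divisor_odd oN); apply: dvdn_trans dvd; rewrite dvdn_exp.
Qed.

Lemma comps_eq : \prod_(c <- comps) rep c.1 c.2.+1 = a * b * \prod_(c <- comps) c.1 ^ c.2.
Proof.
have M0 : 0 < M by case: M oM. have N0 : 0 < N by case: N oN.
rewrite !big_cat /= -(prod_prime_decomp M0) -(prod_prime_decomp N0).
by rewrite -!sigma_prime_decomp sN sM; clear; lia.
Qed.

Lemma primes_count_le h : X0 <= h ->
  count (fun q => q <= 2 ^ h.+1) (primes N) * h ^ 2 <= 2 ^ h.
Proof.
move=> X0h; apply: (tail_count oM oN sN a0).
- by apply: leq_trans (long_height_tow s100 K_le) _; apply: leq_trans X0h; apply: tow_mono.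
- by apply: leq_trans X0h; tow_bound.
apply: leq_trans X0h; rewrite /tail_exp; tow_bound.
all: by apply: leq_trans (long_exp_tow s100 K_le) _; apply: tow_mono.
Qed.

Lemma count_primes_le n x : count (fun p => p <= x) (primes n) <= x.
Proof.
rewrite -size_filter -{2}(size_iota 1 x); apply: uniq_leq_size.
  by rewrite filter_uniq ?primes_uniq.
by move=> p; rewrite mem_filter mem_primes mem_iota add1n ltnS => /and3P[-> /prime_gt0 ->].
Qed.

(** The integers compared in [dickson] are at most [tow 4 x], whereas [G x = 2 ^ tow 9 x]. Beyond
    [G x] the reciprocals sum to at most [1 / (tow 9 x - 1)] over the primes of [N], and to at most
    [k] times as much over those of [M]. *)
Lemma dickson_window x : X0 <= x ->
  {in comps, forall c, ~~ (x < c.1 <= G x)} ->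
  {in comps, forall c, ~~ (x < c.1 ^ c.2 <= G x)} ->
  {in comps, forall c, c.1 ^ c.2 <= x}.
Proof.
move=> X0x gap1 gap2.
have sx : s <= x := leq_trans (leq_tow _ _) X0x.
have x100 := leq_trans s100 sx; have ax := leq_trans a_le sx.
have bx := leq_trans b_le sx; have kx := leq_trans k_le sx.
set n := count (fun c : nat * nat => c.1 <= x) comps.
have n_le : n <= x + x.
  have := leq_add (count_primes_le M x) (count_primes_le N x).
  by rewrite /n count_cat /primes !count_map.
have nx : n <= tow 1 x by apply: leq_trans n_le _; tow_bound.
have nj j : 0 < j -> n <= tow j x by move=> j0; apply: leq_trans nx _; apply: tow_mono.
set V := a * b * x ^ n.
have Vx : V <= tow 4 x by rewrite /V; tow_bound.
apply: (dickson compsP comps_eq _ gap1 gap2); rewrite ?muln_gt0 ?a0 ?leq_tow // -/n -/V.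
  apply: (@leq_trans (tow 6 x).+1); last by tow_bound; apply: tow_mono.
  rewrite ltnS; tow_bound; exact: nj.
set h1 := tow 9 x.
have h1V : V * k.+1 + 2 <= h1.
  by rewrite /h1; tow_bound; apply: leq_trans Vx _; apply: tow_mono.
have h1_1 : 1 < h1 by apply: leq_trans (leq_trans _ x100) (leq_tow _ _).
have GE : G x = 2 ^ h1 by [].
have X0h1 : X0 <= h1 := leq_trans X0x (leq_tow _ _).
have tailN : (\sum_(q <- primes N | (G x < q)%N) (q%:R^-1 : rat) <= h1.-1%:R^-1)%R.
  rewrite GE.
  have := @sum_inv_tail (primes N) h1 (h1 + N) h1_1 (leq_addr _ _)
    (fun h hh => primes_count_le (leq_trans X0h1 hh)).
  rewrite big_seq_cond => h.
  rewrite big_seq_cond (eq_bigl (fun q => (q \in primes N) && (2 ^ h1 < q <= 2 ^ (h1 + N)))).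
    by apply: (le_trans h); rewrite gerBl invr_ge0 ler0n.
  move=> q; case qN: (q \in primes N) => //=; rewrite andb_idr // => _.
  move: qN; rewrite mem_primes => /and3P[_ N0 /(dvdn_leq N0) /leq_trans]; apply.
  by apply: (leq_trans (ltnW (self_lt_exp2 N))); rewrite leq_exp2l // leq_addl.
have h10 : ((0 : rat) < h1.-1%:R)%R by rewrite ltr0n; case: (h1) h1_1 => [|[]].
have tailM : (\sum_(q <- primes M | (G x < q)%N) (q%:R^-1 : rat) <= k%:R / h1.-1%:R)%R.
  apply: (@le_trans _ _ (\sum_(q <- primes M) h1.-1%:R^-1)%R); last first.
    rewrite big_const_seq count_predT iter_addr_0 -[(_ *+ size _)%R]mulr_natl.
    by rewrite ler_pM2r ?invr_gt0 // ler_nat.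
  rewrite big_mkcond; apply: ler_sum => q _; case: ifP => [lt|_]; last by rewrite invr_ge0 ltW.
  have le : h1.-1 <= q.
    by apply: (leq_trans (leq_pred _)); apply: leq_trans (ltnW lt); rewrite GE ltnW // self_lt_exp2.
  have q0 : 0 < q by apply: leq_ltn_trans lt.
  by rewrite lef_pV2 ?posrE ?ltr0n ?ler_nat //; move: h10; rewrite ltr0n.
have -> : (\sum_(c <- comps | (G x < c.1)%N) (c.1%:R^-1 : rat))%R =
    (\sum_(q <- primes M | (G x < q)%N) q%:R^-1 + \sum_(q <- primes N | (G x < q)%N) q%:R^-1)%R.
  by rewrite big_cat /= /primes !big_map.
apply: (@le_lt_trans _ _ (V%:R * (k%:R / h1.-1%:R + h1.-1%:R^-1))%R).
  by rewrite ler_wpM2l ?ler0n // lerD.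
rewrite -{2}[(h1.-1%:R^-1)%R]mul1r -mulrDl mulrA natr1 -natrM ltr_pdivrMr // mul1r ltr_nat.
by move: h1V; clear; move: (V * _) h1 => u v; lia.
Qed.

Definition special_values := flatten [seq [:: c.1; c.1 ^ c.2] |
  c <- prime_decomp M ++ [seq c <- prime_decomp N | odd c.2]].

Lemma size_special_values : size special_values <= 2 * s.
Proof.
rewrite size_flatten /shape -map_comp (eq_map (g := fun=> 2)) // sumnE big_map.
rewrite big_const_seq count_predT iter_addn_0 leq_mul2l /= size_cat size_filter.
apply: (@leq_trans (k + a)); last by move: s_large; clear; lia.
apply: leq_add; first by move: omM; rewrite /primes size_map.
apply: leq_trans (count_odd_exponents oM oN sN a0).
by rewrite prime_decompE count_map.
Qed.

Lemma even_component c : c \in comps -> c.1 \notin special_values \/ c.1 ^ c.2 \notin special_values ->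
  c.1 \in even_primes N /\ c.2 = logn c.1 N.
Proof.
move=> cL nsp.
have nS : c \notin prime_decomp M ++ [seq c <- prime_decomp N | odd c.2].
  apply/negP => cS; case: nsp => /negP; apply; apply/flattenP; exists [:: c.1; c.1 ^ c.2];
    rewrite ?inE ?eqxx ?orbT //; exact: map_f.
move: cL nS; rewrite !mem_cat mem_filter; case: (c \in prime_decomp M) => //= cN.
rewrite cN andbT; move: cN; rewrite prime_decompE => /mapP[p pN ->] /= ev.
by rewrite mem_filter ev.
Qed.

Section Interval.
Variables X Y : nat.
Hypothesis X0X : X0 <= X.
Hypothesis free : {in special_values, forall v, ~~ (X < v <= Y)}.
(* More windows than the number of primes provided by [few_long_components] and
   [few_separated]. *)
Definition num_windows := K * (2 * K) + sep_classes X + 1.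
Notation n := num_windows.
Notation xt t := (tow (10 * t) X).
Hypothesis Y_large : 2 * xt (3 * n).+1 <= Y.

Let xtS t : xt t.+1 = G (xt t). Proof. by rewrite mulnS tow_add_height. Qed.
Let xt_mono t u : t <= u -> xt t <= xt u.
Proof. by move=> tu; apply: tow_mono => //; rewrite leq_mul2l tu orbT. Qed.
Let xt_Y t : t <= (3 * n).+1 -> 2 * xt t <= Y.
Proof. by move=> h; apply: leq_trans Y_large; rewrite leq_mul2l xt_mono. Qed.
Let xt_Y1 t : t <= (3 * n).+1 -> xt t <= Y.
Proof. by move/xt_Y; apply: leq_trans; rewrite leq_pmull. Qed.
Let X_xt t : X <= xt t. Proof. exact: leq_tow. Qed.
Let sX : s <= X. Proof. exact: leq_trans (leq_tow _ _) X0X. Qed.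
Let x100 t : 100 <= xt t. Proof. exact: leq_trans s100 (leq_trans sX (X_xt t)). Qed.

Definition in_window x (c : nat * nat) :=
  (x < c.1 <= G x) || (x < c.1 ^ c.2 <= G x).
Definition window_comp t := nth (0, 0) comps (find (in_window (xt t)) comps).

Definition small_odd_primes := [seq p <- iota 1 X | prime p && odd p].

Let xn_pow : xt (3 * n) ^ (xt (3 * n) ^ long_exp K) <= xt (3 * n).+1.
Proof.
have h : long_exp K <= xt (3 * n).
  apply: leq_trans (X_xt _); apply: leq_trans X0X; apply: leq_trans (long_exp_tow s100 K_le) _.
  exact: tow_mono.
by rewrite xtS; have := x100 (3 * n) => h100; tow_bound.
Qed.

Lemma small_odd_primes_uniq : uniq small_odd_primes.
Proof. by rewrite filter_uniq ?iota_uniq. Qed.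

Lemma small_odd_primesP : {in small_odd_primes, forall p, [/\ prime p, odd p & p <= X]}.
Proof. by move=> p; rewrite mem_filter mem_iota add1n ltnS => /andP[/andP[-> ->] /andP[_ ->]]. Qed.

Lemma size_small_odd_primes : size small_odd_primes <= X.
Proof. by rewrite size_filter (leq_trans (count_size _ _)) // size_iota. Qed.

Let X1 : 0 < X. Proof. exact: leq_trans (leq_trans _ s100) sX. Qed.

Lemma small_support p : p \in S -> p <= Y -> p \in small_odd_primes.
Proof.
rewrite mem_filter => /andP[op paM] pY.
have /and3P[p_pr _ _] : [&& prime p, 0 < a * M & p %| a * M] by rewrite -mem_primes.
rewrite mem_filter p_pr op mem_iota add1n ltnS prime_gt0 //=.
have M0 : 0 < M by case: M oM.
move: paM; rewrite primesM // => /orP[|pM].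
  rewrite mem_primes => /and3P[_ _ /(dvdn_leq a0) pa].
  exact: leq_trans pa (leq_trans a_le sX).
have pV : p \in special_values.
  apply/flattenP; exists [:: p; p ^ logn p M]; rewrite ?mem_head //.
  apply: (map_f (fun c : nat * nat => [:: c.1; c.1 ^ c.2]) (x := (p, logn p M))).
  by rewrite mem_cat prime_decompE (map_f (fun p => (p, logn p M))).
by move: (free pV); rewrite pY andbT -leqNgt.
Qed.

(* The first alternative is the case [q^e > xt (3 n).+1]; otherwise the primes of
   [rep q (e + 1)] are at most [Y], hence at most [X]. *)
Lemma window_compP t : 0 < t -> t < 3 * n -> has (in_window (xt t)) comps ->
  let q := (window_comp t).1 in
  [/\ q \in even_primes N, xt t.-1 < q <= xt t.+1 &
     (xt (3 * n) ^ long_exp K <= (logn q N).+1) \/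
     {subset primes (rep q (logn q N).+1) <= small_odd_primes}].
Proof.
move=> t0 tn hasw; set c := window_comp t => q.
have cL : c \in comps by rewrite mem_nth // -has_find.
have cw : in_window (xt t) c := nth_find _ hasw.
have t_n : t.+1 <= (3 * n).+1 by rewrite ltnS ltnW.
have inXY v : xt t < v <= G (xt t) -> v \notin special_values.
  rewrite -xtS => /andP[v1 v2]; apply/negP => /free; rewrite (leq_ltn_trans (X_xt t) v1) /=.
  by rewrite (leq_trans v2 (xt_Y1 t_n)).
have [qN c2] : q \in even_primes N /\ c.2 = logn q N.
  by apply: even_component => //; case/orP: cw => /inXY; [left|right].
have [q_pr oq q3 F3 sub] := even_primesP oM oN sN a0 qN.
move: cw; rewrite /in_window c2 -/q -xtS => cw.
set e := logn q N in F3 sub cw *.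
have e0 : 0 < e by case: (e) F3.
have q0 : 0 < q by apply: leq_trans q3.
have q_e : q <= q ^ e by rewrite -{1}(expn1 q) leq_pexp2l.
have q_up : q <= xt t.+1 by case/orP: cw => /andP[_ //]; apply: leq_trans.
have q_n : q <= xt (3 * n) by apply: leq_trans q_up (xt_mono tn).
have pred_t : xt t.-1 <= xt t by apply/xt_mono/leq_pred.
have [big|small] := ltnP (xt (3 * n).+1) (q ^ e).
  have -> : xt t.-1 < q.
    case/orP: cw => /andP[h1 h2]; first exact: leq_ltn_trans h1.
    by move: big; rewrite ltnNge (leq_trans h2 (xt_mono t_n)).
  split=> //; left; rewrite leqNgt; apply/negP => /ltnW lt.
  move: big; rewrite ltnNge => /negP; apply; apply: leq_trans xn_pow.
  apply: (@leq_trans (xt (3 * n) ^ e)); first by rewrite leq_exp2r.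
  by rewrite leq_pexp2l ?(leq_trans _ (x100 _)) // (leq_trans _ lt) // ltnW.
have subX : {subset primes (rep q e.+1) <= small_odd_primes}.
  move=> p pr; apply: small_support; first exact: sub.
  move: pr; rewrite mem_primes => /and3P[_ r0 /(dvdn_leq r0) le].
  apply: (leq_trans le); apply: leq_trans Y_large; rewrite ltnW //.
  by apply: (leq_trans (rep_ltX (leq_trans _ q3) (ltn0Sn e))) => //; rewrite leq_mul2l small.
split=> //; last by right.
rewrite q_up andbT; case/orP: cw => /andP[h1 _]; first exact: leq_ltn_trans h1.
(* The case left is that only [q ^ e] is in the window. As [e] is at most [smooth_exp X], a [q] not
   exceeding [xt t.-1] would have [q ^ e <= G (xt t.-1) = xt t], which is below the window. *)
have F_le := rep_smooth_exponent small_odd_primes_uniq small_odd_primesP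
  size_small_odd_primes X1 (leq_trans _ q3) (ltn0Sn e) subX.
rewrite ltnNge; apply/negP => q_le.
move: h1; rewrite ltnNge => /negP; apply; rewrite -(prednK t0) xtS.
have h100 := x100 t.-1; have pos := leq_trans (isT : 0 < 100) h100.
apply: (@leq_trans (xt t.-1 ^ smooth_exp X)).
  apply: (@leq_trans (xt t.-1 ^ e)); first by rewrite leq_exp2r.
  by rewrite leq_pexp2l // (leq_trans _ (F_le _)).
apply: (@leq_trans (tow 10 (xt t.-1))) => //; tow_bound.
apply: leq_trans (smooth_exp_tow h100 (X_xt _)) _; exact: tow_mono.
Qed.
(* Only every third window is used, so that the primes found are far apart. *)
Lemma interval_bounded : exists2 x, x <= Y & {in comps, forall c, c.1 ^ c.2 <= x}.
Proof.
have [/hasP[i]|/hasPn all_win] :=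
    boolP (has (fun i => ~~ has (in_window (xt (3 * i + 2))) comps) (iota 0 n)).
  rewrite mem_iota => /andP[_ i_n] /hasPn nwin; exists (xt (3 * i + 2)).
    by apply: xt_Y1; move: i_n; clear; lia.
  apply: dickson_window; first exact: leq_trans X0X (X_xt _).
    by move=> c /nwin; rewrite negb_or => /andP[].
  by move=> c /nwin; rewrite negb_or => /andP[].
exfalso; pose qs i := (window_comp (3 * i + 2)).1.
have qsP i : i < n -> [/\ qs i \in even_primes N, xt (3 * i + 1) < qs i <= xt (3 * i + 3) &
     (xt (3 * n) ^ long_exp K <= (logn (qs i) N).+1) \/
     {subset primes (rep (qs i) (logn (qs i) N).+1) <= small_odd_primes}].
  move=> i_n; have := @window_compP (3 * i + 2).
  have -> : (3 * i + 2).-1 = 3 * i + 1 by clear; lia.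
  have -> : (3 * i + 2).+1 = 3 * i + 3 by clear; lia.
  apply; [by rewrite addn2 | by move: i_n; clear; lia |].
  by apply/negPn/all_win; rewrite mem_iota.
have sep i j : i < j -> j < n -> qs i <= xt (3 * i + 3) /\ xt (3 * i + 4) < qs j.
  move=> ij jn; have [_ /andP[_ ->] _] := qsP i (ltn_trans ij jn).
  have [_ /andP[h _] _] := qsP j jn; split=> //; apply: leq_ltn_trans h.
  by apply: xt_mono; move: ij; clear; lia.
have step i : xt (3 * i + 4) = G (xt (3 * i + 3)) by rewrite addn4 addn3.
have lt_qs i j : i < j -> j < n -> qs i < qs j.
  move=> ij jn; have [h1 h2] := sep i j ij jn; apply: leq_ltn_trans h1 _; apply: leq_ltn_trans h2.
  by apply: xt_mono; rewrite leq_add2l.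
pose Q := [seq qs i | i <- iota 0 n].
have uQ : uniq Q.
  rewrite map_inj_in_uniq ?iota_uniq // => i j; rewrite !mem_iota !add0n => iN jN e.
  case: (ltngtP i j) => // ij; first by have := lt_qs _ _ ij jN; rewrite e ltnn.
  by have := lt_qs _ _ ij iN; rewrite e ltnn.
pose long q := (q <= 2 ^ xt (3 * n)) && (xt (3 * n) ^ long_exp K <= (logn q N).+1).
have szQ : size Q = n by rewrite size_map size_iota.
have QP q : q \in Q -> exists2 i, i < n & q = qs i.
  by case/mapP=> i; rewrite mem_iota => /andP[_ iN] ->; exists i.
have h1 : count long Q <= K * (2 * K).
  have lhx : long_height K <= xt (3 * n).
    apply: leq_trans (X_xt _); apply: leq_trans X0X.
    by apply: leq_trans (long_height_tow s100 K_le) _; apply: tow_mono.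
  apply: leq_trans (few_long_components oM oN sN a0 lhx); rewrite -!size_filter.
  apply: uniq_leq_size; first by rewrite filter_uniq.
  move=> q; rewrite mem_filter => /andP[lq /QP[i iN eq]].
  rewrite mem_filter; apply/andP; split=> //; rewrite eq.
  by have [h _ _] := qsP i iN.
have h2 : count (predC long) Q <= sep_classes X.
  rewrite -size_filter; set Q2 := [seq q <- Q | predC long q].
  have Q2P q : q \in Q2 -> exists2 i, i < n &
      q = qs i /\ {subset primes (rep q (logn q N).+1) <= small_odd_primes}.
    rewrite mem_filter => /andP[/= nl /QP[i iN eq]]; exists i => //; split=> //.
    have [_ /andP[_ q_le] [h|sub]] := qsP i iN; last by rewrite eq.
    case/negP: nl; rewrite /long {2}eq h andbT.
    apply: leq_trans (ltnW (self_lt_exp2 _)); rewrite eq; apply: (leq_trans q_le).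
    by apply: xt_mono; move: iN; clear; lia.
  apply: (@few_separated small_odd_primes Q2 (fun q => (logn q N).+1) X) => //.
  - exact: small_odd_primes_uniq.
  - exact: small_odd_primesP.
  - exact: size_small_odd_primes.
  - by rewrite filter_uniq.
  - move=> q q' /Q2P[i iN [-> _]] /Q2P[j jN [-> _]] lt.
    have ij : i < j.
      rewrite ltnNge leq_eqVlt; apply/negP => /orP[/eqP e|/lt_qs /(_ iN)]; last by rewrite ltnNge ltnW.
      by rewrite e ltnn in lt.
    have [u1 u2] := sep i j ij jN; apply: leq_trans (ltnW u2); rewrite step.
    have h100 := x100 (3 * i + 3).
    by tow_bound; apply: leq_trans (sep_exp_tow h100 (X_xt _)) _; apply: tow_mono.
  - move=> q /Q2P[i iN [-> _]]; have [_ /andP[h _] _] := qsP i iN; apply: leq_trans (ltnW h).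
    apply: (@leq_trans (tow 10 X)); last by apply: tow_mono => //; clear; lia.
    exact: (sep_start_tow (leq_trans s100 sX) (leqnn X)).
  - by move=> q /Q2P[i iN [-> _]]; have [/(even_primesP oM oN sN a0)[]] := qsP i iN.
  by move=> q /Q2P[i iN []].
have := count_predC long Q; rewrite szQ /num_windows.
by move: h1 h2; move: (count long Q) (count _ Q) (K * _) (sep_classes X); clear; lia.
Qed.
End Interval.

(** The number of windows grows with [X] through [sep_classes X], so the height of this tower is
    itself a tower in [X]. *)
Definition next_scale X := tow (tow 40 X) X.
(** One interval more than there are special values, of which there are at most [2 * s], so that one
    of the successive intervals contains none. *)
Definition comp_bound := iter (2 * s + 1) next_scale X0.

Lemma next_scale_large X : X0 <= X -> 2 * tow (10 * (3 * num_windows X).+1) X <= next_scale X.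
Proof.
move=> X0X; have sX : s <= X := leq_trans (leq_tow _ _) X0X.
have X100 := leq_trans s100 sX; have KX := leq_trans K_le sX.
have X4 : 4 <= X by apply: leq_trans X100.
apply: (@leq_trans (tow (10 * (3 * num_windows X).+1).+1 X)).
  by apply: tow_mul => //; apply: leq_trans (leq_tow _ _); apply: leq_trans X4.
apply: tow_mono => //; rewrite /num_windows; tow_bound.
by apply: leq_trans (sep_classes_tow X100 (leqnn X)) _; apply: tow_mono.
Qed.

Lemma comps_bounded : {in comps, forall c, c.1 ^ c.2 <= comp_bound}.
Proof.
pose Xs i := iter i next_scale X0.
have Xs_mono i j : i <= j -> Xs i <= Xs j.
  by move=> /subnK <-; elim: (j - i) => // d IH; apply: (leq_trans IH); apply: leq_tow.
have [i i_le free] := free_interval special_values Xs_mono.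
have X0i : X0 <= Xs i by apply: (Xs_mono 0).
have [x xY bnd] := interval_bounded X0i free (next_scale_large X0i).
move=> c /bnd /leq_trans; apply; apply: (leq_trans xY); apply: Xs_mono.
by have := size_special_values; move: i_le; clear; lia.
Qed.
End Windows.

(** * Computability and conclusion *)

Definition computable1 (g : nat -> nat) := computable (fun x : 1.-tuple nat => g (thead x)).

Lemma computable_proj n (i : 'I_n) : computable (fun x => tnth x i).
Proof. by exists (RProj i). Qed.

Lemma computable_succ : computable1 succn.
Proof. by exists RSucc. Qed.

Lemma computable_zero n : computable (fun _ : n.-tuple nat => 0).
Proof.
(* Composition with an empty family of inner functions is what raises the arity of [RZero] from 0 to
   [n]; the body of the family is never reached. *)
exists (RComp RZero (fun i : 'I_0 => RProj (let: Ordinal _ h := i in False_rect _ (notF h)))) => x /=.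
by exists [tuple]; split=> // -[].
Qed.

Lemma computable_comp m n (F : m.-tuple nat -> nat) (H : 'I_m -> n.-tuple nat -> nat) :
  computable F -> (forall i, computable (H i)) ->
  computable (fun x => F [tuple H i x | i < m]).
Proof.
move=> [f fP] /choice[h hP]; exists (RComp f h) => x /=.
by exists [tuple H i x | i < m]; split=> // i; rewrite tnth_mktuple.
Qed.

Lemma computable_comp1 n g (H : n.-tuple nat -> nat) : computable1 g -> computable H ->
  computable (fun x => g (H x)).
Proof.
move=> cg cH; have := computable_comp (H := fun _ => H) cg (fun _ => cH).
by congr computable; apply/funext => x /=; rewrite /thead tnth_mktuple.
Qed.

Lemma computable_iter2 g : computable1 g ->
  computable (fun x : 2.-tuple nat => iter (tnth x ord0) g (tnth x ord_max)).
Proof.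
(* The step function has the three arguments counter, previous value, parameter; index 1 selects the
   previous value. *)
move=> [f fP]; exists (RPrim (RProj ord0) (RComp f (fun _ => RProj (inord 1 : 'I_3)))) => x /=.
rewrite /thead; elim: (tnth x ord0) => [|j IH] /=.
  by rewrite !(tnth_nth 0) /= nth_behead.
exists (iter j g (tnth x ord_max)); split=> //.
exists [tuple iter j g (tnth x ord_max)]; split; last exact: fP.
by move=> i; rewrite !(tnth_nth 0) /= inordK //= (ord1 i).
Qed.

(** Iteration, addition and constants suffice below, because every bound has been rounded up to a
    tower: [tow] and [comp_bound] are iterates by definition. *)
Lemma computable_iter n g (c h : n.-tuple nat -> nat) : computable1 g ->
  computable c -> computable h -> computable (fun x => iter (c x) g (h x)).
Proof.
move=> cg cc ch; pose H (i : 'I_2) := if i == ord0 then c else h.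
have cH i : computable (H i) by rewrite /H; case: ifP.
have := computable_comp (computable_iter2 cg) cH.
by congr computable; apply/funext => x; rewrite !tnth_mktuple.
Qed.

Lemma computable_add n (c h : n.-tuple nat -> nat) : computable c -> computable h ->
  computable (fun x => c x + h x).
Proof.
move=> cc ch; have := computable_iter computable_succ cc ch.
by congr computable; apply/funext => x; rewrite iter_succn addnC.
Qed.

Lemma computable_const n c : computable (fun _ : n.-tuple nat => c).
Proof.
elim: c => [|c IH]; first exact: computable_zero.
exact: computable_comp1 computable_succ IH.
Qed.

Lemma computable1_id : computable1 id. Proof. exact: computable_proj. Qed.

Lemma computable_tow n (j h : n.-tuple nat -> nat) : computable j -> computable h ->
  computable (fun x => tow (j x) (h x)).
Proof.
move=> cj ch; apply: computable_iter => //.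
have dbl : computable1 (fun x => x + x) by apply: computable_add computable1_id computable1_id.
have := computable_iter dbl computable1_id (computable_const 1 1).
congr computable; apply/funext => x; elim: (thead x) => //= k ->.
by rewrite addnn -mul2n expnS.
Qed.

Lemma computable_comp_bound : computable1 comp_bound.
Proof.
apply: computable_iter.
- by apply: computable_tow computable1_id; apply: computable_tow computable1_id; apply: computable_const.
- apply: computable_add (computable_const _ _).
  have := computable_add computable1_id computable1_id.
  by congr computable; apply/funext => x; rewrite addnn mul2n.
by apply: computable_tow computable1_id; apply: computable_const.
Qed.

Definition pair_bound s := tow 10 (comp_bound s).

Lemma prime_decomp_bound n k W : 0 < n -> size (primes n) <= k -> 0 < W ->
  {in prime_decomp n, forall c, c.1 ^ c.2 <= W} -> n <= W ^ k.
Proof.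
move=> n0 szn W0 bnd; rewrite (prod_prime_decomp n0) big_seq.
apply: (@leq_trans (\prod_(c <- prime_decomp n | c \in prime_decomp n) W)).
  exact: leq_prod.
rewrite -big_seq big_const_seq count_predT iter_muln_1 leq_pexp2l //.
by move: szn; rewrite /primes size_map.
Qed.

Lemma pair_bounded a b k k' M N : 0 < a -> 0 < b -> admissible_pair a b k k' M N ->
  M <= pair_bound (a + b + k + k' + 100) /\ N <= pair_bound (a + b + k + k' + 100).
Proof.
move=> a0 b0 [[oM oN] sN sM _ omM]; set s := (X in pair_bound X).
have M0 : 0 < M by case: M oM {sN sM omM}. have N0 : 0 < N by case: N oN {sN sM}.
have s_large : a + b + k + 100 <= s by rewrite /s; clear; lia.
have bnd := comps_bounded oM oN sN sM a0 b0 omM s_large.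
set W := comp_bound s in bnd *.
have sW : s <= W.
  rewrite /W /comp_bound; apply: leq_trans (leq_tow 30 s) _.
  by elim: (2 * s + 1) => //= i IH; apply: (leq_trans IH); apply: leq_tow.
have W100 : 100 <= W by apply: leq_trans sW; rewrite leq_addl.
have kW : k <= W by apply: leq_trans sW; rewrite /s; clear; lia.
have aW : a <= W by apply: leq_trans sW; rewrite /s; clear; lia.
have MW : M <= W ^ k.
  apply: prime_decomp_bound => //; first exact: leq_trans W100.
  by move=> c cM; apply: bnd; rewrite mem_cat cM.
have Mt : M <= tow 4 W by apply: (leq_trans MW); tow_bound.
split; first by apply: (leq_trans Mt); apply: tow_mono.
(* Components alone do not bound [N], whose number of primes is not given; the equation
   [sigma N = a * M] transfers the bound from [M]. *)
apply: (@leq_trans (sigma N)).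
  by rewrite /sigma (big_rem N) /= ?leq_addr // -dvdn_divisors.
by rewrite sN /pair_bound -/W; tow_bound; apply: leq_trans Mt _; apply: tow_mono.
Qed.

Theorem theorem1p4 :
  (forall a b k k' : nat, 0 < a -> 0 < b -> 0 < k ->
     finite_set [set MN : nat * nat | admissible_pair a b k k' MN.1 MN.2]%classic) /\
  (exists C2 : 4.-tuple nat -> nat,
     computable C2 /\
     forall a b k k' : nat, 0 < a -> 0 < b -> 0 < k ->
     forall M N : nat, admissible_pair a b k k' M N ->
       M <= C2 [tuple a; b; k; k'] /\ N <= C2 [tuple a; b; k; k']).
Proof.
split.
  move=> a b k k' a0 b0 _; set B := pair_bound (a + b + k + k' + 100).
  apply: (@sub_finite_set _ _ (`I_B.+1 `*` `I_B.+1)%classic).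
    by move=> [M N] /= /(pair_bounded a0 b0)[]; rewrite !ltnS.
  by apply: finite_setX; apply: finite_II.
exists (fun x => pair_bound (tnth x (inord 0) + tnth x (inord 1) + tnth x (inord 2) + tnth x (inord 3) + 100)).
split.
  apply: computable_tow; first exact: computable_const.
  apply: computable_comp1 computable_comp_bound _.
  apply: computable_add; last exact: computable_const.
  by do 3 (apply: computable_add; last exact: computable_proj); apply: computable_proj.
move=> a b k k' a0 b0 _ M N adm.
by rewrite !(tnth_nth 0) !inordK //=; apply: pair_bounded adm.
Qed.
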